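(* Assume $T$ is a $\forall\exists$-axiomatizable theory of C*-algebras and $P$ is a property definable by uniform families of existential formulas such that $T$ has a model satisfying $P$. Let $\mathfrak T_T$ be the space of functionals defined in the context (with $\Sigma$ the set of all quantifier-free $\mathcal L^+$-sentences). (1) There exists a dense $G_\delta$ subset $\mathfrak G$ of $\mathfrak T_T$ such that every $s\in\mathfrak G$ determines a unique model $A_s$ of $T$ and an interpretation $\bar a_s$ of the constants $\bar c$ in $A_s$ such that each sort $S$ in $A_s$ is the closure of $\{a_j^S:j\in\mathbb N\}$ and $s=s_{A_s,\bar a_s}$. (2) The set $\mathfrak G_P:=\{s\in\mathfrak G:A_s\text{ has }P\}$ is a $G_\delta$ subset of $\mathfrak G$. (3) Furthermore, if $T$ is a complete theory then $\mathfrak G_P$ is dense in $\mathfrak G$.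
   Context: Continuous logic for C*-algebras (language $\mathcal L$). A C*-algebra $A$ is viewed as a metric structure whose sorts are the balls $B_n(A)=\{a:\|a\|\le n\}$, $n\in\mathbb N$, with metric $\|x-y\|$, and whose functions are the restrictions to these balls of $+,\cdot,{}^*$, scalar multiplication by each $\lambda\in\mathbb C$, the constant $0$ (and $1$ for unital algebras) and the inclusions $B_m\to B_n$. Terms are *-polynomials, atomic formulas are distances between terms, and formulas are obtained from atomic ones by applying continuous functions $f:\mathbb R^n\to\mathbb R$ and the quantifiers $\sup_x,\inf_x$ over a sort; quantifier-free formulas use no quantifiers; existential formulas are those of the form $\inf_{\bar x}\varphi$ with $\varphi$ quantifier-free and nonnegative; $\varphi^A(\bar a)$ denotes the value. A theory is a set of sentences; $A\models T$ if $\varphi^A=0$ for all $\varphi\in T$; $T$ is complete if any two models assign the same value to each sentence. $T$ is $\forall\exists$-axiomatizable if it has a set of axioms of the form $\sup_{\bar x}\inf_{\bar y}\varphi(\bar x,\bar y)$ with $\varphi$ quantifier-free and nonnegative. Uniform families. A countable set $\mathcal F$ of nonnegative-valued formulas in the same free variables is a uniform family with respect to a theory $T'$ if all its members satisfy $|\varphi(\bar x)-\varphi(\bar y)|\le u(d(\bar x,\bar y))$ in all models of $T'$ for a common uniform continuity modulus $u$. $P$ is definable by uniform families of existential formulas if there are a theory $T'$ and uniform families $\mathcal F_n$ ($n\in\mathbb N$) with respect to $T'$, consisting of existential formulas, such that $A$ has $P$ iff $A\models T'$ and $\inf_{\varphi\in\mathcal F_n}\varphi^A(\bar a)=0$ for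 all $n$ and all $\bar a$ of the appropriate sort. Forcing set-up. $\mathcal L^+$ is obtained from $\mathcal L$ by adding, for each sort $S$, new constant symbols $c_n^S$, $n\in\mathbb N$; its sentences have the form $\varphi(\bar c)$ with $\varphi(\bar x)$ an $\mathcal L$-formula and $\bar c$ a tuple of new constants. Let $\Sigma$ be the set of all quantifier-free $\mathcal L^+$-sentences, a real vector space with seminorm $\|\varphi(\bar c)\|_T=\sup_{A,\bar a}|\varphi(\bar a)^A|$ over models $A$ of $T$ and tuples $\bar a$ of the appropriate sort. Given $A\models T$ and an assignment $\bar a=(a_i^S)$ of elements $a_i^S$ of sort $S$ in $A$ to all constants $c_i^S$, define the functional $s_{A,\bar a}$ on $\Sigma$ by $s_{A,\bar a}(\varphi(\bar c))=\varphi(\bar a)^A$. Let $\mathfrak T_T=\{s_{A,\bar a}:A\models T,\ \bar a\text{ in }A\}$, a weak*-compact subset of the dual of $(\Sigma,\|\cdot\|_T)$, with the relative weak* topology. *)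

(* Defs.v *)
From HB Require Import structures.
From mathcomp Require Import all_boot all_order all_algebra.
From mathcomp Require Import all_classical all_reals all_analysis.
From mathcomp Require Import borel_hierarchy complex.
Set Implicit Arguments.
Unset Strict Implicit.
Unset Printing Implicit Defensive.
Import Order.TTheory GRing.Theory Num.Theory numFieldNormedType.Exports.
Local Open Scope classical_set_scope.
Local Open Scope ring_scope.

(* The boolean [u] selects the language: [u = true] is the language of unital
   C*-algebras, which has the constant 1, and [u = false] the one without 1. *)
Record cstarAlg (R : realType) (u : bool) := CstarAlg {
  carrier :> completeNormedModType R[i];
  cmul : carrier -> carrier -> carrier;
  cstar : carrier -> carrier;
  cone : u -> carrier;
  cmulA : forall x y z, cmul x (cmul y z) = cmul (cmul x y) z;
  cmulDl : forall x y z, cmul (x + y) z = cmul x z + cmul y z;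
  cmulDr : forall x y z, cmul x (y + z) = cmul x y + cmul x z;
  cmulZl : forall (l : R[i]) x y, cmul (l *: x) y = l *: cmul x y;
  cmulZr : forall (l : R[i]) x y, cmul x (l *: y) = l *: cmul x y;
  cstarK : forall x, cstar (cstar x) = x;
  cstarD : forall x y, cstar (x + y) = cstar x + cstar y;
  cstarZ : forall (l : R[i]) x, cstar (l *: x) = l^* *: cstar x;
  cstarM : forall x y, cstar (cmul x y) = cmul (cstar y) (cstar x);
  cnormM : forall x y, `|cmul x y| <= `|x| * `|y|;
  cnorm_star : forall x, `|cmul (cstar x) x| = `|x| ^+ 2;
  cmul1l : forall h x, cmul (cone h) x = x;
  cmul1r : forall h x, cmul x (cone h) = x
}.

(* The sort of index [n], a ball of the algebra. *)
Definition cball (R : realType) u (A : cstarAlg R u) (n : nat) : Type :=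
  {x : A | `|x| <= n%:R}.

(* [V n] is a type of symbols of sort [n]. The same syntax serves for formulas
   with free variables and for sentences with new constants: a symbol is one or
   the other according to what [V] is taken to be. *)
Definition symbols := nat -> Type.

Inductive term (R : realType) (u : bool) (V : symbols) : nat -> Type :=
| Sym n of V n : term R u V n
| Zero : term R u V 0
| One of u : term R u V 1
| Add m n of term R u V m & term R u V n : term R u V (m + n)
| Mul m n of term R u V m & term R u V n : term R u V (m * n)
| Star n of term R u V n : term R u V n
| Scale (l : R[i]) m n of `|l| * m%:R <= n%:R & term R u V m :
    term R u V n
| Incl m n of (m <= n)%N & term R u V m : term R u V n.

Definition nosyms : symbols := fun=> False.

Variant ext (V : symbols) (n : nat) : symbols :=
| Old m of V m : ext V n m
| New : ext V n n.

Fixpoint exts (V : symbols) (xs : seq nat) : symbols :=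
  if xs is n :: xs' then exts (ext V n) xs' else V.

(* [Sup n phi] binds the symbol [New] of sort [n] in [phi]. *)
Inductive formula (R : realType) (u : bool) (V : symbols) : Type :=
| Dist n of term R u V n & term R u V n
| Conn k (f : 'rV[R]_k -> R) of continuous f & ('I_k -> formula R u V)
| Sup n of formula R u (ext V n)
| Inf n of formula R u (ext V n).

Fixpoint sups (R : realType) u V (xs : seq nat) :
    formula R u (exts V xs) -> formula R u V :=
  if xs is n :: xs' then fun phi => Sup (@sups R u (ext V n) xs' phi) else id.

Fixpoint infs (R : realType) u V (xs : seq nat) :
    formula R u (exts V xs) -> formula R u V :=
  if xs is n :: xs' then fun phi => Inf (@infs R u (ext V n) xs' phi) else id.

Fixpoint qfree (R : realType) u V (phi : formula R u V) : Prop :=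
  match phi with
  | Dist _ _ _ => True
  | Conn k _ _ args => forall i : 'I_k, qfree (args i)
  | Sup _ _ | Inf _ _ => False
  end.

Definition sentence R u := formula R u nosyms.

Definition assignment (R : realType) u (V : symbols) (A : cstarAlg R u) :=
  forall n, V n -> cball A n.

Definition noassign (R : realType) u (A : cstarAlg R u) : assignment nosyms A :=
  fun _ v => match v with end.

Definition extend (R : realType) u V (A : cstarAlg R u) (a : assignment V A)
    n (x : cball A n) : assignment (ext V n) A :=
  fun m v => match v in ext _ _ m' return cball A m' with
             | Old m' w => a m' w
             | New => x
             end.

Fixpoint teval (R : realType) u V (A : cstarAlg R u) (a : assignment V A)
    n (t : term R u V n) : A :=
  match t with
  | Sym m v => sval (a m v)
  | Zero => 0
  | One h => cone A h
  | Add _ _ t1 t2 => teval a t1 + teval a t2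
  | Mul _ _ t1 t2 => cmul (teval a t1) (teval a t2)
  | Star _ t1 => cstar (teval a t1)
  | Scale l _ _ _ t1 => l *: teval a t1
  | Incl _ _ _ t1 => teval a t1
  end.

(* The library norm of a complex vector space takes values in [R[i]]; they are
   nonnegative reals, so the real part loses nothing. *)
Definition rnorm (R : realType) (V : normedModType R[i]) (x : V) : R :=
  complex.Re `|x|.

Lemma cstar_norm (R : realType) u (A : cstarAlg R u) (x : A) : `|cstar x| = `|x|.
Proof.
have le y : `|y : A| <= `|cstar y|.
  have [->|y0] := eqVneq y 0; first by rewrite normr0.
  rewrite -(@ler_pM2r _ `|y|) ?normr_gt0// -expr2 -cnorm_star.
  exact: cnormM.
by apply/eqP; rewrite eq_le le -{2}(cstarK x) le.
Qed.

Lemma norm_teval (R : realType) u V (A : cstarAlg R u) (a : assignment V A) n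
  (t : term R u V n) : `|teval a t| <= n%:R.
Proof.
elim: t => /= {n} [n v||h|m n s IHs t IHt|m n s IHs t IHt|n t IHt|l m n lmn t IHt|m n mn t IHt].
- by case: (a n v).
- by rewrite normr0.
- have := cnorm_star (cone A h).
  have -> : cstar (cone A h) = cone A h.
    by rewrite -[LHS](cmul1r h) -{2}(cstarK (cone A h)) -cstarM cmul1r cstarK.
  rewrite cmul1l; have [->|x0] := eqVneq (cone A h) 0; first by rewrite normr0 ler01.
  by rewrite expr2 -{1}[`|_|]mulr1 => /mulfI <- //; rewrite normr_eq0.
- by rewrite natrD (le_trans (ler_normD _ _))// lerD.
- by rewrite natrM (le_trans (cnormM _ _))// ler_pM.
- by rewrite cstar_norm.
- by apply: le_trans lmn; rewrite normrZ ler_pM.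
- by rewrite (le_trans IHt)// ler_nat.
Qed.

(* The suprema and infima are of nonempty bounded sets of reals: a sort contains
   0, and the values of a formula range in a bounded interval. *)
Fixpoint feval (R : realType) u V (A : cstarAlg R u) (a : assignment V A)
    (phi : formula R u V) : R :=
  match phi with
  | Dist _ t1 t2 => rnorm (teval a t1 - teval a t2)
  | Conn k f _ args => f (\row_(i < k) feval a (args i))
  | Sup n psi => sup (range (fun x : cball A n => feval (extend a x) psi))
  | Inf n psi => inf (range (fun x : cball A n => feval (extend a x) psi))
  end.

Definition sentval (R : realType) u (A : cstarAlg R u) (phi : sentence R u) : R :=
  feval (noassign A) phi.

Definition nonneg (R : realType) u V (phi : formula R u V) : Prop :=
  forall (A : cstarAlg R u) (a : assignment V A), 0 <= feval a phi.

Definition theory R u := set (sentence R u).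

Definition models (R : realType) u (A : cstarAlg R u) (T : theory R u) : Prop :=
  forall phi, T phi -> sentval A phi = 0.

Definition complete_theory (R : realType) u (T : theory R u) : Prop :=
  forall A B : cstarAlg R u, models A T -> models B T ->
  forall phi : sentence R u, sentval A phi = sentval B phi.

Definition AE_sentence (R : realType) u (phi : sentence R u) : Prop :=
  exists (xs ys : seq nat) (psi : formula R u (exts (exts nosyms xs) ys)),
    [/\ qfree psi, nonneg psi & phi = sups (infs psi)].

Definition AE_axiomatizable (R : realType) u (T : theory R u) : Prop :=
  exists2 T0 : theory R u, (forall phi, T0 phi -> AE_sentence phi) &
    forall A : cstarAlg R u, models A T <-> models A T0.

Definition existential (R : realType) u V (phi : formula R u V) : Prop :=
  exists (ys : seq nat) (psi : formula R u (exts V ys)),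
    [/\ qfree psi, nonneg psi & phi = infs psi].

(* The maximum of the distances of the entries, when [V] is a finite tuple. *)
Definition adist (R : realType) u V (A : cstarAlg R u) (a b : assignment V A) : R :=
  sup [set r | exists n (v : V n), r = rnorm (sval (a n v) - sval (b n v))].

Definition modulus (R : realType) (w : R -> R) : Prop :=
  [/\ w 0 = 0, forall t, 0 <= t -> 0 <= w t & w t @[t --> 0^'+] --> 0].

Definition uniform_family (R : realType) u (T : theory R u) (xs : seq nat)
    (F : set (formula R u (exts nosyms xs))) : Prop :=
  [/\ countable F, forall phi, F phi -> nonneg phi &
    exists2 w : R -> R, modulus w & forall phi, F phi ->
      forall (A : cstarAlg R u), models A T ->
      forall a b : assignment (exts nosyms xs) A,
        `|feval a phi - feval b phi| <= w (adist a b)].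

(* The infimum is taken in the extended reals, so that it is not 0 when the
   family is empty. *)
Definition definable (R : realType) u (P : cstarAlg R u -> Prop) : Prop :=
  exists (T' : theory R u) (xs : nat -> seq nat)
         (F : forall n, set (formula R u (exts nosyms (xs n)))),
    [/\ forall n, uniform_family T' (F n),
        forall n phi, F n phi -> existential phi &
        forall A : cstarAlg R u, P A <-> models A T' /\
          forall n (a : assignment (exts nosyms (xs n)) A),
            ereal_inf [set (feval a phi)%:E | phi in F n] = 0%E].

(* The new constants: [nat] many of each sort. *)
Definition consts : symbols := fun=> nat.

Definition Sigma R u := {phi : formula R u consts | qfree phi}.

Definition functional (R : realType) u (A : cstarAlg R u)
  (a : assignment consts A) : {ptws Sigma R u -> R} := fun phi => feval a (sval phi).

Definition Sigma_norm (R : realType) u (T : theory R u) (phi : Sigma R u) : \bar R :=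
  ereal_sup [set z | exists (A : cstarAlg R u) (a : assignment consts A),
    models A T /\ z = (`|feval a (sval phi)|)%:E].

Lemma Sigma_lin_continuous (R : realType) (k l : R) :
  continuous (fun v : 'rV[R]_2 => k * v 0 0 + l * v 0 1).
Proof.
move=> v; have c (m : R) (j : 'I_2) :
    (fun w : 'rV[R]_2 => m * w 0 j) @ v --> m * v 0 j.
  exact: (cvgM (cvg_cst m) (@coord_continuous R 1 2 0 j v)).
exact: (cvgD (c k 0) (c l 1)).
Qed.

Definition Sigma_lin (R : realType) u (k l : R) (phi psi : Sigma R u) : Sigma R u.
Proof.
exists (Conn (@Sigma_lin_continuous R k l)
  (fun i : 'I_2 => sval (if i == 0 then phi else psi))) => /= i.
by case: ifP => _; exact: svalP.
Defined.

(* Sentences are kept as syntax, not identified when equal as functions; bounded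
   functionals respect that identification. The weak* topology is the one of
   pointwise convergence on [Sigma], whence the ambient space. *)
Definition Sigma_dual (R : realType) u (T : theory R u) : set {ptws Sigma R u -> R} :=
  [set s | (forall k l phi psi, s (Sigma_lin k l phi psi) = k * s phi + l * s psi) /\
    exists2 M : R, 0 <= M & forall phi, (`|s phi|%:E <= M%:E * Sigma_norm T phi)%E].

Definition TT (R : realType) u (T : theory R u) : set {ptws Sigma R u -> R} :=
  [set s | exists (A : cstarAlg R u) (a : assignment consts A),
    models A T /\ s = functional a].

Lemma TT_Sigma_dual (R : realType) u (T : theory R u) : TT T `<=` Sigma_dual T.
Proof.
move=> _ [A [a [mA ->]]]; split=> [k l phi psi|].
  by rewrite /functional /= !mxE.
exists 1 => // phi; rewrite mul1e; apply: ereal_sup_ubound.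
by exists A, a.
Qed.

Definition sortwise_dense (R : realType) u (A : cstarAlg R u)
    (a : assignment consts A) : Prop :=
  forall n, closure (range (fun j : nat => sval (a n j))) =
            [set x : A | `|x| <= n%:R].

Definition cstar_iso (R : realType) u (A B : cstarAlg R u) (f : A -> B) : Prop :=
  [/\ bijective f, linear f,
      (forall x y, f (cmul x y) = cmul (f x) (f y)) /\
        (forall x, f (cstar x) = cstar (f x)),
      forall h, f (cone A h) = cone B h &
      forall x, rnorm (f x) = rnorm x].

Definition generated_by (R : realType) u (T : theory R u)
    (s : {ptws Sigma R u -> R}) (A : cstarAlg R u) (a : assignment consts A) :=
  [/\ models A T, sortwise_dense a & s = functional a].

(* Main.v *)
(* A functional is generic if it comes from a model whose sorts are the closures of
   the constants. For models generated by the constants this amounts, up to a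
   countable dense family of terms and of axioms, to open conditions, so the generic
   functionals form a G-delta; they are dense by the downward Loewenheim-Skolem
   theorem.

   The theory in a definition by uniform families is arbitrary, so that the models
   satisfying it need not define a G-delta set of generic functionals. But the
   space of functionals is compact, by ultraproducts, hence Baire, and on the
   functionals of densely interpreted constants a quantifier is a countable supremum
   or infimum: every formula is thus continuous off a meager set. The set of generic
   functionals is therefore shrunk to a dense G-delta on which countably many
   sentences, dense in the theory, are continuous. The existential conditions are
   open in terms of the constants.

   If the theory is complete, its models take the same values on sentences, so that
   every functional is a limit of functionals of a fixed model with the property,
   and passing to separable elementary subalgebras keeps the property. *)
From Pilot Require Import Defs.
From HB Require Import structures.
From mathcomp Require Import all_boot all_order all_algebra.
From mathcomp Require Import all_classical all_reals all_analysis.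
From mathcomp Require Import borel_hierarchy complex.
From mathcomp Require Import lra.
(* [sups] and [infs] are those of the formulas, not those of sequences. *)
Import Pilot.Defs.
Set Implicit Arguments.
Unset Strict Implicit.
Unset Printing Implicit Defensive.
Import Order.TTheory GRing.Theory Num.Theory numFieldNormedType.Exports.
Local Open Scope classical_set_scope.
Local Open Scope ring_scope.

(** A functional records quantifier-free values only. It neither determines the model it comes from
    nor bounds its size, so the model of a generic functional is rebuilt as the closure of the
    constants inside an arbitrary one. Hence everything must be a strict inequality between values
    at constants: an axiom [sup inf] holds in that closure iff, for each outer tuple of constants
    and each tolerance, some inner tuple of constants meets the tolerance. This is open for each
    outer tuple, and a further alternation of quantifiers would break it. The property has the same
    shape, the choice of a member of the family joining the choice of the witnesses; the common
    modulus then carries smallness from tuples of constants to all tuples. Countability is not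
    automatic: connectives are arbitrary continuous functions and scalars arbitrary complex numbers.
    It comes from countably many codes that approximate terms and formulas uniformly over all
    algebras. The dense G-delta is chosen after the property, since the sentences to be made
    continuous on it come from the theory in the definition of the property. *)

Section rnorm.
Context {R : realType}.

Definition cabs (l : R[i]) : R := complex.Re `|l|.

Lemma normC_cabs (l : R[i]) : `|l| = (cabs l)%:C%C.
Proof. by rewrite /cabs RRe_real// normr_real. Qed.

Lemma cabs_real (r : R) : cabs r%:C%C = `|r|.
Proof. by rewrite /cabs normc_def /= expr0n /= addr0 sqrtr_sqr. Qed.

Lemma cabs_ge0 (l : R[i]) : 0 <= cabs l.
Proof. by rewrite -ler0c -normC_cabs. Qed.

Variable V : normedModType R[i].
Implicit Types x y : V.

Lemma normE x : `|x| = (rnorm x)%:C%C.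
Proof. by rewrite /rnorm RRe_real// normr_real. Qed.

Lemma rnorm_ge0 x : 0 <= rnorm x.
Proof. by rewrite -ler0c -normE. Qed.

Lemma rnorm0 : rnorm (0 : V) = 0.
Proof. by rewrite /rnorm normr0. Qed.

Lemma rnorm0_eq0 x : rnorm x = 0 -> x = 0.
Proof. by move=> h; apply/eqP; rewrite -normr_eq0 normE h. Qed.

Lemma rnormD x y : rnorm (x + y) <= rnorm x + rnorm y.
Proof. by rewrite -lecR rmorphD/= -!normE ler_normD. Qed.

Lemma rnormN x : rnorm (- x) = rnorm x.
Proof. by rewrite /rnorm normrN. Qed.

Lemma rnormB x y : rnorm (x - y) = rnorm (y - x).
Proof. by rewrite -rnormN opprB. Qed.

Lemma rnorm_triangle y x z : rnorm (x - z) <= rnorm (x - y) + rnorm (y - z).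
Proof. by rewrite (le_trans _ (rnormD _ _))// addrA subrK. Qed.

Lemma rnorm_dist x y : `|rnorm x - rnorm y| <= rnorm (x - y).
Proof.
rewrite ler_norml; have h1 := rnormD (x - y) y; have h2 := rnormD (y - x) x.
by rewrite !subrK in h1 h2; rewrite (rnormB y) in h2; apply/andP; split; lra.
Qed.

Lemma rnormZ l x : rnorm (l *: x) = cabs l * rnorm x.
Proof. by apply: complexI; rewrite rmorphM/= -!normE -normC_cabs normrZ. Qed.

Lemma normr_leN x n : (`|x| <= n%:R) = (rnorm x <= n%:R).
Proof. by rewrite normE -lecR rmorph_nat. Qed.

End rnorm.

Lemma rnorm_cmul (R : realType) u (A : cstarAlg R u) (x y : A) :
  rnorm (cmul x y) <= rnorm x * rnorm y.
Proof. by rewrite -lecR rmorphM/= -!normE cnormM. Qed.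

Lemma rnorm_cstar (R : realType) u (A : cstarAlg R u) (x : A) :
  rnorm (cstar x) = rnorm x.
Proof. by rewrite /rnorm cstar_norm. Qed.

Lemma rnorm_cstar_mul (R : realType) u (A : cstarAlg R u) (x : A) :
  rnorm (cmul (cstar x) x) = rnorm x ^+ 2.
Proof. by apply: complexI; rewrite rmorphXn/= -!normE cnorm_star. Qed.

Lemma cmulBl (R : realType) u (A : cstarAlg R u) (x y z : A) :
  cmul (x - y) z = cmul x z - cmul y z.
Proof. by rewrite cmulDl -scaleN1r cmulZl scaleN1r. Qed.

Lemma cmulBr (R : realType) u (A : cstarAlg R u) (x y z : A) :
  cmul x (y - z) = cmul x y - cmul x z.
Proof. by rewrite cmulDr -scaleN1r cmulZr scaleN1r. Qed.

Lemma cstarB (R : realType) u (A : cstarAlg R u) (x y : A) :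
  cstar (x - y) = cstar x - cstar y.
Proof. by rewrite cstarD -scaleN1r cstarZ rmorphN1 scaleN1r. Qed.

Lemma geometric_cvg (R : realType) (V : completeNormedModType R[i]) (x : nat -> V) :
  (forall k, rnorm (x k.+1 - x k) <= 2^-1 ^+ k) ->
  exists z, forall k, rnorm (x k - z) <= 2 * 2^-1 ^+ k.
Proof.
move=> hx.
(* The bound is the exact sum of [2^-1 ^+ i] for [k <= i < k + m]; the plain bound [2 * 2^-1 ^+ k]
   would not pass the induction step. *)
have hm k m : rnorm (x (k + m)%N - x k) <= 2 * 2^-1 ^+ k - 2 * 2^-1 ^+ (k + m)%N.
  elim: m => [|m IH]; first by rewrite addn0 !subrr rnorm0.
  rewrite addnS (le_trans (rnorm_triangle (x (k + m)%N) _ _))//.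
  have := hx (k + m)%N; rewrite exprSr => h.
  by have := lerD h IH; rewrite -[X in _ <= X -> _]/(_) => /le_trans; apply; lra.
have pos k : 0 < 2^-1 ^+ k :> R by rewrite exprn_gt0// invr_gt0.
have small (e : R) : 0 < e -> \forall k \near \oo, 2 * 2^-1 ^+ k < e.
  move=> e0; have /cvgrPdist_lt /(_ e e0) : (fun k => 2 * 2^-1 ^+ k : R) @ \oo --> 0.
    rewrite -[0](mulr0 2); apply: cvgM; first exact: cvg_cst.
    by apply: cvg_expr; rewrite ger0_norm ?invr_ge0// invf_lt1// ltr1n.
  by apply: filterS => k; rewrite sub0r normrN ger0_norm// ltW// mulr_gt0.
have /cauchy_cvgP xc : cauchy (x @ \oo).
  apply: cauchy_exP => e e0.
  have [e1 e1E] : exists e1, e = e1%:C%C.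
    by apply/complex_realP; rewrite ger0_real// ltW.
  have e10 : 0 < e1 by rewrite e1E ltcR in e0.
  have [k _ /(_ k (leqnn _)) kP] := small _ e10.
  exists (x k); exists k => // m /= /subnKC <-.
  rewrite -ball_normE/= normE e1E ltcR rnormB (le_lt_trans (hm _ _))//.
  by rewrite (le_lt_trans _ kP)// lerBlDr lerDl mulr_ge0// ltW.
exists (lim (x @ \oo)) => k; apply/ler_addgt0Pr => e e0.
have /cvgrPdist_lt/(_ e%:C%C) : x @ \oo --> lim (x @ \oo) by [].
rewrite ltcR => /(_ e0) [m _ /(_ (k + m)%N)] /=.
rewrite leq_addl normE ltcR rnormB => /(_ isT) h.
apply: le_trans (rnorm_triangle (x (k + m)%N) _ _) _.
apply: lerD; last exact: ltW.
rewrite rnormB (le_trans (hm _ _))// lerBlDr lerDl mulr_ge0// ltW//.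
Qed.

(** * Quotients by null vectors, closed subalgebras and ultraproducts *)

(* The algebraic laws hold on the whole carrier and the analytic ones on [pset]
   only, so that closed subalgebras and ultraproducts are both instances. *)
Record preCstar (R : realType) (u : bool) := PreCstar {
  pcar : lmodType R[i];
  pset : set pcar;
  pnorm : pcar -> R;
  pmul : pcar -> pcar -> pcar;
  pstar : pcar -> pcar;
  pone : u -> pcar;
  pset0 : pset 0;
  psetD : forall x y, pset x -> pset y -> pset (x + y);
  psetZ : forall (l : R[i]) x, pset x -> pset (l *: x);
  psetM : forall x y, pset x -> pset y -> pset (pmul x y);
  psetS : forall x, pset x -> pset (pstar x);
  pset1 : forall h, pset (pone h);
  pmulA : forall x y z, pmul x (pmul y z) = pmul (pmul x y) z;
  pmulDl : forall x y z, pmul (x + y) z = pmul x z + pmul y z;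
  pmulDr : forall x y z, pmul x (y + z) = pmul x y + pmul x z;
  pmulZl : forall (l : R[i]) x y, pmul (l *: x) y = l *: pmul x y;
  pmulZr : forall (l : R[i]) x y, pmul x (l *: y) = l *: pmul x y;
  pstarK : forall x, pstar (pstar x) = x;
  pstarD : forall x y, pstar (x + y) = pstar x + pstar y;
  pstarZ : forall (l : R[i]) x, pstar (l *: x) = l^* *: pstar x;
  pstarM : forall x y, pstar (pmul x y) = pmul (pstar y) (pstar x);
  pmul1l : forall h x, pmul (pone h) x = x;
  pmul1r : forall h x, pmul x (pone h) = x;
  pnorm_ge0 : forall x, pset x -> 0 <= pnorm x;
  pnormD : forall x y, pset x -> pset y -> pnorm (x + y) <= pnorm x + pnorm y;
  pnormZ : forall (l : R[i]) x, pset x -> pnorm (l *: x) = cabs l * pnorm x;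
  pnormM : forall x y, pset x -> pset y -> pnorm (pmul x y) <= pnorm x * pnorm y;
  pnormS : forall x, pset x -> pnorm (pmul (pstar x) x) = pnorm x ^+ 2;
  pcomplete : forall x : nat -> pcar, (forall k, pset (x k)) ->
    (forall k, pnorm (x k.+1 - x k) < 2^-1 ^+ k) ->
    exists2 z, pset z & forall k, pnorm (x k - z) <= 2 * 2^-1 ^+ k
}.

Section preCstar_theory.
Variables (R : realType) (u : bool) (E : preCstar R u).
Implicit Types x y z : pcar E.
Local Notation S := (@pset R u E).
Local Notation p := (@pnorm R u E).
Local Hint Resolve pset0 psetD psetZ psetM psetS pset1 : core.

Lemma psetN x : S x -> S (- x).
Proof. by rewrite -scaleN1r; auto. Qed.

Lemma psetB x y : S x -> S y -> S (x - y).
Proof. by move=> *; apply: psetD => //; exact: psetN. Qed.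
Local Hint Resolve psetN psetB : core.

Lemma pnorm0 : p 0 = 0.
Proof. by rewrite -(scale0r 0) pnormZ// /cabs normr0 mul0r. Qed.

Lemma pnormN x : S x -> p (- x) = p x.
Proof. by move=> Sx; rewrite -scaleN1r pnormZ// /cabs normrN1 mul1r. Qed.

Lemma pnormBC x y : S x -> S y -> p (x - y) = p (y - x).
Proof. by move=> Sx Sy; rewrite -pnormN ?opprB; auto. Qed.

Lemma pnorm_triangle y x z : S x -> S y -> S z ->
  p (x - z) <= p (x - y) + p (y - z).
Proof. by move=> Sx Sy Sz; rewrite -{1}(subrK y x) -addrA pnormD; auto. Qed.

Lemma pnorm_le0 x : S x -> p x <= 0 -> p x = 0.
Proof. by move=> Sx h; apply/eqP; rewrite eq_le h pnorm_ge0. Qed.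

Lemma pmulBl x y z : pmul (x - y) z = pmul x z - pmul y z.
Proof. by rewrite pmulDl -scaleN1r pmulZl scaleN1r. Qed.

Lemma pmulBr x y z : pmul x (y - z) = pmul x y - pmul x z.
Proof. by rewrite pmulDr -scaleN1r pmulZr scaleN1r. Qed.

Lemma pstarB x y : pstar (x - y) = pstar x - pstar y.
Proof. by rewrite pstarD -scaleN1r pstarZ rmorphN1 scaleN1r. Qed.

(** The C*-identity and submultiplicativity give [p y ^+ 2 <= p (pstar y) * p y]; null vectors are
    treated apart, as [p y] is cancelled. *)
Lemma pnorm_star x : S x -> p (pstar x) = p x.
Proof.
have le y : S y -> p y <= p (pstar y).
  move=> Sy; have := pnorm_ge0 Sy; rewrite le_eqVlt => /orP[/eqP <-|y0].
    by rewrite pnorm_ge0; auto.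
  by rewrite -(ler_pM2r y0) -expr2 -pnormS// pnormM; auto.
move=> Sx; apply/eqP; rewrite eq_le le// andbT.
by rewrite (le_trans (le _ (psetS Sx)))// pstarK.
Qed.

(* The quotient by null vectors is carried by canonical representatives. *)
Definition pclass x : pred (pcar E) := fun y => `[< S y /\ p (x - y) = 0 >].
Definition prepr x := choose (pclass x) x.

Lemma pclass_refl x : S x -> pclass x x.
Proof. by move=> Sx; apply/asboolP; rewrite subrr pnorm0. Qed.

Lemma prepr_class x : S x -> S (prepr x) /\ p (x - prepr x) = 0.
Proof.
by move=> Sx; have /asboolP := chooseP (pclass_refl Sx).
Qed.

Lemma prepr_eq x y : S x -> S y -> p (x - y) = 0 -> prepr x = prepr y.
Proof.
move=> Sx Sy xy; have E1 : pclass x =1 pclass y.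
  move=> z; apply/asboolP/asboolP => -[Sz h]; split=> //; apply: pnorm_le0; auto.
    by rewrite (le_trans (pnorm_triangle (y:=x) _ _ _))// (pnormBC Sy Sx) xy h addr0.
  by rewrite (le_trans (pnorm_triangle (y:=y) _ _ _))// xy h addr0.
(* Both choices now use one predicate but different defaults, which do not matter because both
   defaults satisfy it. *)
rewrite /prepr (eq_choose E1); apply: choose_id; last exact: pclass_refl.
by rewrite -E1 pclass_refl.
Qed.

Lemma prepr_id x : S x -> prepr (prepr x) = prepr x.
Proof.
by move=> Sx; have [Sr h] := prepr_class Sx; apply/esym/prepr_eq.
Qed.

Record pquot := PQuot { pqval : pcar E ; _ : `[< S pqval /\ prepr pqval = pqval >] }.
HB.instance Definition _ := [isSub for pqval].
HB.instance Definition _ := [Choice of pquot by <:].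

Lemma pmk_subproof x : S x -> `[< S (prepr x) /\ prepr (prepr x) = prepr x >].
Proof.
move=> Sx; apply/asboolP; split; last exact: prepr_id.
by case: (prepr_class Sx).
Qed.

Definition pmk0 : pquot := PQuot (pmk_subproof (@pset0 _ _ E)).
Definition pmk x : pquot := insubd pmk0 (prepr x).

Lemma val_pmk x : S x -> pqval (pmk x) = prepr x.
Proof.
by move=> Sx; rewrite /pmk -[pqval _]/(val _) val_insubd pmk_subproof.
Qed.

Lemma pqvalS q : S (pqval q).
Proof. by case: q => x /= /asboolP[]. Qed.

Lemma pqvalK q : pmk (pqval q) = q.
Proof.
by apply: val_inj; rewrite /= val_pmk ?pqvalS//; case: q => x /= /asboolP[].
Qed.
Local Hint Resolve pqvalS : core.

Lemma pmk_eq x y : S x -> S y -> p (x - y) = 0 -> pmk x = pmk y.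
Proof. by move=> Sx Sy h; apply: val_inj; rewrite /= !val_pmk// (prepr_eq Sx Sy). Qed.

Lemma pmkP x : S x -> p (pqval (pmk x) - x) = 0.
Proof.
move=> Sx; rewrite val_pmk//; have [Sr h] := prepr_class Sx.
by rewrite pnormBC.
Qed.

Lemma pmkE q : exists2 x, S x & q = pmk x.
Proof. by exists (pqval q) => //; rewrite pqvalK. Qed.

Definition pqadd q r := pmk (pqval q + pqval r).
Definition pqopp q := pmk (- pqval q).
Definition pqscale (l : R[i]) q := pmk (l *: pqval q).
Definition pqmul q r := pmk (pmul (pqval q) (pqval r)).
Definition pqstar q := pmk (pstar (pqval q)).
Definition pqone (h : u) := pmk (pone E h).
Definition pqnorm q := p (pqval q).

Lemma pmkD x y : S x -> S y -> pqadd (pmk x) (pmk y) = pmk (x + y).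
Proof.
move=> Sx Sy; apply: pmk_eq; auto; apply: pnorm_le0; auto.
rewrite opprD addrACA (le_trans (pnormD _ _)) ?pmkP ?addr0//; auto.
Qed.

Lemma pmkZ l x : S x -> pqscale l (pmk x) = pmk (l *: x).
Proof.
move=> Sx; apply: pmk_eq; auto; apply: pnorm_le0; auto.
by rewrite -scalerBr pnormZ ?pmkP ?mulr0//; auto.
Qed.

Lemma pmkN x : S x -> pqopp (pmk x) = pmk (- x).
Proof. by move=> Sx; rewrite -scaleN1r -pmkZ// /pqscale scaleN1r. Qed.

Lemma pmkM x y : S x -> S y -> pqmul (pmk x) (pmk y) = pmk (pmul x y).
Proof.
move=> Sx Sy; apply: pmk_eq; auto; apply: pnorm_le0; auto.
apply: le_trans (@pnorm_triangle (pmul (pqval (pmk x)) y) _ _ _ _ _) _; auto.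
rewrite -pmulBr -pmulBl (le_trans (lerD (pnormM _ _) (pnormM _ _))) ?pmkP//; auto.
by rewrite mulr0 mul0r addr0.
Qed.

Lemma pmkS x : S x -> pqstar (pmk x) = pmk (pstar x).
Proof.
move=> Sx; apply: pmk_eq; auto; apply: pnorm_le0; auto.
by rewrite -pstarB pnorm_star ?pmkP//; auto.
Qed.

Lemma pmk_norm x : S x -> pqnorm (pmk x) = p x.
Proof.
move=> Sx; have h := pmkP Sx; apply/eqP; rewrite eq_le; apply/andP; split.
  have := @pnormD _ _ E (pqval (pmk x) - x) x.
  by rewrite subrK h add0r; apply; auto.
have := @pnormD _ _ E (x - pqval (pmk x)) (pqval (pmk x)).
by rewrite subrK pnormBC// h add0r; apply; auto.
Qed.

Lemma pqaddA : associative pqadd.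
Proof.
move=> q r s; have [x Sx ->] := pmkE q; have [y Sy ->] := pmkE r.
by have [z Sz ->] := pmkE s; rewrite !pmkD ?addrA; auto.
Qed.

Lemma pqaddC : commutative pqadd.
Proof. by move=> q r; rewrite /pqadd addrC. Qed.

Lemma pqadd0 : left_id (pmk 0) pqadd.
Proof. by move=> q; have [x Sx ->] := pmkE q; rewrite pmkD// add0r. Qed.

Lemma pqaddN : left_inverse (pmk 0) pqopp pqadd.
Proof.
by move=> q; have [x Sx ->] := pmkE q; rewrite pmkN// pmkD ?addNr; auto.
Qed.

HB.instance Definition _ :=
  GRing.isZmodule.Build pquot pqaddA pqaddC pqadd0 pqaddN.

Lemma pqscaleA a b q : pqscale a (pqscale b q) = pqscale (a * b) q.
Proof. by have [x Sx ->] := pmkE q; rewrite !pmkZ ?scalerA; auto. Qed.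

Lemma pqscale1 : left_id 1 pqscale.
Proof. by move=> q; have [x Sx ->] := pmkE q; rewrite pmkZ ?scale1r. Qed.

Lemma pqscaleDr : right_distributive pqscale +%R.
Proof.
move=> a q r; have [x Sx ->] := pmkE q; have [y Sy ->] := pmkE r.
change (pqscale a (pqadd (pmk x) (pmk y)) =
  pqadd (pqscale a (pmk x)) (pqscale a (pmk y))).
by rewrite pmkD// !pmkZ ?pmkD ?scalerDr//; auto.
Qed.

Lemma pqscaleDl q : {morph pqscale^~ q : a b / a + b}.
Proof.
move=> a b; have [x Sx ->] := pmkE q.
change (pqscale (a + b) (pmk x) = pqadd (pqscale a (pmk x)) (pqscale b (pmk x))).
by rewrite !pmkZ ?pmkD ?scalerDl//; auto.
Qed.

HB.instance Definition _ := GRing.Zmodule_isLmodule.Build R[i] pquot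
  pqscaleA pqscale1 pqscaleDr pqscaleDl.

Lemma pqD x y : S x -> S y -> pmk x + pmk y = pmk (x + y).
Proof. exact: pmkD. Qed.
Lemma pqN x : S x -> - pmk x = pmk (- x).
Proof. exact: pmkN. Qed.
Lemma pqB x y : S x -> S y -> pmk x - pmk y = pmk (x - y).
Proof. by move=> Sx Sy; rewrite pqN// pqD//; auto. Qed.
Lemma pqZ l x : S x -> l *: pmk x = pmk (l *: x).
Proof. exact: pmkZ. Qed.
Lemma pq0 : 0 = pmk 0. Proof. by []. Qed.

Definition pqnormC (q : pquot) : R[i] := (pqnorm q)%:C%C.

Lemma pqnormD q r : pqnormC (q + r) <= pqnormC q + pqnormC r.
Proof.
have [x Sx ->] := pmkE q; have [y Sy ->] := pmkE r.
by rewrite pqD// /pqnormC -rmorphD/= lecR !pmk_norm ?pnormD//; auto.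
Qed.

Lemma pqnormZ (l : R[i]) q : pqnormC (l *: q) = `|l| * pqnormC q.
Proof.
have [x Sx ->] := pmkE q; rewrite pqZ// normC_cabs /pqnormC -rmorphM/=.
by rewrite !pmk_norm ?pnormZ//; auto.
Qed.

Lemma pqnorm0_eq0 q : pqnormC q = 0 -> q = 0.
Proof.
have [x Sx ->] := pmkE q => /complexI; rewrite pmk_norm// => h.
by rewrite pq0; apply: pmk_eq; rewrite ?subr0.
Qed.

HB.instance Definition _ := Lmodule_isNormed.Build R[i] pquot
  pqnormD pqnormZ pqnorm0_eq0.

Lemma pq_rnorm q : rnorm q = pqnorm q.
Proof. by []. Qed.

Lemma pquot_complete (F : set_system pquot) : ProperFilter F -> cauchy F -> cvg F.
Proof.
move=> FF Fc.
have pos k : 0 < 2^-1 ^+ k :> R by rewrite exprn_gt0// invr_gt0.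
(* Two successive balls belong to [F] and so share a point: the centres differ by less than
   [2^-1 ^+ k / 4 + 2^-1 ^+ k.+1 / 4], within the rate required by [pcomplete]. *)
have h k : exists q : pquot, F [set r | rnorm (q - r) < 2^-1 ^+ k / 4].
  have /cauchyP/(_ ((2^-1 ^+ k / 4)%:C%C)) := Fc.
  rewrite ltcR divr_gt0// => /(_ isT)[q Fq]; exists q.
  by apply: filterS Fq => r; rewrite -ball_normE/= normE ltcR.
pose q k := projT1 (cid (h k)).
have qP k : F [set r | rnorm (q k - r) < 2^-1 ^+ k / 4] by exact: projT2 (cid (h k)).
have [//|k|z Sz zP] := @pcomplete _ _ E (fun k => pqval (q k)).
  rewrite -pmk_norm//; last by apply: psetB.
  rewrite -pqB// !pqvalK -pq_rnorm.
  have [r [r1 r2]] := filter_ex (filterI (qP k) (qP k.+1)).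
  apply: le_lt_trans (rnorm_triangle r _ _) _; rewrite (rnormB r).
  rewrite /= in r1 r2; rewrite (lt_trans (ltrD r2 r1))// exprSr.
  by have := pos k; move: (2^-1 ^+ k) => t t0; lra.
apply/cvg_ex; exists (pmk z); apply/cvgrPdist_lt => e e0.
have [e1 e1E] : exists e1, e = e1%:C%C.
  by apply/complex_realP; rewrite ger0_real// ltW.
have e10 : 0 < e1 by rewrite e1E ltcR in e0.
(* The factor 3 covers the tail [2 * 2^-1 ^+ k] of the sequence and the radius of the ball that
   belongs to [F]. *)
have /cvgrPdist_lt /(_ e1 e10) [k _ /(_ k (leqnn _))] :
    (fun k => 3 * 2^-1 ^+ k : R) @ \oo --> 0.
  rewrite -[0](mulr0 3); apply: cvgM; first exact: cvg_cst.
  by apply: cvg_expr; rewrite ger0_norm ?invr_ge0// invf_lt1// ltr1n.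
rewrite sub0r normrN ger0_norm => [ke|]; last by rewrite mulr_ge0// ltW.
apply: filterS (qP k) => r /= rP; rewrite normE e1E ltcR.
apply: le_lt_trans ke; apply: le_trans (rnorm_triangle (q k) _ _) _.
have {}zP := zP k; move: zP; rewrite -pmk_norm//; last by apply: psetB.
rewrite -pqB// pqvalK -pq_rnorm rnormB => zk.
by have := pos k; move: (2^-1 ^+ k) rP zk => t *; lra.
Qed.

HB.instance Definition _ := Uniform_isComplete.Build pquot pquot_complete.

Definition pquotC : completeNormedModType R[i] := pquot.

Lemma pqmulA (q r s : pquotC) : pqmul q (pqmul r s) = pqmul (pqmul q r) s.
Proof.
have [x Sx ->] := pmkE q; have [y Sy ->] := pmkE r; have [z Sz ->] := pmkE s.
by rewrite (pmkM Sy Sz) (pmkM Sx Sy) !pmkM ?pmulA; auto.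
Qed.

Lemma pqmulDl (q r s : pquotC) : pqmul (q + r) s = pqmul q s + pqmul r s.
Proof.
have [x Sx ->] := pmkE q; have [y Sy ->] := pmkE r; have [z Sz ->] := pmkE s.
by rewrite (pqD Sx Sy) !pmkM ?pqD ?pmulDl; auto.
Qed.

Lemma pqmulDr (q r s : pquotC) : pqmul q (r + s) = pqmul q r + pqmul q s.
Proof.
have [x Sx ->] := pmkE q; have [y Sy ->] := pmkE r; have [z Sz ->] := pmkE s.
by rewrite (pqD Sy Sz) !pmkM ?pqD ?pmulDr; auto.
Qed.

Lemma pqmulZl l (q r : pquotC) : pqmul (l *: q) r = l *: pqmul q r.
Proof.
have [x Sx ->] := pmkE q; have [y Sy ->] := pmkE r.
by rewrite (pqZ _ Sx) !pmkM ?pqZ ?pmulZl; auto.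
Qed.

Lemma pqmulZr l (q r : pquotC) : pqmul q (l *: r) = l *: pqmul q r.
Proof.
have [x Sx ->] := pmkE q; have [y Sy ->] := pmkE r.
by rewrite (pqZ _ Sy) !pmkM ?pqZ ?pmulZr; auto.
Qed.

Lemma pqstarK (q : pquotC) : pqstar (pqstar q) = q.
Proof. by have [x Sx ->] := pmkE q; rewrite (pmkS Sx) pmkS ?pstarK; auto. Qed.

Lemma pqstarD (q r : pquotC) : pqstar (q + r) = pqstar q + pqstar r.
Proof.
have [x Sx ->] := pmkE q; have [y Sy ->] := pmkE r.
by rewrite (pqD Sx Sy) !pmkS ?pqD ?pstarD; auto.
Qed.

Lemma pqstarZ l (q : pquotC) : pqstar (l *: q) = l^* *: pqstar q.
Proof.
by have [x Sx ->] := pmkE q; rewrite (pqZ _ Sx) !pmkS ?pqZ ?pstarZ; auto.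
Qed.

Lemma pqstarM (q r : pquotC) : pqstar (pqmul q r) = pqmul (pqstar r) (pqstar q).
Proof.
have [x Sx ->] := pmkE q; have [y Sy ->] := pmkE r.
by rewrite (pmkM Sx Sy) !pmkS ?pmkM ?pstarM; auto.
Qed.

Lemma pqnormM (q r : pquotC) : `|pqmul q r| <= `|q| * `|r|.
Proof.
have [x Sx ->] := pmkE q; have [y Sy ->] := pmkE r.
rewrite !normE -rmorphM/= lecR !pq_rnorm pmkM// !pmk_norm; auto.
exact: pnormM.
Qed.

Lemma pqnorm_star (q : pquotC) : `|pqmul (pqstar q) q| = `|q| ^+ 2.
Proof.
have [x Sx ->] := pmkE q; rewrite !normE -rmorphXn/= !pq_rnorm (pmkS Sx) pmkM; auto.
by rewrite !pmk_norm ?pnormS; auto.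
Qed.

Lemma pqmul1l h (q : pquotC) : pqmul (pqone h) q = q.
Proof. by have [x Sx ->] := pmkE q; rewrite pmkM ?pmul1l. Qed.

Lemma pqmul1r h (q : pquotC) : pqmul q (pqone h) = q.
Proof. by have [x Sx ->] := pmkE q; rewrite pmkM ?pmul1r. Qed.

Definition cstar_of_pre : cstarAlg R u :=
  CstarAlg pqmulA pqmulDl pqmulDr pqmulZl pqmulZr pqstarK pqstarD pqstarZ
    pqstarM pqnormM pqnorm_star pqmul1l pqmul1r.

End preCstar_theory.

(** * Suprema of bounded functions and continuous connectives on boxes *)

Section real_bounds.
Context {R : realType}.
Implicit Types (T : Type) (e K : R).

Section sup_range.
Variables (T : Type) (t0 : T) (K : R).
Implicit Types F G : T -> R.

Lemma has_sup_range F : (forall x, `|F x| <= K) -> has_sup (range F).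
Proof.
move=> FK; split; first by exists (F t0); exists t0.
by exists K => _ [x _ <-]; rewrite (le_trans (ler_norm _))// FK.
Qed.

Lemma le_sup_range F : (forall x, `|F x| <= K) -> forall x, F x <= sup (range F).
Proof.
by move=> FK x; apply: sup_upper_bound; [exact: has_sup_range|exists x].
Qed.

Lemma sup_range_le F c : (forall x, F x <= c) -> sup (range F) <= c.
Proof. by move=> Fc; apply: ge_sup => [|_ [x _ <-]]; [exists (F t0), t0|]. Qed.

Lemma sup_range_adherent F e : (forall x, `|F x| <= K) -> 0 < e ->
  exists x, sup (range F) - e < F x.
Proof.
move=> FK e0; have [_ [x _ <-] h] := sup_adherent e0 (has_sup_range FK).
by exists x.
Qed.

Lemma sup_range_dist F G e : (forall x, `|F x| <= K) ->
  (forall x, `|F x - G x| <= e) -> `|sup (range F) - sup (range G)| <= e.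
Proof.
move=> FK FG; have hG : has_sup (range G).
  split; first by exists (G t0), t0.
  exists (K + e) => _ [x _ <-]; have := FG x; have := FK x.
  by rewrite !ler_norml => /andP[? ?] /andP[? ?]; lra.
rewrite ler_norml; apply/andP; split.
  rewrite lerBrDl; rewrite -lerBrDr; apply: sup_range_le => x.
  have := le_sup_range FK x; have := FG x.
  by rewrite ler_norml => /andP[? ?] ?; lra.
rewrite lerBlDr; apply: sup_range_le => x.
have : G x <= sup (range G) by apply: sup_upper_bound => //; exists x.
by have := FG x; rewrite ler_norml => /andP[? ?] ?; lra.
Qed.

Lemma sup_range_norm F : (forall x, `|F x| <= K) -> `|sup (range F)| <= K.
Proof.
move=> FK; rewrite ler_norml; apply/andP; split.
  apply: le_trans (le_sup_range FK t0); have := FK t0.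
  by rewrite ler_norml => /andP[].
by apply: sup_range_le => x; rewrite (le_trans (ler_norm _)).
Qed.

End sup_range.

Lemma inf_range T (F : T -> R) : inf (range F) = - sup (range (fun x => - F x)).
Proof.
rewrite /inf; congr (- sup _); apply/seteqP; split=> [_ [_ [x _ <-] <-]|_ [x _ <-]].
  by exists x.
by exists (F x) => //; exists x.
Qed.

Lemma inf_range_dist T (t0 : T) K (F G : T -> R) e : (forall x, `|F x| <= K) ->
  (forall x, `|F x - G x| <= e) -> `|inf (range F) - inf (range G)| <= e.
Proof.
move=> FK FG; rewrite !inf_range -opprD normrN.
by apply: (sup_range_dist t0 (K := K)) => x; rewrite ?normrN// -opprD normrN.
Qed.

Lemma fin_bound k (M : 'I_k -> R) : exists2 K, 0 <= K & forall i, M i <= K.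
Proof.
exists (\sum_i `|M i|); first by rewrite sumr_ge0.
move=> i; rewrite (bigD1 i)//= (le_trans (ler_norm _))// lerDl sumr_ge0//.
Qed.

Lemma fin_pos k (d : 'I_k -> R) : (forall i, 0 < d i) ->
  exists2 e, 0 < e & forall i, e <= d i.
Proof.
move=> d0; have [K K0 KP] := fin_bound (fun i => (d i)^-1).
exists (K + 1)^-1 => [|i]; first by rewrite invr_gt0 ltr_wpDl.
by rewrite -[d i]invrK lef_pV2 ?posrE ?invr_gt0 ?ltr_wpDl// (le_trans (KP i))// lerDl.
Qed.

Lemma fin_bound_nat k (N : 'I_k -> nat) : exists M, forall i, (N i <= M)%N.
Proof. by exists (\max_i N i) => i; exact: leq_bigmax. Qed.

End real_bounds.

Section row_continuity.
Context {R : realType} (k : nat).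
Implicit Types (v w : 'rV[R]_k) (f : 'rV[R]_k -> R).

Lemma row_ball v w d : 0 < d -> (forall i, `|v 0 i - w 0 i| < d) -> ball v d w.
Proof.
move=> d0 h; split=> // i j; rewrite (ord1 i) -ball_normE; exact: h.
Qed.

Lemma row_ballW v w d i : ball v d w -> `|v 0 i - w 0 i| < d.
Proof. by move=> [_ /(_ 0 i)]; rewrite -ball_normE. Qed.

Lemma continuous_row f v e : continuous f -> 0 < e ->
  exists2 d, 0 < d & forall w, (forall i, `|v 0 i - w 0 i| < d) -> `|f v - f w| < e.
Proof.
move=> cf e0; have /cvgrPdist_lt/(_ e e0) := cf v.
rewrite -filter_from_ballE => -[d /= d0 h]; exists d => // w vw.
by apply: h; exact: row_ball.
Qed.

Definition row_box (K : R) : set 'rV[R]_k := [set v | forall i, `|v 0 i| <= K].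

Lemma row_box_compact K : compact (row_box K).
Proof.
have -> : row_box K = [set v | forall i, `[- K, K]%classic (v ord0 i)].
  by apply/seteqP; split=> v h i; have := h i; rewrite /= in_itv/= ler_norml.
apply: (@rV_compact R k (fun=> `[- K, K]%classic)) => i.
exact: segment_compact.
Qed.

(** Only [v] has to lie in the box: perturbed rows and grid points may leave it, which rules out a
    plain appeal to uniform continuity on a compact set. *)
Lemma unif_continuous_row f K e : continuous f -> 0 < e ->
  exists2 d, 0 < d & forall v w, row_box K v ->
    (forall i, `|v 0 i - w 0 i| <= d) -> `|f v - f w| <= e.
Proof.
move=> cf e0.
have h : \forall d \near (0 : R)^'+, row_box K `<=` (fun v => forall w,
    (forall i, `|v 0 i - w 0 i| <= d) -> `|f v - f w| <= e).
  have /compact_near_coveringP cov := @row_box_compact K; apply: cov => v _.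
  have e20 : 0 < e / 2 by rewrite divr_gt0.
  have [d d0 dP] := continuous_row v cf e20.
  exists (ball v (d / 2), [set x | 0 < x < d / 2]).
    split; first by apply: nbhsx_ballx; rewrite divr_gt0.
    have d20 : 0 < d / 2 by rewrite divr_gt0.
    near=> t; apply/andP; split; near: t; first exact: nbhs_right_gt.
    exact: nbhs_right_lt.
  move=> [x y] [/= xv /andP[y0 yd]] w xw.
  have h1 : `|f v - f x| < e / 2.
    by apply: dP => i; have := row_ballW i xv; move=> /lt_trans; apply; lra.
  have h2 : `|f v - f w| < e / 2.
    apply: dP => i; have := row_ballW i xv; have := xw i.
    have := ler_distD (x 0 i) (v 0 i) (w 0 i).
    by move=> a b c; lra.
  have := ler_distD (f v) (f x) (f w); rewrite (distrC (f x) (f v)).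
  by move=> h; apply: (le_trans h); lra.
have /filter_ex[d [d0 dP]] : (0 : R)^'+ ([set d | 0 < d] `&` [set d | row_box K `<=`
    (fun v => forall w, (forall i, `|v 0 i - w 0 i| <= d) -> `|f v - f w| <= e)]).
  by apply: filterI => //; exact: nbhs_right_gt.
by exists d => // v w vK; exact: dP.
Unshelve. all: by end_near. Qed.

Lemma bounded_row f K : continuous f -> exists2 M, 0 <= M & forall v, row_box K v -> `|f v| <= M.
Proof.
move=> cf; have : compact (f @` row_box K).
  by apply: continuous_compact; [exact: continuous_subspaceT|exact: row_box_compact].
move=> /compact_bounded[M [Mr MP]]; exists (`|M| + 1); first by rewrite addr_ge0.
move=> v vK; apply: (MP (`|M| + 1)); last by exists v.
by rewrite (le_lt_trans (ler_norm _))// ltrDl.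
Qed.

End row_continuity.

(** * Bounds and moduli of continuity of terms and formulas, uniform over all algebras *)

Section semantics.
Context {R : realType} {u : bool}.
Implicit Types (V : symbols) (A : cstarAlg R u) (e : R).

Lemma cball0_subproof A n : `|0 : A| <= n%:R. Proof. by rewrite normr0. Qed.
Definition cball0 A n : cball A n := exist _ 0 (cball0_subproof A n).

Lemma cball_rnorm A n (x : cball A n) : rnorm (sval x) <= n%:R.
Proof. by rewrite -normr_leN (svalP x). Qed.

Definition mkball A n (x : A) (h : rnorm x <= n%:R) : cball A n :=
  exist _ x (etrans (normr_leN x n) h).

Lemma rnorm_teval V A (a : assignment V A) n (t : term R u V n) :
  rnorm (teval a t) <= n%:R.
Proof. by rewrite -normr_leN norm_teval. Qed.

Lemma feval_bound V (phi : formula R u V) :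
  exists K, forall A (a : assignment V A), `|feval a phi| <= K.
Proof.
elim: phi => {V} [V n t1 t2|V k f cf args IH|V n psi [K KP]|V n psi [K KP]].
- exists (n%:R + n%:R) => A a /=; rewrite ger0_norm ?rnorm_ge0//.
  by rewrite (le_trans (rnormD _ _))// rnormN lerD// rnorm_teval.
- have [K KP] := choice IH; have [K1 K10 K1P] := fin_bound K.
  have [M _ MP] := bounded_row K1 cf; exists M => A a /=; apply: MP => i.
  by rewrite mxE (le_trans (KP i A a)).
- by exists K => A a /=; apply: sup_range_norm => //; exact: cball0.
- exists K => A a /=; rewrite inf_range normrN; apply: sup_range_norm => //.
    exact: cball0.
  by move=> x; rewrite normrN.
Qed.

(** An arbitrary ranking [rk] of the symbols expresses that a term involves finitely many of them:
    only those of rank below [N] count. Neither [N] nor [K] depends on the algebra, since sorts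
    bound the values of subterms. *)
Lemma teval_lipschitz V n (t : term R u V n) (rk : forall n, V n -> nat) :
  exists N, exists2 K, 0 <= K & forall A (a b : assignment V A) d, 0 <= d ->
    (forall n v, (rk n v < N)%N -> rnorm (sval (a n v) - sval (b n v)) <= d) ->
    rnorm (teval a t - teval b t) <= K * d.
Proof.
elim: t => {n} [n v||h|m n s [N1 [K1 K10 h1]] t [N2 [K2 K20 h2]]
  |m n s [N1 [K1 K10 h1]] t [N2 [K2 K20 h2]]|n t [N [K K0 h]]
  |l m n lmn t [N [K K0 h]]|m n mn t [N [K K0 h]]].
- exists (rk n v).+1, 1 => // A a b d d0 /= h.
  by rewrite mul1r; exact: h.
- by exists 0%N, 0 => // A a b d d0 _ /=; rewrite subrr rnorm0 mul0r.
- by exists 0%N, 0 => // A a b d d0 _ /=; rewrite subrr rnorm0 mul0r.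
- exists (maxn N1 N2), (K1 + K2); first by rewrite addr_ge0.
  move=> A a b d d0 h /=; rewrite opprD addrACA (le_trans (rnormD _ _))// mulrDl.
  by rewrite lerD ?h1 ?h2// => k v kN; apply: h; rewrite leq_max kN ?orbT.
- exists (maxn N1 N2), (m%:R * K2 + K1 * n%:R).
    by rewrite addr_ge0// mulr_ge0.
  move=> A a b d d0 h /=.
  have -> : cmul (teval a s) (teval a t) - cmul (teval b s) (teval b t) =
      cmul (teval a s) (teval a t - teval b t) +
      cmul (teval a s - teval b s) (teval b t).
    by rewrite cmulBr cmulBl addrA subrK.
  rewrite (le_trans (rnormD _ _))// mulrDl lerD// (le_trans (rnorm_cmul _ _))//.
    rewrite -mulrA ler_pM ?rnorm_ge0 ?rnorm_teval//.
    by apply: h2 => // k v kN; apply: h; rewrite leq_max kN ?orbT.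
  rewrite mulrAC ler_pM ?rnorm_ge0 ?rnorm_teval//.
  by apply: h1 => // k v kN; apply: h; rewrite leq_max kN ?orbT.
- exists N, K => // A a b d d0 hd /=.
  by rewrite -cstarB rnorm_cstar; exact: h.
- exists N, (cabs l * K); first by rewrite mulr_ge0// cabs_ge0.
  move=> A a b d d0 hd /=; rewrite -scalerBr rnormZ -mulrA ler_wpM2l ?cabs_ge0//.
  exact: h.
- by exists N, K.
Qed.

(** Here [N] depends on [e] only through the induction; its independence of the algebra is what
    turns agreement on part of the constants into weak* closeness, even between functionals of
    different models. *)
Lemma feval_continuous V (phi : formula R u V) (rk : forall n, V n -> nat) e :
  0 < e -> exists N, exists2 d, 0 < d & forall A (a b : assignment V A),
    (forall n v, (rk n v < N)%N -> rnorm (sval (a n v) - sval (b n v)) <= d) ->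
    `|feval a phi - feval b phi| <= e.
Proof.
elim: phi rk e => {V} [V n t1 t2|V k f cf args IH|V n psi IH|V n psi IH] rk e e0.
- have [N1 [K1 K10 h1]] := teval_lipschitz t1 rk.
  have [N2 [K2 K20 h2]] := teval_lipschitz t2 rk.
  have K0 : 0 < K1 + K2 + 1 by rewrite ltr_wpDl// addr_ge0.
  exists (maxn N1 N2), (e / (K1 + K2 + 1)); first by rewrite divr_gt0.
  move=> A a b h /=; rewrite (le_trans (rnorm_dist _ _))//.
  have -> : teval a t1 - teval a t2 - (teval b t1 - teval b t2) =
      (teval a t1 - teval b t1) - (teval a t2 - teval b t2).
    by rewrite !opprD !opprK addrACA.
  rewrite (le_trans (rnormD _ _))// rnormN.
  have d0 : 0 <= e / (K1 + K2 + 1) by rewrite ltW// divr_gt0.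
  apply: (@le_trans _ _ ((K1 + K2) * (e / (K1 + K2 + 1)))); last first.
    rewrite mulrA ler_pdivrMr// mulrC ler_pM2l// lerDl//.
  by rewrite mulrDl lerD ?h1 ?h2// => m v mN; apply: h; rewrite leq_max mN ?orbT.
- have [K KP] := choice (fun i => feval_bound (args i)).
  have [K1 K10 K1P] := fin_bound K.
  have [d d0 dP] := unif_continuous_row K1 cf e0.
  have [N NP] := choice (fun i => IH i rk d d0).
  have /choice[d' d'P] i : exists d', 0 < d' /\ forall A (a b : assignment V A),
      (forall n v, (rk n v < N i)%N -> rnorm (sval (a n v) - sval (b n v)) <= d') ->
      `|feval a (args i) - feval b (args i)| <= d.
    by have [d' d'0 d'P] := NP i; exists d'.
  have [N1 N1P] := fin_bound_nat N.
  have [d1 d10 d1P] := fin_pos (fun i => proj1 (d'P i)).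
  exists N1, d1 => // A a b h /=; apply: dP => i.
    by rewrite mxE (le_trans (KP i A a)).
  rewrite !mxE; apply: (proj2 (d'P i)) => m v mN.
  by rewrite (le_trans (h m v (leq_trans mN (N1P i))))//.
(* Any rank does for the bound variable, whose two values coincide. *)
- pose rk' m (v : ext V n m) := match v with Old _ w => rk _ w | New => 0%N end.
  have [N [d d0 h]] := IH rk' e e0; exists N, d => // A a b hab /=.
  have [K KP] := feval_bound psi; apply: (sup_range_dist (cball0 A n) (K := K)) => //.
  move=> x; apply: h => m [p w|] mN /=; first exact: hab.
  by rewrite subrr rnorm0 ltW.
- pose rk' m (v : ext V n m) := match v with Old _ w => rk _ w | New => 0%N end.
  have [N [d d0 h]] := IH rk' e e0; exists N, d => // A a b hab /=.
  have [K KP] := feval_bound psi; apply: (inf_range_dist (cball0 A n) (K := K)) => //.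
  move=> x; apply: h => m [p w|] mN /=; first exact: hab.
  by rewrite subrr rnorm0 ltW.
Qed.

End semantics.

(** * Isometric embeddings and closed subalgebras *)

Section embedding.
Context {R : realType} {u : bool}.

Record cstar_emb (B A : cstarAlg R u) (f : B -> A) : Prop := CstarEmb {
  embD : forall x y, f (x + y) = f x + f y;
  embZ : forall l x, f (l *: x) = l *: f x;
  embM : forall x y, f (cmul x y) = cmul (f x) (f y);
  embS : forall x, f (cstar x) = cstar (f x);
  emb1 : forall h, f (cone B h) = cone A h;
  emb_norm : forall x, rnorm (f x) = rnorm x }.

Variables (B A : cstarAlg R u) (f : B -> A) (hf : cstar_emb f).

Lemma emb0 : f 0 = 0.
Proof. by rewrite -(scale0r (0 : B)) (embZ hf) scale0r. Qed.

Lemma embB x y : f (x - y) = f x - f y.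
Proof. by rewrite (embD hf) -scaleN1r (embZ hf) scaleN1r. Qed.

Lemma push_subproof n (x : cball B n) : rnorm (f (sval x)) <= n%:R.
Proof. by rewrite (emb_norm hf) cball_rnorm. Qed.

Definition push_ball n (x : cball B n) : cball A n := mkball (push_subproof x).

Definition push (V : symbols) (b : assignment V B) : assignment V A :=
  fun n v => push_ball (b n v).

Lemma teval_push V (b : assignment V B) n (t : term R u V n) :
  teval (push b) t = f (teval b t).
Proof.
elim: t => {n} [||||m n s IHs t IHt|||] //=.
- by rewrite emb0.
- by move=> h; rewrite (emb1 hf).
- by move=> m n s -> t ->; rewrite (embD hf).
- by rewrite IHs IHt (embM hf).
- by move=> n t ->; rewrite (embS hf).
- by move=> l m n _ t ->; rewrite (embZ hf).
Qed.

Lemma feval_push_qfree V (b : assignment V B) (phi : formula R u V) :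
  qfree phi -> feval (push b) phi = feval b phi.
Proof.
elim: phi b => {V} [V n t1 t2|V k g cg args IH|//|//] b /=.
  by move=> _; rewrite !teval_push -embB (emb_norm hf).
by move=> q; congr g; apply/rowP => i; rewrite !mxE IH.
Qed.

Lemma push_extend V (b : assignment V B) n (x : cball B n) :
  push (extend b x) = extend (push b) (push_ball x).
Proof. by apply: functional_extensionality_dep => m; apply/funext => -[]. Qed.

End embedding.

Section subalgebra.
Context {R : realType} {u : bool} (A : cstarAlg R u).

Record csub := CSub {
  csset : set A;
  cs0 : csset 0;
  csD : forall x y, csset x -> csset y -> csset (x + y);
  csZ : forall (l : R[i]) x, csset x -> csset (l *: x);
  csM : forall x y, csset x -> csset y -> csset (cmul x y);
  csS : forall x, csset x -> csset (cstar x);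
  cs1 : forall h, csset (cone A h);
  cs_closed : forall x,
    (forall e, 0 < e -> exists2 y, csset y & rnorm (x - y) < e) -> csset x }.

Variable C : csub.
Local Notation S := (csset C).

Lemma csub_complete (x : nat -> A) : (forall k, S (x k)) ->
  (forall k, rnorm (x k.+1 - x k) < 2^-1 ^+ k) ->
  exists2 z, S z & forall k, rnorm (x k - z) <= 2 * 2^-1 ^+ k.
Proof.
move=> Sx xx; have [z zP] := geometric_cvg (fun k => ltW (xx k)).
exists z => //; apply: cs_closed => e e0.
have /cvgrPdist_lt /(_ e e0) [k _ /(_ k (leqnn _))] :
    (fun k => 2 * 2^-1 ^+ k : R) @ \oo --> 0.
  rewrite -[0](mulr0 2); apply: cvgM; first exact: cvg_cst.
  by apply: cvg_expr; rewrite ger0_norm ?invr_ge0// invf_lt1// ltr1n.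
rewrite sub0r normrN => h; exists (x k) => //; rewrite rnormB.
by rewrite (le_lt_trans (zP k))// (le_lt_trans (ler_norm _)).
Qed.

Definition csub_pre : preCstar R u :=
  @PreCstar R u A S (@rnorm R A) (@cmul _ _ A) (@cstar _ _ A) (cone A)
    (cs0 C) (@csD C) (@csZ C) (@csM C) (@csS C) (@cs1 C)
    (@cmulA _ _ A) (@cmulDl _ _ A) (@cmulDr _ _ A) (@cmulZl _ _ A) (@cmulZr _ _ A)
    (@cstarK _ _ A) (@cstarD _ _ A) (@cstarZ _ _ A) (@cstarM _ _ A)
    (@cmul1l _ _ A) (@cmul1r _ _ A)
    (fun x _ => rnorm_ge0 x) (fun x y _ _ => rnormD x y) (fun l x _ => rnormZ l x)
    (fun x y _ _ => rnorm_cmul x y) (fun x _ => rnorm_cstar_mul x) csub_complete.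

Definition csub_alg : cstarAlg R u := cstar_of_pre csub_pre.

Definition csub_val : csub_alg -> A := @pqval R u csub_pre.
Definition csub_mk : A -> csub_alg := @pmk R u csub_pre.

Lemma csub_valS x : S (csub_val x).
Proof. exact: (@pqvalS R u csub_pre x). Qed.

Lemma csub_mkK x : S x -> csub_val (csub_mk x) = x.
Proof. by move=> Sx; apply/subr0_eq/rnorm0_eq0/(@pmkP R u csub_pre). Qed.

Lemma csub_emb : cstar_emb csub_val.
Proof.
split=> [x y|l x|x y|x|h|x].
- by apply: csub_mkK; apply: csD; exact: csub_valS.
- by apply: csub_mkK; apply: csZ; exact: csub_valS.
- by apply: csub_mkK; apply: csM; exact: csub_valS.
- by apply: csub_mkK; apply: csS; exact: csub_valS.
- by apply: csub_mkK; exact: cs1.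
- by [].
Qed.

End subalgebra.

(** * Ultraproducts and the theorem of Los *)

Section ultraproduct.
Context {R : realType} {u : bool} (I : Type) (U : set_system I) (FU : UltraFilter U).
Variable A : I -> cstarAlg R u.

(** Compactness of the segment gives a cluster point. A neighbourhood missed by the ultrafilter
    would have its complement in it, and a cluster point excludes this. *)
Lemma ultra_bounded_cvg (f : I -> R) K : (forall i, `|f i| <= K) -> cvg (f @ U).
Proof.
move=> fK; have cK := @segment_compact R (- K) K.
have FP : ProperFilter (f @ U) by apply: fmap_proper_filter; exact: ultra_proper.
have [] := cK _ FP.
  by apply: nearW => i; rewrite /= in_itv/= -ler_norml.
move=> p [_ pc]; apply/cvg_ex; exists p; apply/cvgrPdist_lt => e e0.
have [//|h] := in_ultra_setVsetC [set i | `|p - f i| < e] FU.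
have [y [/= [i h1 <-] h2]] : ((f @` ~` [set i | `|p - f i| < e]) `&` ball p e) !=set0.
  apply: pc; last exact: nbhsx_ballx.
  rewrite /fmap/= -[nbhs _]/U; apply: (filterS _ h) => i hi.
  by exists i.
by rewrite -ball_normE in h2.
Qed.

Lemma ultra_lim_le (f g : I -> R) a b : (\forall i \near U, f i <= g i) ->
  f @ U --> a -> g @ U --> b -> a <= b.
Proof.
move=> fg fa gb; rewrite leNgt; apply/negP => ba.
have h1 : \forall i \near U, (a + b) / 2 < f i by apply: cvgr_gt fa _ _; lra.
have h2 : \forall i \near U, g i < (a + b) / 2 by apply: cvgr_lt gb _ _; lra.
by have [i [[h3 h4] h5]] := filter_ex (filterI (filterI fg h1) h2); lra.
Qed.

Definition prodalg := forall i, A i.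
HB.instance Definition _ := gen_eqMixin prodalg.
HB.instance Definition _ := gen_choiceMixin prodalg.

Lemma prodalgP (x y : prodalg) : (forall i, x i = y i) -> x = y.
Proof. exact: functional_extensionality_dep. Qed.

Fact prodalg_addA : associative (fun (x y : prodalg) i => x i + y i : A i).
Proof. by move=> x y z; apply: prodalgP => i; rewrite addrA. Qed.
Fact prodalg_addC : commutative (fun (x y : prodalg) i => x i + y i : A i).
Proof. by move=> x y; apply: prodalgP => i; rewrite addrC. Qed.
Fact prodalg_add0 : left_id (fun i => 0 : A i) (fun (x y : prodalg) i => x i + y i : A i).
Proof. by move=> x; apply: prodalgP => i; rewrite add0r. Qed.
Fact prodalg_addN : left_inverse (fun i => 0 : A i) (fun (x : prodalg) i => - x i)
  (fun (x y : prodalg) i => x i + y i : A i).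
Proof. by move=> x; apply: prodalgP => i; rewrite addNr. Qed.
HB.instance Definition _ := GRing.isZmodule.Build prodalg
  prodalg_addA prodalg_addC prodalg_add0 prodalg_addN.

Definition prodalg_scale (l : R[i]) (x : prodalg) : prodalg := fun i => l *: x i.
Fact prodalg_scaleA a b (x : prodalg) :
  prodalg_scale a (prodalg_scale b x) = prodalg_scale (a * b) x.
Proof. by apply: prodalgP => i; exact: scalerA. Qed.
Fact prodalg_scale1 : left_id 1 prodalg_scale.
Proof. by move=> x; apply: prodalgP => i; exact: scale1r. Qed.
Fact prodalg_scaleDr : right_distributive prodalg_scale +%R.
Proof. by move=> l x y; apply: prodalgP => i; exact: scalerDr. Qed.
Fact prodalg_scaleDl x : {morph prodalg_scale^~ x : a b / a + b}.
Proof. by move=> a b; apply: prodalgP => i; exact: scalerDl. Qed.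
HB.instance Definition _ := GRing.Zmodule_isLmodule.Build R[i] prodalg
  prodalg_scaleA prodalg_scale1 prodalg_scaleDr prodalg_scaleDl.

Implicit Types x y z : prodalg.

Lemma prodalgB x y i : (x - y) i = x i - y i. Proof. by []. Qed.

Definition prodalg_bounded : set prodalg :=
  [set x | exists K, forall i, rnorm (x i) <= K].
Local Notation S := prodalg_bounded.

Definition ultra_norm x : R := lim (rnorm (x i) @[i --> U]).

Lemma ultra_normP x : S x -> rnorm (x i) @[i --> U] --> ultra_norm x.
Proof.
move=> [K xK]; apply: (ultra_bounded_cvg (K := K)) => i.
by rewrite ger0_norm// rnorm_ge0.
Qed.

Lemma ultra_norm_unique x l : rnorm (x i) @[i --> U] --> l -> ultra_norm x = l.
Proof. exact: cvg_lim. Qed.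

Lemma prodalg_bounded0 : S 0.
Proof. by exists 0 => i; rewrite rnorm0. Qed.

Lemma prodalg_boundedD x y : S x -> S y -> S (x + y).
Proof.
move=> [K xK] [L yL]; exists (K + L) => i.
by rewrite (le_trans (rnormD _ _))// lerD.
Qed.

Lemma prodalg_boundedZ (l : R[i]) x : S x -> S (l *: x).
Proof.
by move=> [K xK]; exists (cabs l * K) => i; rewrite rnormZ ler_wpM2l// cabs_ge0.
Qed.

Definition prodalg_mul x y : prodalg := fun i => cmul (x i) (y i).
Definition prodalg_star x : prodalg := fun i => cstar (x i).
Definition prodalg_one (h : u) : prodalg := fun i => cone (A i) h.

Lemma prodalg_boundedM x y : S x -> S y -> S (prodalg_mul x y).
Proof.
move=> [K xK] [L yL]; exists (K * L) => i.
by rewrite (le_trans (rnorm_cmul _ _))// ler_pM// rnorm_ge0.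
Qed.

Lemma prodalg_boundedS x : S x -> S (prodalg_star x).
Proof. by move=> [K xK]; exists K => i; rewrite rnorm_cstar. Qed.

Lemma prodalg_bounded1 h : S (prodalg_one h).
Proof.
exists 1 => i; have := @rnorm_teval R u nosyms (A i) (noassign (A i)) _ (One R nosyms h).
by [].
Qed.

Lemma ultra_norm_ge0 x : S x -> 0 <= ultra_norm x.
Proof.
move=> Sx; apply: (ultra_lim_le (f := fun=> 0)) (ultra_normP Sx) => [|].
  by apply: nearW => i; exact: rnorm_ge0.
exact: cvg_cst.
Qed.

Lemma ultra_normD x y : S x -> S y -> ultra_norm (x + y) <= ultra_norm x + ultra_norm y.
Proof.
move=> Sx Sy; apply: ultra_lim_le (ultra_normP (prodalg_boundedD Sx Sy)) _; last first.
  exact: cvgD (ultra_normP Sx) (ultra_normP Sy).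
by apply: nearW => i; exact: rnormD.
Qed.

Lemma ultra_normZ (l : R[i]) x : S x -> ultra_norm (l *: x) = cabs l * ultra_norm x.
Proof.
move=> Sx; apply: ultra_norm_unique.
under eq_fun do rewrite rnormZ.
by apply: cvgM; [exact: cvg_cst|exact: ultra_normP].
Qed.

Lemma ultra_normM x y : S x -> S y -> ultra_norm (prodalg_mul x y) <= ultra_norm x * ultra_norm y.
Proof.
move=> Sx Sy; apply: ultra_lim_le (ultra_normP (prodalg_boundedM Sx Sy)) _; last first.
  exact: cvgM (ultra_normP Sx) (ultra_normP Sy).
by apply: nearW => i; exact: rnorm_cmul.
Qed.

Lemma ultra_normS x : S x -> ultra_norm (prodalg_mul (prodalg_star x) x) = ultra_norm x ^+ 2.
Proof.
move=> Sx; apply: ultra_norm_unique.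
under eq_fun do rewrite rnorm_cstar_mul.
by rewrite expr2; under eq_fun do rewrite expr2; apply: cvgM; exact: ultra_normP.
Qed.

(* The sequence is corrected on the coordinates where an increment exceeds the
   bound that holds along the ultrafilter, so that it converges everywhere. *)
Lemma ultra_complete (x : nat -> prodalg) : (forall k, S (x k)) ->
  (forall k, ultra_norm (x k.+1 - x k) < 2^-1 ^+ k) ->
  exists2 z, S z & forall k, ultra_norm (x k - z) <= 2 * 2^-1 ^+ k.
Proof.
move=> Sx xx; pose d k i := x k.+1 i - x k i.
pose y := fix y k : prodalg := if k is k'.+1 then
  fun i => y k' i + (if rnorm (d k' i) <= 2^-1 ^+ k' then d k' i else 0) else x 0%N.
have SB v w : S v -> S w -> S (v - w).
  by move=> Sv Sw; rewrite -scaleN1r; apply: prodalg_boundedD => //; exact: prodalg_boundedZ.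
have yx k : \forall i \near U, y k i = x k i.
  elim: k => [|k IH]; first exact: nearW.
  have h : \forall i \near U, rnorm (d k i) < 2^-1 ^+ k.
    apply: (cvgr_lt (ultra_norm (x k.+1 - x k))) => //.
    by apply: ultra_normP; exact: SB.
  by apply: filterS2 IH h => i /= -> /ltW ->; rewrite addrC subrK.
have hz i : exists z : A i, forall k, rnorm (y k i - z) <= 2 * 2^-1 ^+ k.
  apply: geometric_cvg => k /=; rewrite addrAC subrr add0r; case: ifP => // _.
  by rewrite rnorm0 exprn_ge0// invr_ge0.
pose z : prodalg := fun i => projT1 (cid (hz i)).
have zP i : forall k, rnorm (y k i - z i) <= 2 * 2^-1 ^+ k := projT2 (cid (hz i)).
have Sz : S z.
  have [K xK] := Sx 0%N; exists (2 + K) => i.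
  rewrite -(subrK (x 0%N i) (z i)) (le_trans (rnormD _ _))// lerD// rnormB.
  by have := zP i 0%N; rewrite expr0 mulr1.
exists z => // k.
apply: (ultra_lim_le (g := fun=> 2 * 2^-1 ^+ k)) (ultra_normP (SB _ _ (Sx k) Sz)) _.
  by apply: filterS (yx k) => i yxi; rewrite prodalgB -yxi; exact: zP.
exact: cvg_cst.
Qed.

Definition ultra_pre : preCstar R u :=
  @PreCstar R u prodalg S ultra_norm prodalg_mul prodalg_star prodalg_one
    prodalg_bounded0 prodalg_boundedD prodalg_boundedZ prodalg_boundedM prodalg_boundedS prodalg_bounded1
    (fun x y z => prodalgP (fun i => cmulA (x i) (y i) (z i)))
    (fun x y z => prodalgP (fun i => cmulDl (x i) (y i) (z i)))
    (fun x y z => prodalgP (fun i => cmulDr (x i) (y i) (z i)))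
    (fun l x y => prodalgP (fun i => cmulZl l (x i) (y i)))
    (fun l x y => prodalgP (fun i => cmulZr l (x i) (y i)))
    (fun x => prodalgP (fun i => cstarK (x i)))
    (fun x y => prodalgP (fun i => cstarD (x i) (y i)))
    (fun l x => prodalgP (fun i => cstarZ l (x i)))
    (fun x y => prodalgP (fun i => cstarM (x i) (y i)))
    (fun h x => prodalgP (fun i => cmul1l h (x i)))
    (fun h x => prodalgP (fun i => cmul1r h (x i)))
    ultra_norm_ge0 ultra_normD ultra_normZ ultra_normM ultra_normS ultra_complete.

Definition ultraproduct : cstarAlg R u := cstar_of_pre ultra_pre.

End ultraproduct.

Section los.
Context {R : realType} {u : bool} (I : Type) (U : set_system I) (FU : UltraFilter U).
Variable A : I -> cstarAlg R u.

Let ult : cstarAlg R u := ultraproduct FU A.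
Let uc : prodalg A -> ult := @pmk R u (ultra_pre FU A).
Let S := prodalg_bounded (A := A).

Lemma ball_bounded n (x : forall i, cball (A i) n) : S (fun i => sval (x i)).
Proof. by exists n%:R => i; exact: cball_rnorm. Qed.

Lemma uc_norm x : S x -> rnorm (uc x) = ultra_norm U x.
Proof. exact: (@pmk_norm R u (ultra_pre FU A)). Qed.

Lemma uc_rnorm_cvg x : S x -> rnorm (x i) @[i --> U] --> rnorm (uc x).
Proof. by move=> Sx; rewrite uc_norm//; exact: ultra_normP. Qed.

Lemma uc_ball_subproof n (x : forall i, cball (A i) n) :
  rnorm (uc (fun i => sval (x i))) <= n%:R.
Proof.
apply: (ultra_lim_le FU) (uc_rnorm_cvg (ball_bounded x)) (cvg_cst _).
by apply: nearW => i; exact: cball_rnorm.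
Qed.

Definition uc_ball n (x : forall i, cball (A i) n) : cball ult n :=
  mkball (uc_ball_subproof x).

(** Coordinates of a representative that exceed [n] are scaled back radially. The correction there
    is [rnorm (z i) - n%:R], which is small along the ultrafilter because the limit of the norms is
    at most [n]. *)
Lemma uc_ball_surj n (y : cball ult n) :
  exists x : forall i, cball (A i) n, y = uc_ball x.
Proof.
have [z Sz yz] := @pmkE R u (ultra_pre FU A) (sval y).
pose w : prodalg A := fun i =>
  if rnorm (z i) <= n%:R then z i else (n%:R / rnorm (z i))%:C%C *: z i.
have w0 i : ~~ (rnorm (z i) <= n%:R) -> 0 < rnorm (z i).
  by rewrite -ltNge => /(le_lt_trans _); apply.
have wn i : rnorm (w i) <= n%:R.
  rewrite /w; case: ifPn => // /w0 z0.
  rewrite rnormZ cabs_real ger0_norm ?divr_ge0 ?rnorm_ge0//.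
  by rewrite divfK// gt_eqF.
exists (fun i => mkball (wn i)); apply: val_inj; rewrite /= yz.
have Sw : S w by exists n%:R.
apply: (@pmk_eq R u (ultra_pre FU A)) => //=.
have Szw : S (z - w).
  by rewrite -scaleN1r; apply: prodalg_boundedD => //; exact: prodalg_boundedZ.
apply/eqP; rewrite eq_le (ultra_norm_ge0 FU Szw) andbT; apply/ler_addgt0Pr => e e0.
have zn : rnorm (uc z) <= n%:R by have := cball_rnorm y; rewrite yz.
have h : \forall i \near U, rnorm (z i) < n%:R + e.
  by apply: cvgr_lt (uc_rnorm_cvg Sz) _ _; lra.
rewrite add0r -[X in X <= _]/(ultra_norm U ((z : prodalg A) - w)).
apply: (ultra_lim_le FU) (ultra_normP FU Szw) (cvg_cst e).
apply: filterS h => i hi; rewrite prodalgB /w.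
case: ifPn => [_|/[dup] /w0 z0]; first by rewrite subrr rnorm0 ltW.
rewrite -ltNge => nz; rewrite -[X in X - _]scale1r -scalerBl rnormZ.
have -> : (1 - (n%:R / rnorm (z i))%:C%C) = (1 - n%:R / rnorm (z i))%:C%C :> R[i].
  by rewrite rmorphB/=.
rewrite cabs_real ger0_norm; last by rewrite subr_ge0 ler_pdivrMr// mul1r ltW.
by rewrite mulrBl mul1r divfK ?gt_eqF//; lra.
Qed.

(** One inequality lifts an element of the ball of the ultraproduct to a family of elements of the
    balls; the other assembles near-maximizers chosen in each factor. *)
Lemma los_sup n (F : forall i, cball (A i) n -> R) (G : cball ult n -> R) K :
  (forall i x, `|F i x| <= K) -> (forall x, `|G x| <= K) ->
  (forall x : forall i, cball (A i) n, F i (x i) @[i --> U] --> G (uc_ball x)) ->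
  sup (range (F i)) @[i --> U] --> sup (range G).
Proof.
move=> FK GK FG.
have bd i : `|sup (range (F i))| <= K.
  exact: (sup_range_norm (cball0 _ n) (FK i)).
have /cvg_ex[l lP] := ultra_bounded_cvg FU bd.
suff -> : sup (range G) = l by [].
apply/eqP; rewrite eq_le; apply/andP; split.
  apply: (sup_range_le (cball0 _ n)) => y; have [x ->] := uc_ball_surj y.
  apply: (ultra_lim_le FU) (FG x) lP; apply: nearW => i.
  exact: (le_sup_range (cball0 _ n) (FK i)).
apply/ler_addgt0Pr => e e0.
have hx i : exists x : cball (A i) n, sup (range (F i)) - e < F i x.
  exact: (sup_range_adherent (cball0 _ n) (FK i)).
pose x i := projT1 (cid (hx i)).
have xP i : sup (range (F i)) - e < F i (x i) := projT2 (cid (hx i)).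
rewrite -lerBlDr; apply: (@le_trans _ _ (G (uc_ball x))).
  have lPe : sup (range (F i)) - e @[i --> U] --> l - e.
    by apply: cvgB => //; exact: cvg_cst.
  by apply: (ultra_lim_le FU) lPe (FG x); apply: nearW => i; exact: ltW.
exact: (le_sup_range (cball0 _ n) GK).
Qed.

Lemma teval_bounded V (a : forall i, assignment V (A i)) n (t : term R u V n) :
  S (fun i => teval (a i) t).
Proof. by exists n%:R => i; exact: rnorm_teval. Qed.

Definition uc_assign V (a : forall i, assignment V (A i)) : assignment V ult :=
  fun n v => uc_ball (fun i => a i n v).

Lemma teval_uc V (a : forall i, assignment V (A i)) n (t : term R u V n) :
  teval (uc_assign a) t = uc (fun i => teval (a i) t).
Proof.
elim: t => {n} [//|//|//|m n s IHs t IHt|m n s IHs t IHt|n t IHt|l m n lmn t IHt|//] /=.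
- rewrite IHs IHt; apply: (@pqD R u (ultra_pre FU A)); exact: teval_bounded.
- rewrite IHs IHt; apply: (@pmkM R u (ultra_pre FU A)); exact: teval_bounded.
- rewrite IHt; apply: (@pmkS R u (ultra_pre FU A)); exact: teval_bounded.
- rewrite IHt; apply: (@pqZ R u (ultra_pre FU A)); exact: teval_bounded.
Qed.

Lemma uc_extend V (a : forall i, assignment V (A i)) n (x : forall i, cball (A i) n) :
  extend (uc_assign a) (uc_ball x) = uc_assign (fun i => extend (a i) (x i)).
Proof. by apply: functional_extensionality_dep => m; apply/funext => -[]. Qed.

Theorem los V (phi : formula R u V) (a : forall i, assignment V (A i)) :
  feval (a i) phi @[i --> U] --> feval (uc_assign a) phi.
Proof.
elim: phi a => {V} [V n t1 t2|V k f cf args IH|V n psi IH|V n psi IH] a /=.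
- rewrite !teval_uc -[in X in _ --> X]/(uc _ - uc _).
  rewrite /uc (@pqB R u (ultra_pre FU A)); try exact: teval_bounded.
  apply: (@uc_rnorm_cvg (fun i => teval (a i) t1 - teval (a i) t2)).
  have [K1 h1] := teval_bounded a t1; have [K2 h2] := teval_bounded a t2.
  exists (K1 + K2) => i; rewrite (le_trans (rnormD _ _))// rnormN lerD//.
- apply/cvgrPdist_lt => e e0.
  have [d d0 dP] := continuous_row (\row_i feval (uc_assign a) (args i)) cf e0.
  have h : \forall i \near U, forall j : 'I_k,
      `|feval (uc_assign a) (args j) - feval (a i) (args j)| < d.
    apply: filter_forall => j.
    by have /cvgrPdist_lt/(_ d d0) := IH j a.
  by apply: filterS h => i hi; apply: dP => j; rewrite !mxE; exact: hi.
- have [K KP] := feval_bound psi.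
  apply: (los_sup (K := K)) => [i x|x|x]; rewrite ?KP// uc_extend.
  exact: IH.
- have [K KP] := feval_bound psi.
  rewrite inf_range; under eq_fun do rewrite inf_range; apply: cvgN.
  apply: (los_sup (K := K)) => [i x|x|x]; rewrite ?normrN ?KP// uc_extend.
  by apply: cvgN; exact: IH.
Qed.

Lemma models_ultraproduct (T : theory R u) :
  (forall i, models (A i) T) -> models ult T.
Proof.
move=> mA phi Tphi; have := @los nosyms phi (fun i => noassign (A i)).
have -> : uc_assign (fun i => noassign (A i)) = noassign ult.
  by apply: functional_extensionality_dep => n; apply/funext => -[].
have -> : (fun i => feval (noassign (A i)) phi) = cst 0.
  by apply/funext => i; exact: mA.
by move=> h; apply: (cvg_unique (@Rhausdorff R) h); exact: cvg_cst.
Qed.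

End los.

(** * Baire category in the space of functionals *)

Section comeager.
Context {T : topologicalType}.
Implicit Types (U V W H K : set T).

Definition comeager H := exists2 O : nat -> set T,
  (forall k, open (O k) /\ dense (O k)) & \bigcap_k O k `<=` H.

Lemma comeagerS H K : H `<=` K -> comeager H -> comeager K.
Proof. by move=> HK [D DP DH]; exists D => //; exact: subset_trans DH HK. Qed.

Lemma comeager_open_dense U : open U -> dense U -> comeager U.
Proof. by move=> oU dU; exists (fun=> U) => // x h; exact: (h 0%N). Qed.

Lemma comeager_bigcap (J : countType) (H : J -> set T) :
  (forall i, comeager (H i)) -> comeager (\bigcap_i H i).
Proof.
move=> cH.
have hO i : exists O : nat -> set T,
    (forall k, open (O k) /\ dense (O k)) /\ \bigcap_k O k `<=` H i.
  by have [D h1 h2] := cH i; exists D.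
have [D DP] := choice hO.
exists (fun m => if unpickle m is Some (i, k) then D i k else setT).
  move=> m; case: unpickle => [[i k]|]; first exact: (proj1 (DP i)).
  by split; [exact: openT|move=> W W0 _; rewrite setIT].
move=> x xO i _; apply: (proj2 (DP i)) => k _.
by have := xO (pickle (i, k)) I; rewrite pickleK.
Qed.

Lemma comeagerI H K : comeager H -> comeager K -> comeager (H `&` K).
Proof.
move=> cH cK; have := @comeager_bigcap bool (fun b => if b then H else K).
move=> h; apply: comeagerS (h _); last by case.
by move=> x hx; split; [exact: (hx true)|exact: (hx false)].
Qed.

Lemma dense_bdyC U : open U -> dense (U `|` ~` closure U).
Proof.
move=> oU W W0 oW; have [[x [Ux Wx]]|h] := pselect (U `&` W !=set0).
  by exists x; split=> //; left.
have [x Wx] := W0; exists x; split=> //; right => /(_ W).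
by move=> /(_ (open_nbhs_nbhs (conj oW Wx))).
Qed.

Section Baire.
Hypotheses (cT : compact [set: T]) (hT : hausdorff_space T).

Lemma regular_shrink U V : open U -> dense U -> open V -> V !=set0 ->
  exists W, [/\ open W, W !=set0, closure W `<=` V & closure W `<=` U].
Proof.
move=> oU dU oV V0; have [x [Vx Ux]] := dU V V0 oV.
have /compact_regular : compact [set: T] by [].
move=> /(_ x hT (filterT)) /(_ (V `&` U)) [|A nA AVU].
  by apply: open_nbhs_nbhs; split=> //; exact: openI.
exists (interior A); have sub : closure (interior A) `<=` V `&` U.
  by apply: subset_trans AVU; apply: closureS; exact: interior_subset.
split; [exact: open_interior| |by move=> y /sub[]|by move=> y /sub[]].
by exists x.
Qed.

(** Baire's theorem: the nested open sets generate a filter, and a cluster point of it lies in all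
    their closures. *)
Theorem comeager_dense H : comeager H -> dense H.
Proof.
move=> [D DP DH] V V0 oV.
pose good := {W : set T | open W /\ W !=set0}.
have step (k : nat) (W : good) : exists W' : good,
    closure (sval W') `<=` sval W /\ closure (sval W') `<=` D k.
  have [[oD dD] [oW W0]] := (DP k, svalP W).
  by have [W' [? ? ? ?]] := regular_shrink oD dD oW W0; unshelve eexists; first by exists W'.
pose next k (W : good) := projT1 (cid (step k W)).
pose W := fix W k : good := if k is k'.+1 then next k' (W k') else exist _ V (conj oV V0).
have WS k : closure (sval (W k.+1)) `<=` sval (W k) /\ closure (sval (W k.+1)) `<=` D k.
  exact: projT2 (cid (step k (W k))).
have Wdec k m : sval (W (k + m)%N) `<=` sval (W k).
  elim: m => [|m IH]; first by rewrite addn0.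
  rewrite addnS; apply: subset_trans IH; apply: subset_trans (proj1 (WS _)).
  exact: subset_closure.
pose F := filter_from [set: nat] (fun k => sval (W k)).
have FF : ProperFilter F.
  apply: filter_from_proper => [|k _]; last by case: (svalP (W k)).
  apply: filter_from_filter; first by exists 0%N.
  move=> i j _ _; exists (i + j)%N => // x hx; split; first exact: Wdec hx.
  by rewrite addnC in hx; exact: Wdec hx.
have [] := cT (F := F); first by exists 0%N.
move=> p [_]; rewrite clusterE => pF.
have pW k : closure (sval (W k)) p by apply: pF; exists k.
exists p; split; first by apply: (proj1 (WS 0%N)); exact: pW.
by apply: DH => k _; apply: (proj2 (WS k)); exact: pW.
Qed.

End Baire.
End comeager.

(** * The weak* topology on the functionals and its compactness *)

Section functionals.
Context {R : realType} {u : bool} (T : theory R u).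
Local Notation X := (set_type (TT T) : topologicalType).
Implicit Types (s : X) (phi : Sigma R u).

Definition ev phi s : R := set_val s phi.

Lemma initial_cvg (S : choiceType) (Y : topologicalType) (f : S -> Y)
  (F : set_system S) (s : initial_topology f) : Filter F ->
  f @ F --> f s -> F --> s.
Proof.
move=> FF h A /= [_ [[B Bop <-] Bfs sBA]].
by apply: filterS sBA _; apply: h; exact: open_nbhs_nbhs.
Qed.

Lemma ptws_cvg (F : set_system X) s : Filter F ->
  (forall phi, ev phi t @[t --> F] --> ev phi s) -> F --> s.
Proof.
move=> FF h; apply: (initial_cvg (f := set_val)); apply/cvg_sup => phi.
by apply: (initial_cvg (f := fun g : Sigma R u -> R => g phi)); exact: h.
Qed.

Lemma ev_continuous phi : continuous (ev phi).
Proof.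
move=> s; have /cvg_sup/(_ phi) h : set_val t @[t --> s] --> set_val s.
  exact: (@initial_continuous _ _ (set_val : X -> _)).
move=> C nC; apply: (h _ ((fun g => g phi) @^-1` C)); first by apply: fmap_filter; exact: (@nbhs_filter X).
exact: (@initial_continuous _ _ (fun g : Sigma R u -> R => g phi) (set_val s) C).
Qed.

Lemma open_ev_lt phi (r : R) : open [set s | ev phi s < r].
Proof.
apply: open_comp (@open_lt R r) => s _; exact: ev_continuous.
Qed.

Lemma open_ev_gt phi (r : R) : open [set s | r < ev phi s].
Proof.
apply: open_comp (@open_gt R r) => s _; exact: ev_continuous.
Qed.

Lemma ev_inj s t : (forall phi, ev phi s = ev phi t) -> s = t.
Proof. by move=> h; apply: val_inj; apply/funext => phi; exact: h. Qed.

Lemma TT_hausdorff : hausdorff_space X.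
Proof.
move=> p q pq; apply: ev_inj => phi; apply: (@Rhausdorff R) => A B pA qB.
have [s [sA sB]] := pq _ _ (@ev_continuous phi p _ pA) (@ev_continuous phi q _ qB).
by exists (ev phi s).
Qed.

Lemma TT_ex s : exists (A : cstarAlg R u) (a : assignment consts A),
  models A T /\ set_val s = functional a.
Proof. exact: set_mem (valP s). Qed.

Lemma evE s (A : cstarAlg R u) (a : assignment consts A) phi :
  set_val s = functional a -> ev phi s = feval a (sval phi).
Proof. by rewrite /ev => ->. Qed.

Definition mkTT (A : cstarAlg R u) (a : assignment consts A) (mA : models A T) : X :=
  exist _ (functional a) (mem_set (ex_intro _ A (ex_intro _ a (conj mA erefl)))).

(** The ultrafilter lives on the space of functionals, which thus serves as the index set: the
    ultraproduct of chosen models, with the constants interpreted coordinatewise, realizes the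
    limit. *)
Lemma TT_compact : compact [set: X].
Proof.
rewrite compact_ultra => U UU _.
pose A s := projT1 (cid (TT_ex s)).
have hA s : exists a : assignment consts (A s), models (A s) T /\ set_val s = functional a.
  exact: projT2 (cid (TT_ex s)).
pose a s := projT1 (cid (hA s)).
have aP s : models (A s) T /\ set_val s = functional (a s) := projT2 (cid (hA s)).
exists (mkTT (uc_assign UU a) (models_ultraproduct UU (fun s => proj1 (aP s)))).
split=> //; apply: ptws_cvg => phi.
have e : (fun s => feval (a s) (sval phi)) = ev phi.
  by apply/funext => s; rewrite (evE _ (proj2 (aP s))).
have := @los R u _ U UU A consts (sval phi) a; rewrite e; exact.
Qed.

End functionals.

(** * Separability of the language *)

(* Numbering the symbols turns an assignment into a stream of elements, to which
   a quantifier prepends an element. *)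
Record naming (V : symbols) := Naming {
  name : forall n, V n -> nat;
  unname : nat -> option {n & V n};
  nameK : forall n v, unname (@name n v) = Some (existT V n v) }.

Definition naming_none : naming nosyms :=
  @Naming nosyms (fun _ v => match v with end) (fun=> None)
    (fun _ v => match v with end).

Definition ext_name V (N : naming V) n m (v : ext V n m) : nat :=
  match v with Old _ w => (name N w).+1 | New => 0%N end.

Definition ext_unname V (N : naming V) n i : option {m & ext V n m} :=
  if i is j.+1 then
    omap (fun s : {m & V m} => existT (ext V n) (projT1 s) (Old n (projT2 s))) (unname N j)
  else Some (existT (ext V n) n (New V n)).

Lemma ext_nameK V (N : naming V) n m (v : ext V n m) :
  ext_unname N n (ext_name N v) = Some (existT (ext V n) m v).
Proof. by case: v => [k w|] //=; rewrite nameK. Qed.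

Definition naming_ext V (N : naming V) n : naming (ext V n) :=
  Naming (ext_nameK N (n := n)).

Fixpoint naming_exts V (N : naming V) xs : naming (exts V xs) :=
  if xs is n :: xs' return naming (exts V xs) then naming_exts (naming_ext N n) xs' else N.

Definition const_unname (i : nat) : option {n & consts n} :=
  omap (fun p : nat * nat => existT consts p.1 p.2) (unpickle i).

Lemma const_nameK n (j : consts n) :
  const_unname (pickle (n, j : nat)) = Some (existT consts n j).
Proof. by rewrite /const_unname pickleK. Qed.

Definition naming_consts : naming consts := Naming const_nameK.

Lemma nth_map_enum_ord k (T : Type) (h : 'I_k -> T) x0 (i : 'I_k) :
  nth x0 [seq h j | j <- enum 'I_k] i = h i.
Proof. by rewrite (nth_map i) ?size_enum_ord// nth_ord_enum. Qed.

Section generated.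
Variables (T : Type) (base : nat -> T) (op : nat -> seq T -> T).

(** Trees labelled by naturals form a countable type, so whatever is generated from countably many
    elements by countably many finitary operations is the range of such an evaluation. Terms,
    formulas and Skolem hulls are all treated this way. *)
Fixpoint gen_eval (t : GenTree.tree nat) : T :=
  match t with
  | GenTree.Leaf n => base n
  | GenTree.Node n l => op n (map gen_eval l)
  end.

End generated.

Section rational_approximation.
Context {R : realType}.

Lemma ratr_approx (x e : R) : 0 < e -> exists q : rat, `|x - ratr q| < e.
Proof.
move=> e0; have [q] : exists q : rat, ratr q \in `]x - e, x + e[.
  by apply: rat_in_itvoo; lra.
by rewrite in_itv/= => /andP[h1 h2]; exists q; rewrite ltr_norml; apply/andP; split; lra.
Qed.

Definition qcomplex (p : rat * rat) : R[i] := (ratr p.1 +i* ratr p.2)%C.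

Lemma cabs_le (a b : R) : cabs (a +i* b)%C <= `|a| + `|b|.
Proof.
rewrite -lecR -normC_cabs rmorphD/= -!cabs_real -!normC_cabs.
have -> : (a +i* b)%C = a%:C%C + 'i%C * b%:C%C by simpc.
rewrite (le_trans (ler_normD _ _))// normrM lerD2l.
by rewrite [`|'i%C|]normc_def/= expr0n/= add0r expr1n sqrtr1 mul1r.
Qed.

Lemma qcomplex_approx (l : R[i]) (e : R) : 0 < e -> exists p, cabs (l - qcomplex p) < e.
Proof.
case: l => a b e0; have e20 : 0 < e / 2 by rewrite divr_gt0.
have [p pa] := ratr_approx a e20; have [q qb] := ratr_approx b e20.
exists (p, q); apply: le_lt_trans (cabs_le _ _) _ => /=.
by apply: lt_le_trans (ltrD pa qb) _; rewrite -splitr.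
Qed.

(* A table of rationals indexed by the cells of a grid in a cube. *)
Definition grid : countType :=
  ((nat * nat) * {kM : nat * nat & {ffun {ffun 'I_kM.1 -> 'I_kM.2.+1} -> rat}})%type.

Definition grid_eval (g : grid) (w : seq R) : R :=
  let: (p, existT kM t) := g in
  ratr (t [ffun i : 'I_kM.1 => inord (Num.trunc (p.1%:R * (nth 0 w i + p.2%:R)))]).

Lemma grid_approx k (f : 'rV[R]_k -> R) K e : continuous f -> 0 < e ->
  exists g, exists2 d, 0 < d & forall v : 'rV[R]_k, row_box K v ->
    forall w, (forall i : 'I_k, `|v 0 i - nth 0 w i| <= d) ->
    `|f v - grid_eval g w| <= e.
Proof.
move=> cf e0; have e20 : 0 < e / 2 by rewrite divr_gt0.
have [d d0 dP] := unif_continuous_row K cf e20.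
(* The cube [[-L, L]] contains the box with margin 1, and cells have width [N%:R^-1 < d / 2]. *)
pose L := Num.bound (`|K| + 1); pose N := Num.bound (2 / d).
have LK : `|K| + 1 < L%:R by apply: archi_boundP; rewrite addr_ge0.
have Nd : 2 / d < N%:R by apply: archi_boundP; rewrite divr_ge0// ltW.
have N0 : 0 < N%:R :> R by apply: le_lt_trans Nd; rewrite divr_ge0// ltW.
have N1 : N%:R^-1 < d / 2.
  by rewrite -[d / 2]invrK ltf_pV2 ?posrE ?invr_gt0 ?divr_gt0// invf_div.
pose M := (N * (2 * L))%N.
pose pt (x : {ffun 'I_k -> 'I_M.+1}) : 'rV[R]_k := \row_i ((x i)%:R / N%:R - L%:R).
have /choice[t tP] (x : {ffun 'I_k -> 'I_M.+1}) :
    exists q : rat, `|f (pt x) - ratr q| < e / 2 by exact: ratr_approx.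
exists ((N, L), existT (fun kM : nat * nat => {ffun {ffun 'I_kM.1 -> 'I_kM.2.+1} -> rat})
  (k, M) (finfun t)).
(* The bound 1 keeps [w] in the cube; [d / 2] and the width of a cell add up to at most [d]. *)
exists (Num.min (d / 2) 1); first by rewrite lt_min divr_gt0 ?ltr01.
move=> v vK w vw.
pose x : {ffun 'I_k -> 'I_M.+1} :=
  [ffun i : 'I_k => inord (Num.trunc (N%:R * (nth 0 w i + L%:R)))].
rewrite (_ : grid_eval _ w = ratr (t x)); last by rewrite /grid_eval ffunE.
have vx i : `|v 0 i - pt x 0 i| <= d.
  rewrite mxE ffunE; have := vw i; rewrite le_min => /andP[wd w1].
  have y0 : 0 <= N%:R * (nth 0 w i + L%:R).
    rewrite mulr_ge0//; have := vK i; have := ler_norm K.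
    by move: w1 LK; rewrite !ler_norml => /andP[? ?] ? ? /andP[? ?]; lra.
  have yM : (Num.trunc (N%:R * (nth 0 w i + L%:R))%R < M.+1)%N.
    rewrite truncn_lt_nat// (@le_lt_trans _ _ M%:R) ?ltr_nat// /M natrM ler_pM2l//.
    rewrite natrM; have := vK i; have := ler_norm K.
    by move: w1 LK; rewrite !ler_norml => /andP[? ?] ? ? /andP[? ?]; lra.
  rewrite inordK//; set m := Num.trunc _.
  have m1 : m%:R <= N%:R * (nth 0 w i + L%:R) by rewrite -truncn_ge_nat.
  have m2 : N%:R * (nth 0 w i + L%:R) < m.+1%:R by rewrite -truncn_le_nat.
  have m3 : m%:R / N%:R <= nth 0 w i + L%:R by rewrite ler_pdivrMr// mulrC.
  have m4 : nth 0 w i + L%:R < m%:R / N%:R + N%:R^-1.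
    by rewrite -[X in _ < _ + X]mul1r -mulrDl natr1 ltr_pdivlMr// mulrC.
  move: wd; rewrite !ler_norml => /andP[? ?]; apply/andP; split; lra.
have h1 := dP v (pt x) vK vx; have h2 := tP x.
have := ler_distD (f (pt x)) (f v) (ratr (t x)).
by move=> h; rewrite (le_trans h)// [e]splitr lerD// ltW.
Qed.

End rational_approximation.

Section separability.
Context {R : realType} {u : bool}.
Implicit Types (V : symbols) (A : cstarAlg R u).

(* Codes denote functions of streams rather than terms and formulas: binding needs
   no substitution and the coded connectives need not be continuous. *)
Definition tsem := forall A, (nat -> A) -> A.
Definition fsem := forall A, (nat -> A) -> R.

Definition scons A (x : A) (env : nat -> A) : nat -> A :=
  fun i => if i is j.+1 then env j else x.

Definition tzero : tsem := fun A _ => 0.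
(** Codes are common to both languages, so this node needs a value even where there is no unit. *)
Definition tone : tsem := fun A _ =>
  match pselect u with left h => cone A h | right _ => 0 end.

Definition tbase (i : nat) : tsem := fun A env => env i.
(** Labels from 5 on encode scalings by Gaussian rationals. Sorts are forgotten, so inclusions need
    no node, and missing arguments default to 0. *)
Definition top (c : nat) (l : seq tsem) : tsem := fun A env =>
  let x := nth tzero l 0 A env in let y := nth tzero l 1 A env in
  match c with
  | 0 => 0 | 1 => tone env | 2 => x + y | 3 => cmul x y | 4 => cstar x
  | c'.+4.+1 => if unpickle c' is Some p then qcomplex p *: x else 0
  end.
Definition tcode : GenTree.tree nat -> tsem := gen_eval tbase top.

Lemma tcode_scale k c A (env : nat -> A) : tcode (GenTree.Node k.+4.+1 [:: c]) env =
  if unpickle k is Some p then qcomplex p *: tcode c env else 0.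
Proof. by []. Qed.

Definition fzero : fsem := fun _ _ => 0.
Definition fbase (i : nat) : fsem := fun A env =>
  if unpickle i is Some (s, t) then rnorm (tcode s env - tcode t env) else 0.
Definition fop (c : nat) (l : seq fsem) : fsem := fun A env =>
  match unpickle c : option (bool * nat + grid) with
  | Some (inl (b, n)) =>
    let F (x : cball A n) := nth fzero l 0 A (scons (sval x) env) in
    if b then sup (range F) else inf (range F)
  | Some (inr g) => grid_eval g [seq F A env | F : fsem <- l]
  | None => 0
  end.
Definition fcode : GenTree.tree nat -> fsem := gen_eval fbase fop.

Lemma fcode_dist k A (env : nat -> A) : fcode (GenTree.Leaf k) env =
  if unpickle k is Some (s, t) then rnorm (tcode s env - tcode t env) else 0.
Proof. by []. Qed.

Lemma fcode_node k l A (env : nat -> A) :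
  fcode (GenTree.Node k l) env = fop k [seq fcode c | c <- l] env.
Proof. by []. Qed.

Definition agree V (N : naming V) A (a : assignment V A) (env : nat -> A) :=
  forall n v, env (name N v) = sval (a n v).

Lemma agree_extend V (N : naming V) A (a : assignment V A) env n (x : cball A n) :
  agree N a env -> agree (naming_ext N n) (extend a x) (scons (sval x) env).
Proof. by move=> h m [k w|] //=; exact: h. Qed.

(** One code serves all algebras and assignments because values of a term are bounded by its sort,
    which controls the errors in products and scalings. *)
Lemma tcode_approx V (N : naming V) n (t : term R u V n) e : 0 < e ->
  exists c, forall A (a : assignment V A) env, agree N a env ->
    rnorm (teval a t - tcode c env) <= e.
Proof.
elim: t e => {n} [n v||h|m n s IHs t IHt|m n s IHs t IHt|n t IHt|l m n lmn t IHt|m n mn t IHt] e e0.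
- exists (GenTree.Leaf (name N v)) => A a env ae /=.
  by rewrite /tcode/= /tbase ae subrr rnorm0 ltW.
- exists (GenTree.Node 0 [::]) => A a env ae /=.
  by rewrite /tcode/= /top subrr rnorm0 ltW.
- exists (GenTree.Node 1 [::]) => A a env ae /=.
  rewrite /tcode/= /top /tone; case: pselect => // h'.
  by rewrite (bool_irrelevance h' h) subrr rnorm0 ltW.
- have e20 : 0 < e / 2 by rewrite divr_gt0.
  have [c1 h1] := IHs _ e20; have [c2 h2] := IHt _ e20.
  exists (GenTree.Node 2 [:: c1; c2]) => A a env ae /=.
  rewrite /tcode/= /top/= opprD addrACA (le_trans (rnormD _ _))// [e]splitr.
  by rewrite lerD ?(h1 _ _ _ ae) ?(h2 _ _ _ ae).
(* This denominator ensures both [e1 <= 1], which bounds the approximant of the second factor by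
   [n%:R + 1], and [e1 * (m%:R + n%:R + 1) <= e]. *)
- pose d := m%:R + n%:R + 1 + e; pose e1 := e / d.
  have d0 : 0 < d by rewrite ltr_wpDl.
  have e10 : 0 < e1 by rewrite divr_gt0.
  have e1d : e1 * d = e by rewrite /e1 divfK// gt_eqF.
  have e11 : e1 <= 1 by rewrite ler_pdivrMr// mul1r lerDr addr_ge0// addr_ge0.
  have [c1 h1] := IHs _ e10; have [c2 h2] := IHt _ e10.
  exists (GenTree.Node 3 [:: c1; c2]) => A a env ae /=.
  rewrite /tcode/= /top/= -/(tcode c1) -/(tcode c2).
  have {}h1 := h1 _ _ _ ae; have {}h2 := h2 _ _ _ ae.
  set y := tcode c2 env in h2 *; set x := tcode c1 env in h1 *.
  have yn : rnorm y <= n%:R + 1.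
    have := rnormD (teval a t) (y - teval a t); rewrite addrC subrK (rnormB y).
    by move/le_trans; apply; rewrite lerD// ?rnorm_teval// (le_trans h2).
  have -> : cmul (teval a s) (teval a t) - cmul x y =
      cmul (teval a s) (teval a t - y) + cmul (teval a s - x) y.
    by rewrite cmulBr cmulBl addrA subrK.
  rewrite (le_trans (rnormD _ _))//.
  apply: (@le_trans _ _ (m%:R * e1 + e1 * (n%:R + 1))).
    rewrite lerD// (le_trans (rnorm_cmul _ _))// ler_pM ?rnorm_ge0 ?rnorm_teval//.
  rewrite (mulrC _ e1) -mulrDr -e1d ler_pM2l// /d; lra.
- have [c h] := IHt _ e0; exists (GenTree.Node 4 [:: c]) => A a env ae /=.
  by rewrite /tcode/= /top/= -cstarB rnorm_cstar h.
- have m0 : 0 < m%:R + 1 :> R by rewrite ltr_wpDl.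
  have [p pl] : exists p, cabs (l - qcomplex p) < e / (2 * (m%:R + 1)).
    by apply: qcomplex_approx; rewrite divr_gt0 ?mulr_gt0.
  have q0 : 0 < cabs (qcomplex p : R[i]) + 1 by rewrite ltr_wpDl// cabs_ge0.
  have [c h] : exists c, forall A (a : assignment V A) env, agree N a env ->
      rnorm (teval a t - tcode c env) <= e / (2 * (cabs (qcomplex p : R[i]) + 1)).
    by apply: IHt; rewrite divr_gt0 ?mulr_gt0.
  exists (GenTree.Node (pickle p).+4.+1 [:: c]) => A a env ae.
  rewrite -[teval _ _]/(l *: teval a t) tcode_scale pickleK.
  have -> : l *: teval a t - qcomplex p *: tcode c env =
      (l - qcomplex p) *: teval a t + qcomplex p *: (teval a t - tcode c env).
    by rewrite scalerBr scalerBl addrA subrK.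
  rewrite (le_trans (rnormD _ _))// !rnormZ [e]splitr lerD//.
    apply: (@le_trans _ _ (e / (2 * (m%:R + 1)) * (m%:R + 1))).
      rewrite ler_pM ?cabs_ge0 ?rnorm_ge0 ?ltW// (le_lt_trans (rnorm_teval _ _))//.
      by rewrite ltrDl.
    by rewrite invfM mulrA divfK ?gt_eqF.
  apply: (@le_trans _ _ ((cabs (qcomplex p : R[i]) + 1) *
      (e / (2 * (cabs (qcomplex p : R[i]) + 1))))).
    by rewrite ler_pM ?cabs_ge0 ?rnorm_ge0 ?lerDl// h.
  by rewrite mulrC invfM mulrA divfK ?gt_eqF.
- exact: IHt.
Qed.

(** Suprema and infima do not increase uniform errors, so quantifiers keep [e]. For a connective the
    modulus [d] of its grid dictates the accuracy of the arguments. *)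
Lemma fcode_approx V (N : naming V) (phi : formula R u V) e : 0 < e ->
  exists c, forall A (a : assignment V A) env, agree N a env ->
    `|feval a phi - fcode c env| <= e.
Proof.
elim: phi N e => {V} [V n t1 t2|V k f cf args IH|V n psi IH|V n psi IH] N e e0.
- have e20 : 0 < e / 2 by rewrite divr_gt0.
  have [c1 h1] := tcode_approx N t1 e20; have [c2 h2] := tcode_approx N t2 e20.
  exists (GenTree.Leaf (pickle (c1, c2))) => A a env ae.
  rewrite fcode_dist pickleK (le_trans (rnorm_dist _ _))//.
  have -> : teval a t1 - teval a t2 - (tcode c1 env - tcode c2 env) =
      (teval a t1 - tcode c1 env) - (teval a t2 - tcode c2 env).
    by rewrite !opprD !opprK addrACA.
  by rewrite (le_trans (rnormD _ _))// rnormN [e]splitr lerD ?h1 ?h2.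
- have [K KP] := choice (fun i => feval_bound (args i)).
  have [K1 K10 K1P] := fin_bound K.
  have [g [d d0 gP]] := grid_approx K1 cf e0.
  have /choice[c cP] i : exists c, forall A (a : assignment V A) env, agree N a env ->
      `|feval a (args i) - fcode c env| <= d by exact: IH.
  exists (GenTree.Node (pickle (inr g : bool * nat + grid)%type) [seq c i | i <- enum 'I_k]).
  move=> A a env ae; rewrite fcode_node /fop pickleK.
  have -> : [seq F A env | F : fsem <- [seq fcode t | t <- [seq c i | i <- enum 'I_k]]] =
      [seq fcode (c i) env | i <- enum 'I_k] by rewrite -2!map_comp.
  rewrite -[feval a _]/(f (\row_i feval a (args i))); apply: gP => i.
    by rewrite mxE (le_trans (KP i A a)).
  by rewrite mxE nth_map_enum_ord; exact: cP.
- have [c cP] := IH (naming_ext N n) e e0.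
  exists (GenTree.Node (pickle (inl (true, n) : bool * nat + grid)%type) [:: c]).
  move=> A a env ae; rewrite fcode_node /fop pickleK/=.
  have [K KP] := feval_bound psi.
  apply: (sup_range_dist (cball0 A n) (K := K)) => x; first exact: KP.
  exact/cP/agree_extend.
- have [c cP] := IH (naming_ext N n) e e0.
  exists (GenTree.Node (pickle (inl (false, n) : bool * nat + grid)%type) [:: c]).
  move=> A a env ae; rewrite fcode_node /fop pickleK/=.
  have [K KP] := feval_bound psi.
  apply: (inf_range_dist (cball0 A n) (K := K)) => x; first exact: KP.
  exact/cP/agree_extend.
Qed.

Definition env_of V (N : naming V) A (a : assignment V A) : nat -> A :=
  fun i => if unname N i is Some s then sval (a (projT1 s) (projT2 s)) else 0.

Lemma agree_env_of V (N : naming V) A (a : assignment V A) : agree N a (env_of N a).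
Proof. by move=> n v; rewrite /env_of nameK. Qed.

(* A subset of a separable pseudometric space is separable. *)
Lemma formulas_separable V (N : naming V) (Psi : set (formula R u V)) :
  exists2 g : nat -> option (formula R u V), forall k phi, g k = Some phi -> Psi phi &
    forall phi e, Psi phi -> 0 < e -> exists k psi, g k = Some psi /\
      forall A (a : assignment V A), `|feval a phi - feval a psi| <= e.
Proof.
pose near (p : GenTree.tree nat * nat) := [set phi | Psi phi /\
  forall A (a : assignment V A), `|feval a phi - fcode p.1 (env_of N a)| <= p.2.+1%:R^-1].
pose g k := if unpickle k is Some p then
    (if pselect (near p !=set0) is left h then Some (projT1 (cid h)) else None) else None.
exists g => [k phi|phi e Pphi e0].
  rewrite /g; case: unpickle => // p; case: pselect => // h [<-].
  by have [] := projT2 (cid h).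
pose m := Num.bound (2 / e).
have m0 : 2 / e < m%:R by apply: archi_boundP; rewrite divr_ge0// ltW.
have me : m.+1%:R^-1 <= e / 2.
  rewrite -[e / 2]invrK lef_pV2 ?posrE ?invr_gt0 ?divr_gt0// invf_div.
  by rewrite (le_trans (ltW m0))// ler_nat.
have [|c cP] := @fcode_approx V N phi m.+1%:R^-1; first by rewrite invr_gt0.
have nphi : near (c, m) phi by split=> // A a; apply: cP; exact: agree_env_of.
exists (pickle (c, m)); rewrite /g pickleK; case: pselect => [h|[]]; last by exists phi.
case: cid => psi [Ppsi hpsi] /=; exists psi; split=> // A a.
rewrite (le_trans (ler_distD (fcode c (env_of N a)) _ _))// [e]splitr.
apply: lerD; first exact: le_trans (proj2 nphi A a) me.
by rewrite distrC; exact: le_trans (hpsi A a) me.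
Qed.

Lemma terms_separable V (N : naming V) :
  exists g : nat -> {n & term R u V n}, forall n (t : term R u V n) e, 0 < e ->
    exists k, forall A (a : assignment V A), rnorm (teval a t - teval a (projT2 (g k))) <= e.
Proof.
pose near (p : GenTree.tree nat * nat) := [set s : {n & term R u V n} |
  forall A (a : assignment V A),
    rnorm (teval a (projT2 s) - tcode p.1 (env_of N a)) <= p.2.+1%:R^-1].
pose t0 : {n & term R u V n} := existT _ _ (Zero R u V).
pose g k := if unpickle k is Some p then
    (if pselect (near p !=set0) is left h then projT1 (cid h) else t0) else t0.
exists g => n t e e0.
pose m := Num.bound (2 / e).
have m0 : 2 / e < m%:R by apply: archi_boundP; rewrite divr_ge0// ltW.
have me : m.+1%:R^-1 <= e / 2.
  rewrite -[e / 2]invrK lef_pV2 ?posrE ?invr_gt0 ?divr_gt0// invf_div.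
  by rewrite (le_trans (ltW m0))// ler_nat.
have [|c cP] := @tcode_approx V N n t m.+1%:R^-1; first by rewrite invr_gt0.
have nt : near (c, m) (existT _ n t) by move=> A a; apply: cP; exact: agree_env_of.
exists (pickle (c, m)) => A a; rewrite /g pickleK.
case: pselect => [h|[]]; last by exists (existT _ n t).
case: cid => s hs /=.
rewrite (le_trans (rnorm_triangle (tcode c (env_of N a)) _ _))// [e]splitr.
apply: lerD; first exact: le_trans (nt A a) me.
by rewrite rnormB; exact: le_trans (hs A a) me.
Qed.

End separability.

(** * Separable elementary subalgebras *)

Section density.
Context {R : realType} {u : bool}.
Implicit Types A : cstarAlg R u.

Lemma closure_rnorm A (S : set A) (x : A) :
  closure S x <-> forall e, 0 < e -> exists2 y, S y & rnorm (x - y) < e.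
Proof.
split=> [cx e e0|h U].
  have /cx[y [Sy]] : nbhs x (ball x e%:C%C) by apply: nbhsx_ballx; rewrite ltcR.
  by rewrite -ball_normE/= normE ltcR; exists y.
rewrite -filter_from_ballE => -[e /= e0 sub].
have [e1 e1E] : exists e1, e = e1%:C%C.
  by apply/complex_realP; rewrite ger0_real// ltW.
have [|y Sy xy] := h e1; first by rewrite e1E ltcR in e0.
by exists y; split=> //; apply: sub; rewrite -ball_normE/= normE e1E ltcR.
Qed.

Lemma sortwise_denseP A (a : assignment consts A) :
  sortwise_dense a <-> forall n (x : cball A n) e, 0 < e ->
    exists j, rnorm (sval x - sval (a n j)) < e.
Proof.
split=> [h n [x xn] e e0|h n].
  have : closure (range (fun j : nat => sval (a n j))) x by rewrite h.
  by move=> /closure_rnorm/(_ e e0)[_ [j _ <-] xj]; exists j.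
apply/seteqP; split=> [x /closure_rnorm cx|x xn].
  rewrite /= normr_leN; apply/ler_addgt0Pr => e e0.
  have [_ [j _ <-] xj] := cx e e0; rewrite -(subrK (sval (a n j)) x).
  by rewrite (le_trans (rnormD _ _))// addrC lerD ?cball_rnorm// ltW.
apply/closure_rnorm => e e0; have [j xj] := h n (exist _ x xn) e e0.
by exists (sval (a n j)) => //; exists j.
Qed.

(** This is the Tarski-Vaught test for one quantifier: near-optimal witnesses exist in the image of
    [f]. *)
Lemma sup_range_sub (T1 T2 : Type) (t1 : T1) (f : T1 -> T2) (H : T2 -> R) K :
  (forall y, `|H y| <= K) ->
  (forall y e, 0 < e -> exists x, H y <= H (f x) + e) ->
  sup (range (fun x => H (f x))) = sup (range H).
Proof.
move=> HK hd; have HfK x : `|H (f x)| <= K by exact: HK.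
apply/eqP; rewrite eq_le; apply/andP; split.
  by apply: (sup_range_le t1) => x; exact: (le_sup_range (f t1) HK).
apply: (sup_range_le (f t1)) => y; apply/ler_addgt0Pr => e e0.
have [x hx] := hd y e e0; rewrite (le_trans hx)// lerD2r.
exact: (le_sup_range t1 HfK).
Qed.

Lemma inf_range_sub (T1 T2 : Type) (t1 : T1) (f : T1 -> T2) (H : T2 -> R) K :
  (forall y, `|H y| <= K) ->
  (forall y e, 0 < e -> exists x, H (f x) <= H y + e) ->
  inf (range (fun x => H (f x))) = inf (range H).
Proof.
move=> HK hd; rewrite !inf_range; congr (- _).
apply: (sup_range_sub t1 (H := fun x => - H x) (K := K)) => [y|y e e0].
  by rewrite normrN.
by have [x hx] := hd y e e0; exists x; lra.
Qed.

Lemma opp_row_continuous : continuous (fun v : 'rV[R]_1 => - v 0 0).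
Proof.
by move=> v; exact: (cvgN (@coord_continuous R 1 1 0 0 v)).
Qed.

Definition fneg V (phi : formula R u V) : formula R u V :=
  Conn opp_row_continuous (fun=> phi).

Lemma feval_neg V A (a : assignment V A) phi : feval a (fneg phi) = - feval a phi.
Proof. by rewrite /= mxE. Qed.

End density.

Section closure_csub.
Context {R : realType} {u : bool} (A : cstarAlg R u) (H : set A).

Definition norm_closure : set A :=
  [set x | forall e, 0 < e -> exists2 y, H y & rnorm (x - y) < e].

Lemma norm_closure_sub x : H x -> norm_closure x.
Proof. by move=> hx e e0; exists x => //; rewrite subrr rnorm0. Qed.

Lemma norm_closure_closed x :
  (forall e, 0 < e -> exists2 y, norm_closure y & rnorm (x - y) < e) -> norm_closure x.
Proof.
move=> h e e0; have e20 : 0 < e / 2 by rewrite divr_gt0.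
have [y hy xy] := h _ e20; have [z hz yz] := hy _ e20.
exists z => //; apply: le_lt_trans (rnorm_triangle y _ _) _.
by rewrite [e]splitr ltrD.
Qed.

(** Sums and products are extended to the closure one variable at a time, each being Lipschitz when
    the other variable is fixed. *)
Lemma norm_closure_lipschitz (f : A -> A) (L : R) :
  (forall x y, rnorm (f x - f y) <= L * rnorm (x - y)) ->
  (forall x, H x -> norm_closure (f x)) ->
  forall x, norm_closure x -> norm_closure (f x).
Proof.
move=> fL fh x hx; apply: norm_closure_closed => e e0.
have L0 : 0 < `|L| + 1 by rewrite ltr_wpDl.
have [y hy xy] := hx (e / (`|L| + 1)) (divr_gt0 e0 L0).
exists (f y); first exact: fh.
apply: le_lt_trans (fL _ _) _; apply: (@le_lt_trans _ _ ((`|L| + 1) * rnorm (x - y))).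
  by rewrite ler_wpM2r ?rnorm_ge0// (le_trans (ler_norm L))// lerDl.
by rewrite -ltr_pdivlMl// mulrC.
Qed.

Hypothesis H0 : H 0.
Hypothesis HD : forall x y, H x -> H y -> norm_closure (x + y).
Hypothesis HZ : forall l x, H x -> norm_closure (l *: x).
Hypothesis HM : forall x y, H x -> H y -> norm_closure (cmul x y).
Hypothesis HS : forall x, H x -> norm_closure (cstar x).
Hypothesis H1 : forall h, norm_closure (cone A h).

Lemma norm_closureZ l x : norm_closure x -> norm_closure (l *: x).
Proof.
apply: (norm_closure_lipschitz (L := cabs l)) => {x} [x y|]; last exact: HZ.
by rewrite -scalerBr rnormZ.
Qed.

Lemma norm_closureS x : norm_closure x -> norm_closure (cstar x).
Proof.
apply: (norm_closure_lipschitz (L := 1)) => {x} [x y|]; last exact: HS.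
by rewrite -cstarB rnorm_cstar mul1r.
Qed.

Lemma norm_closureD x y : norm_closure x -> norm_closure y -> norm_closure (x + y).
Proof.
move=> hx; apply: (norm_closure_lipschitz (f := fun y => x + y) (L := 1)) => {y} [y z|y hy].
  by rewrite opprD addrACA subrr add0r mul1r.
move: x hx; apply: (norm_closure_lipschitz (f := fun x => x + y) (L := 1)) => [x z|x hx].
  by rewrite opprD addrACA subrr addr0 mul1r.
exact: HD.
Qed.

Lemma norm_closureM x y : norm_closure x -> norm_closure y -> norm_closure (cmul x y).
Proof.
move=> hx; apply: (norm_closure_lipschitz (f := fun y => cmul x y) (L := rnorm x)) => {y} [y z|y hy].
  by rewrite -cmulBr rnorm_cmul.
move: x hx; apply: (norm_closure_lipschitz (f := fun x => cmul x y) (L := rnorm y)) => [x z|x hx].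
  by rewrite -cmulBl mulrC rnorm_cmul.
exact: HM.
Qed.

(** [H] has to be closed under the operations only up to closure. Skolem witnesses and generic
    constants, which merely approximate the values of operations, are both covered. *)
Definition closure_csub : csub A :=
  CSub (norm_closure_sub H0) norm_closureD norm_closureZ norm_closureM
    norm_closureS H1 norm_closure_closed.

End closure_csub.

Lemma rnorm_le_nat (R : realType) u (A : cstarAlg R u) (x : A) :
  exists n : nat, rnorm x <= n%:R.
Proof.
by exists (Num.bound (rnorm x)); rewrite ltW// archi_boundP// rnorm_ge0.
Qed.

Lemma scale_sort (R : realType) (l : R[i]) n : exists m : nat, `|l| * n%:R <= m%:R.
Proof.
exists (Num.bound (cabs l * n%:R)).
rewrite normC_cabs -!(rmorph_nat (real_complex R)) -rmorphM/= lecR ltW//.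
by rewrite archi_boundP// mulr_ge0// cabs_ge0.
Qed.

Lemma inv_succ_le (R : realType) (e : R) : 0 < e -> exists m : nat, m.+1%:R^-1 <= e.
Proof.
move=> e0; exists (Num.bound e^-1); rewrite -[leRHS]invrK lef_pV2 ?posrE ?invr_gt0//.
have h : e^-1 < (Num.bound e^-1)%:R by apply: archi_boundP; rewrite invr_ge0 ltW.
by rewrite (le_trans (ltW h))// ler_nat.
Qed.

Section skolem_hull.
Context {R : realType} {u : bool} (A : cstarAlg R u) (a0 : assignment consts A).

Definition list_env (l : seq A) : nat -> A := nth 0 l.

(** The triple gives the radius, the coded formula and the tolerance. A tolerance is unavoidable,
    since an infimum over a ball need not be attained. *)
Definition near_min (p : nat * GenTree.tree nat * nat) (l : seq A) : set A :=
  [set x | rnorm x <= p.1.1%:R /\ forall y, rnorm y <= p.1.1%:R ->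
    fcode p.1.2 (scons x (list_env l)) <=
    fcode p.1.2 (scons y (list_env l)) + p.2.+1%:R^-1].

(* The values of the nodes of trees are Skolem witnesses, or 0 if there is none. *)
Definition hull_base (i : nat) : A :=
  if i is j.+1 then
    (if unpickle j is Some p then sval (@a0 p.1 p.2) else 0)
  else 0.

Definition hull_op (k : nat) (l : seq A) : A :=
  if unpickle k is Some p then
    (if pselect (near_min p l !=set0) is left h then projT1 (cid h) else 0)
  else 0.

Definition hull_eval : GenTree.tree nat -> A := gen_eval hull_base hull_op.
Definition hull : set A := range hull_eval.

Lemma hull0 : hull 0.
Proof. by exists (GenTree.Leaf 0). Qed.

Lemma hull_const n (j : nat) : hull (sval (@a0 n j)).
Proof.
exists (GenTree.Leaf (pickle (n, j)).+1) => //.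
by rewrite /hull_eval /gen_eval /hull_base pickleK.
Qed.

Lemma hull_op_in k l : (forall x, x \in l -> hull x) -> hull (hull_op k l).
Proof.
move=> hl; suff [ts <-] : exists ts, map hull_eval ts = l.
  by exists (GenTree.Node k ts).
elim: l hl => [|x l IH] hl; first by exists [::].
have [t _ tx] := hl x (mem_head _ _); have [|ts tsl] := IH.
  by move=> y yl; apply: hl; rewrite inE yl orbT.
by exists (t :: ts); rewrite /= tx tsl.
Qed.

(** The error [e] is spent on four steps of [e / 8], namely truncation of the parameters and passage
    to a code for each of [x] and [y], and on the tolerance of at most [e / 2] of the
    near-minimizer. *)
Lemma hull_skolem V (N : naming V) n (psi : formula R u (ext V n))
    (a : assignment V A) e : (forall m v, hull (sval (a m v))) -> 0 < e ->
  exists2 x : cball A n, hull (sval x) &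
    forall y, feval (extend a x) psi <= feval (extend a y) psi + e.
Proof.
move=> ha e0; have e80 : 0 < e / 8 by rewrite divr_gt0.
have [c cP] := fcode_approx (naming_ext N n) psi e80.
have [M [d d0 dP]] := feval_continuous psi (name (naming_ext N n)) e80.
have [m mP] := inv_succ_le (divr_gt0 e0 (ltr0n R 2)).
pose env := env_of N a; pose l := mkseq env M.
(* Parameters named beyond [M] become 0, the default of [nth], so that the finite list [l] describes
   [a'] exactly. *)
pose a' k (v : V k) := if (name N v < M)%N then a k v else cball0 A k.
have ae' : agree N a' (list_env l).
  move=> k v; rewrite /list_env /a'; case: ifPn => vM.
    by rewrite nth_mkseq//; exact: agree_env_of.
  by rewrite nth_default// size_mkseq leqNgt.
have hl x : x \in l -> hull x.
  move=> /mapP[i _ ->]; rewrite /env /env_of; case: unname => [s|]; last exact: hull0.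
  exact: ha.
have near1 (x : cball A n) : `|feval (extend a x) psi - feval (extend a' x) psi| <= e / 8.
  apply: dP => k [i v|] /= vM; last by rewrite subrr rnorm0 ltW.
  by rewrite /a' (ltnW vM) subrr rnorm0 ltW.
have near2 (x : cball A n) :
    `|feval (extend a' x) psi - fcode c (scons (sval x) (list_env l))| <= e / 8.
  exact/cP/agree_extend.
have [K KP] := feval_bound psi.
have m0 : 0 < m.+1%:R^-1 :> R by rewrite invr_gt0.
(* A coded function has no bound of its own; on this ball it inherits one from the formula it
   approximates, so near-minimizers exist. *)
have ex : near_min (n, c, m) l !=set0.
  pose F (x : cball A n) := - fcode c (scons (sval x) (list_env l)).
  have FK x : `|F x| <= K + e / 8.
    rewrite /F normrN; have := near2 x; have := KP A (extend a' x).
    by rewrite !ler_norml => /andP[? ?] /andP[? ?]; apply/andP; split; lra.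
  have [x xP] := sup_range_adherent (cball0 A n) FK m0.
  exists (sval x); split=> [|y yn] /=; first exact: cball_rnorm.
  have := le_sup_range (cball0 A n) FK (mkball yn).
  move: xP; rewrite /F /=; set r := m.+1%:R^-1.
  move: (sup _) (fcode _ _) (fcode _ _) r => *; lra.
have hx := hull_op_in (pickle (n, c, m)) hl.
have : near_min (n, c, m) l (hull_op (pickle (n, c, m)) l).
  rewrite /hull_op pickleK; case: pselect => [h|//]; exact: projT2 (cid h).
move=> [/= xn xP]; exists (mkball xn) => // y.
have := xP _ (cball_rnorm y); have := near1 (mkball xn); have := near2 (mkball xn).
have := near1 y; have := near2 y; rewrite !ler_norml /=; move: mP m0.
set r := m.+1%:R^-1; move: r (fcode _ _) (fcode _ _) => r s t.
by move=> ? ? /andP[? ?] /andP[? ?] /andP[? ?] /andP[? ?] ?; lra.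
Qed.

Local Notation hull_closure := (norm_closure hull).

(** Trees have no nodes for the algebraic operations: [z] minimizes the distance to [t], and the
    Skolem witnesses for this formula approach it. Closure under each operation follows by choosing
    [t]. *)
Lemma hull_term V (N : naming V) n (t : term R u (ext V n) n) (a : assignment V A) (z : A) :
  (forall m v, hull (sval (a m v))) ->
  (forall x : cball A n, teval (extend a x) t = z) -> hull_closure z.
Proof.
move=> ha tz e e0; have e20 : 0 < e / 2 by rewrite divr_gt0.
have [x hx xP] := hull_skolem N (Dist (Sym R u (New V n)) t) ha e20.
have zn : rnorm z <= n%:R by rewrite -(tz x) rnorm_teval.
exists (sval x) => //; have := xP (mkball zn); rewrite /= !tz subrr rnorm0 add0r.
by rewrite rnormB => h; apply: le_lt_trans h _; lra.
Qed.

Definition assign1 n (x : cball A n) : assignment (ext nosyms n) A := extend (noassign A) x.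
Definition assign2 n m (x : cball A n) (y : cball A m) :
  assignment (ext (ext nosyms n) m) A := extend (assign1 x) y.

Lemma hull_assign1 n (x : cball A n) : hull (sval x) ->
  forall m v, hull (sval (@assign1 n x m v)).
Proof. by move=> hx m []. Qed.

Lemma hull_assign2 n m (x : cball A n) (y : cball A m) : hull (sval x) -> hull (sval y) ->
  forall k v, hull (sval (@assign2 n m x y k v)).
Proof. by move=> hx hy k [? []|]. Qed.

Let N1 n := naming_ext naming_none n.
Let N2 n m := naming_ext (N1 n) m.

Lemma hullZ l x : hull x -> hull_closure (l *: x).
Proof.
move=> hx; have [n xn] := rnorm_le_nat x; have [m lm] := scale_sort l n.
apply: (hull_term (N1 n) (a := assign1 (mkball xn))
  (t := Scale lm (Sym R u (Old m (New nosyms n))))) => //.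
exact: hull_assign1.
Qed.

Lemma hullS x : hull x -> hull_closure (cstar x).
Proof.
move=> hx; have [n xn] := rnorm_le_nat x.
apply: (hull_term (N1 n) (a := assign1 (mkball xn))
  (t := Star (Sym R u (Old n (New nosyms n))))) => //.
exact: hull_assign1.
Qed.

Lemma hull1 h : hull_closure (cone A h).
Proof.
by apply: (hull_term naming_none (a := noassign A) (t := One R (ext nosyms 1) h)) => // m [].
Qed.

Lemma hullD x y : hull x -> hull y -> hull_closure (x + y).
Proof.
move=> hx hy; have [n xn] := rnorm_le_nat x; have [m ym] := rnorm_le_nat y.
apply: (hull_term (N2 n m) (a := assign2 (mkball xn) (mkball ym))
  (t := Add (Sym R u (Old (n + m) (Old m (New nosyms n))))
            (Sym R u (Old (n + m) (New (ext nosyms n) m))))) => //.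
exact: hull_assign2.
Qed.

Lemma hullM x y : hull x -> hull y -> hull_closure (cmul x y).
Proof.
move=> hx hy; have [n xn] := rnorm_le_nat x; have [m ym] := rnorm_le_nat y.
apply: (hull_term (N2 n m) (a := assign2 (mkball xn) (mkball ym))
  (t := Mul (Sym R u (Old (n * m) (Old m (New nosyms n))))
            (Sym R u (Old (n * m) (New (ext nosyms n) m))))) => //.
exact: hull_assign2.
Qed.

Definition hull_csub : csub A := closure_csub hull0 hullD hullZ hullM hullS hull1.

(** A nearby point [y] of the hull may lie outside the ball. Minimizing the distance to [y] over the
    ball of radius [n], where [sval x] competes, yields a point of the hull inside it; each of the
    three errors is [e / 3]. *)
Lemma hull_ball_dense n (x : cball A n) e : hull_closure (sval x) -> 0 < e ->
  exists2 y : cball A n, hull (sval y) & rnorm (sval x - sval y) <= e.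
Proof.
move=> hx e0; have e30 : 0 < e / 3 by rewrite divr_gt0.
have [y hy xy] := hx _ e30; have [m ym] := rnorm_le_nat y.
have [z hz zP] := hull_skolem (N1 m)
  (Dist (Incl (leq_maxl n m) (Sym R u (New (ext nosyms m) n)))
        (Incl (leq_maxr n m) (Sym R u (Old n (New nosyms m)))))
  (hull_assign1 (x := mkball ym) hy) e30.
exists z => //; have /= := zP x => h.
by rewrite (le_trans (rnorm_triangle y _ _))// (rnormB y); lra.
Qed.

Lemma hull_skolem_closure V (N : naming V) n (psi : formula R u (ext V n))
    (a : assignment V A) e : (forall m v, hull_closure (sval (a m v))) -> 0 < e ->
  exists2 x : cball A n, hull (sval x) &
    forall y, feval (extend a x) psi <= feval (extend a y) psi + e.
Proof.
move=> ha e0; have e30 : 0 < e / 3 by rewrite divr_gt0.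
have [M [d d0 dP]] := feval_continuous psi (name (naming_ext N n)) e30.
have ha' m (v : V m) : exists y : cball A m, hull (sval y) /\ rnorm (sval (a m v) - sval y) <= d.
  by have [y ? ?] := hull_ball_dense (ha m v) d0; exists y.
pose a' m (v : V m) := projT1 (cid (ha' m v)).
have a'P m (v : V m) : hull (sval (a' m v)) /\ rnorm (sval (a m v) - sval (a' m v)) <= d.
  exact: projT2 (cid (ha' m v)).
have near1 (x : cball A n) : `|feval (extend a x) psi - feval (extend a' x) psi| <= e / 3.
  apply: dP => k [i v|] /= vM; last by rewrite subrr rnorm0 ltW.
  exact: (proj2 (a'P i v)).
have [x hx xP] := hull_skolem N psi (fun m v => proj1 (a'P m v)) e30.
exists x => // y; have := xP y; have := near1 x; have := near1 y.
by rewrite !ler_norml => /andP[? ?] /andP[? ?] ?; lra.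
Qed.

Let B := csub_alg hull_csub.
Let incl := csub_emb hull_csub.

Lemma hull_csub_ball n (x : cball A n) : hull (sval x) ->
  exists y : cball B n, push_ball incl y = x.
Proof.
move=> hx; have hE : csub_val (csub_mk hull_csub (sval x)) = sval x.
  by apply: csub_mkK; exact: norm_closure_sub.
have yn : rnorm (csub_mk hull_csub (sval x)) <= n%:R.
  by rewrite -(emb_norm incl) hE cball_rnorm.
by exists (mkball yn); apply: val_inj; rewrite /= hE.
Qed.

(** Tarski-Vaught: a quantifier over the subalgebra agrees with the one over [A] because
    near-optimal witnesses over parameters in the closure are found in the hull. Suprema are reduced
    to infima of the negated formula. *)
Theorem hull_elementary V (N : naming V) (phi : formula R u V) (b : assignment V B) :
  feval b phi = feval (push incl b) phi.
Proof.
elim: phi N b => {V} [V n t1 t2|V k f cf args IH|V n psi IH|V n psi IH] N b.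
- by rewrite feval_push_qfree.
- by congr f; apply/rowP => i; rewrite !mxE; exact: IH.
- rewrite /=; have [K KP] := feval_bound psi.
  rewrite -(sup_range_sub (cball0 B n) (f := @push_ball _ _ _ _ _ incl n)
    (H := fun x => feval (extend (push incl b) x) psi) (K := K)) => [|//|y e e0].
    congr sup; apply: eq_imagel => x _.
    by rewrite (IH (naming_ext N n)) push_extend.
  have [|x hx xP] := hull_skolem_closure N (fneg psi) (a := push incl b) _ e0.
    by move=> m v; exact: (@csub_valS _ _ _ hull_csub).
  have [x' x'E] := hull_csub_ball hx; exists x'; rewrite x'E.
  by have := xP y; rewrite !feval_neg; lra.
- rewrite /=; have [K KP] := feval_bound psi.
  rewrite -(inf_range_sub (cball0 B n) (f := @push_ball _ _ _ _ _ incl n)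
    (H := fun x => feval (extend (push incl b) x) psi) (K := K)) => [|//|y e e0].
    congr inf; apply: eq_imagel => x _.
    by rewrite (IH (naming_ext N n)) push_extend.
  have [|x hx xP] := hull_skolem_closure N psi (a := push incl b) _ e0.
    by move=> m v; exact: (@csub_valS _ _ _ hull_csub).
  by have [x' x'E] := hull_csub_ball hx; exists x'; rewrite x'E.
Qed.

End skolem_hull.

(** The first [M] constants of every sort keep their values, so that the new functional is close to
    the old one; the remaining constants are free to enumerate the countable hull. *)
Theorem downward_LS (R : realType) u (A : cstarAlg R u) (a : assignment consts A) M :
  exists (B : cstarAlg R u) (f : B -> A) (hf : cstar_emb f) (b : assignment consts B),
    [/\ forall V (N : naming V) (phi : formula R u V) (c : assignment V B),
          feval c phi = feval (push hf c) phi,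
        sortwise_dense b &
        forall n (j : nat), (j < M)%N -> f (sval (b n j)) = sval (a n j)].
Proof.
pose B := csub_alg (hull_csub a); pose hf := csub_emb (hull_csub a).
have ha n (x : cball A n) : hull a (sval x) -> exists y : cball B n, push_ball hf y = x.
  exact: hull_csub_ball.
have ex n (j : nat) : exists y : cball B n, push_ball hf y = a n j.
  exact/ha/hull_const.
(* Constant [M + pickle t] of sort [n] is assigned the value of the tree [t], when this value lies
   in the ball of radius [n]. *)
pose good n i (y : cball B n) := if unpickle i is Some t
  then csub_val (sval y) = hull_eval a t else True.
pose b n (j : nat) : cball B n :=
  if (j < M)%N then projT1 (cid (ex n j)) else
  if pselect (exists y, good n (j - M)%N y) is left h then projT1 (cid h) else cball0 B n.
exists B, (@csub_val _ _ _ _), hf, b; split.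
- by move=> V N phi c; exact: hull_elementary.
- apply/sortwise_denseP => n x e e0.
  have hx : norm_closure (hull a) (sval (push_ball hf x)) by exact: (@csub_valS _ _ _ (hull_csub a)).
  have e20 : 0 < e / 2 by rewrite divr_gt0.
  have [y [t _ ty] xy] := hull_ball_dense hx e20.
  have [z zy] : exists z : cball B n, push_ball hf z = y by apply: ha; exists t.
  have zt : csub_val (sval z) = hull_eval a t by rewrite ty -zy.
  exists (M + pickle t)%N; rewrite /b ltnNge leq_addr/= addKn.
  case: pselect => [h|[]]; last by exists z; rewrite /good pickleK.
  case: cid => w /=; rewrite /good pickleK => wt.
  rewrite -(emb_norm hf) (embB hf) wt ty.
  by apply: le_lt_trans xy _; lra.
- move=> n j jM; rewrite /b jM; case: cid => y /= <-.
  by [].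
Qed.

(** * Substitution, and formulas evaluated at tuples of constants *)

Section substitution.
Context {R : realType} {u : bool}.
Implicit Types (V W : symbols) (A : cstarAlg R u).

Definition compatible V W (sigma : forall n, V n -> term R u W n)
    A (b : assignment W A) (a : assignment V A) :=
  forall n v, sval (a n v) = teval b (sigma n v).

(** Substitution is specified by values: all later uses compare evaluations, so no identities
    between dependently sorted pieces of syntax have to be proved. *)
Lemma subst_term V W (sigma : forall n, V n -> term R u W n) n (t : term R u V n) :
  exists t' : term R u W n, forall A (b : assignment W A) (a : assignment V A),
    compatible sigma b a -> teval b t' = teval a t.
Proof.
elim: t => {n} [n v||h|m n s [s' hs] t [t' ht]|m n s [s' hs] t [t' ht]|n t [t' ht]
  |l m n lmn t [t' ht]|m n mn t [t' ht]].
- by exists (sigma n v) => A b a c /=; rewrite c.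
- by exists (Zero R u W).
- by exists (One R W h).
- by exists (Add s' t') => A b a c /=; rewrite (hs _ _ _ c) (ht _ _ _ c).
- by exists (Mul s' t') => A b a c /=; rewrite (hs _ _ _ c) (ht _ _ _ c).
- by exists (Star t') => A b a c /=; rewrite (ht _ _ _ c).
- by exists (Scale lmn t') => A b a c /=; rewrite (ht _ _ _ c).
- by exists (Incl mn t') => A b a c /=; rewrite (ht _ _ _ c).
Qed.

Lemma compatible_ext V W (sigma : forall n, V n -> term R u W n) n :
  exists sigma' : forall m, ext V n m -> term R u (ext W n) m,
    forall A (b : assignment W A) (a : assignment V A) x,
      compatible sigma b a -> compatible sigma' (extend b x) (extend a x).
Proof.
have old m (t : term R u W m) : exists t' : term R u (ext W n) m,
    forall A (b : assignment W A) x, teval (extend b x) t' = teval b t.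
  have [t' ht] := subst_term (fun m w => Sym R u (Old n w)) t.
  by exists t' => A b x; exact: ht.
exists (fun m (v : ext V n m) => match v in ext _ _ m' return term R u (ext W n) m' with
  | Old m' w => projT1 (cid (old m' (sigma m' w))) | New => Sym R u (New W n) end).
move=> A b a x c m [m' w|] //=.
by case: cid => t' /= ->.
Qed.

Lemma subst_formula V W (sigma : forall n, V n -> term R u W n) (phi : formula R u V) :
  exists2 psi : formula R u W, qfree phi -> qfree psi &
    forall A (b : assignment W A) (a : assignment V A),
      compatible sigma b a -> feval b psi = feval a phi.
Proof.
elim: phi W sigma => {V} [V n t1 t2|V k f cf args IH|V n phi IH|V n phi IH] W sigma.
- have [t1' h1] := subst_term sigma t1; have [t2' h2] := subst_term sigma t2.
  by exists (Dist t1' t2') => // A b a c /=; rewrite (h1 _ _ _ c) (h2 _ _ _ c).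
- have /choice[args' args'P] i : exists psi : formula R u W,
      (qfree (args i) -> qfree psi) /\ forall A (b : assignment W A) (a : assignment V A),
      compatible sigma b a -> feval b psi = feval a (args i).
    by have [psi h1 h2] := IH i W sigma; exists psi.
  exists (Conn cf args') => [/= q i|A b a c /=].
    by apply: (proj1 (args'P i)); exact: q.
  by congr f; apply/rowP => i; rewrite !mxE; exact: (proj2 (args'P i)).
- have [sigma' s'P] := compatible_ext sigma n; have [psi _ psiP] := IH _ sigma'.
  exists (Sup psi) => // A b a c /=; congr sup; apply: eq_imagel => x _.
  exact/psiP/s'P.
- have [sigma' s'P] := compatible_ext sigma n; have [psi _ psiP] := IH _ sigma'.
  exists (Inf psi) => // A b a c /=; congr inf; apply: eq_imagel => x _.
  exact/psiP/s'P.
Qed.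

Definition pull V (rho : forall n, V n -> nat) A (a : assignment consts A) :
  assignment V A := fun n v => a n (rho n v).

Lemma subst_qfree V (rho : forall n, V n -> nat) (phi : formula R u V) : qfree phi ->
  exists chi : Sigma R u, forall A (a : assignment consts A),
    feval a (sval chi) = feval (pull rho a) phi.
Proof.
move=> q; have [psi h1 h2] := subst_formula (fun n v => Sym R u (rho n v : consts n)) phi.
by exists (exist _ psi (h1 q)) => A a; exact: h2.
Qed.

End substitution.

Section dense_assignment.
Context {R : realType} {u : bool}.
Implicit Types (V : symbols) (xs ys : seq nat) (l : seq nat).

Definition ren_ext V (rho : forall n, V n -> nat) n (j : nat) m (v : ext V n m) : nat :=
  match v with Old m' w => rho m' w | New => j end.

#[global] Arguments ren_ext {V} rho n j [m] v.

(** The list [l] names the constants put for a block of bound variables. Missing entries default to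
    0, so lists of any length serve and range over a countable type. *)
Fixpoint ren_exts V (rho : forall n, V n -> nat) xs l : forall n, exts V xs n -> nat :=
  if xs is n :: xs' return forall m, exts V xs m -> nat
  then @ren_exts _ (ren_ext rho n (head 0%N l)) xs' (behead l) else rho.
#[global] Arguments ren_exts {V} rho xs l [n] v.

Definition ren_none : forall n, nosyms n -> nat := fun _ v => match v with end.

Fixpoint exts_old V xs n : V n -> exts V xs n :=
  if xs is m :: xs' return V n -> exts V xs n
  then fun v => @exts_old (ext V m) xs' n (Old m v) else id.
#[global] Arguments exts_old {V} xs [n] v.

Variables (A : cstarAlg R u) (a : assignment consts A) (da : sortwise_dense a).

Lemma pull_extend V (rho : forall n, V n -> nat) n (j : nat) :
  extend (pull rho a) (@a n j) = pull (ren_ext rho n j) a.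
Proof. by apply: functional_extensionality_dep => m; apply/funext => -[]. Qed.

Lemma pull_none : pull ren_none a = noassign A.
Proof. by apply: functional_extensionality_dep => m; apply/funext => -[]. Qed.

Lemma feval_dense V n (phi : formula R u (ext V n)) (rho : forall n, V n -> nat) x e :
  0 < e -> exists j : nat,
   `|feval (extend (pull rho a) x) phi - feval (pull (ren_ext rho n j) a) phi| <= e.
Proof.
move=> e0; have [N [d d0 dP]] := feval_continuous phi (fun _ _ => 0%N) e0.
have [j xj] := (sortwise_denseP a).1 da n x d d0.
exists j; rewrite -pull_extend; apply: dP => m [k w|] _ /=; last exact: ltW.
by rewrite subrr rnorm0 ltW.
Qed.

(** Strictness is essential: a value below [r] survives a small change of the witness, hence passes
    to a constant, whereas an infimum need not be attained. *)
Lemma inf_ltP V n (phi : formula R u (ext V n)) (rho : forall n, V n -> nat) r :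
  feval (pull rho a) (Inf phi) < r <->
  exists j : nat, feval (pull (ren_ext rho n j) a) phi < r.
Proof.
have [K KP] := feval_bound phi; rewrite /= inf_range.
set F := fun x => - _; have FK x : `|F x| <= K by rewrite normrN.
split=> [h|[j h]]; last first.
  have := le_sup_range (cball0 A n) FK (@a n j).
  rewrite [F (@a n j)]/F pull_extend; move: (sup _) h => s *; lra.
(* The gap between [r] and the infimum is [r + sup (range F)]: half of it pays for a near-minimizer,
   a quarter for replacing it by a constant. *)
have e0 : 0 < (r + sup (range F)) / 2 by rewrite divr_gt0// -ltrBlDr sub0r.
have [x xP] := sup_range_adherent (cball0 A n) FK e0.
have e20 : 0 < (r + sup (range F)) / 4 by rewrite divr_gt0// -ltrBlDr sub0r.
have [j hj] := feval_dense phi rho x e20; exists j; move: hj; rewrite ler_norml => /andP[h1 h2].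
move: xP; rewrite [F x]/F => xP; move: (sup (range F)) h e0 e20 h1 h2 xP => s *; lra.
Qed.

Lemma sup_gtP V n (phi : formula R u (ext V n)) (rho : forall n, V n -> nat) r :
  r < feval (pull rho a) (Sup phi) <->
  exists j : nat, r < feval (pull (ren_ext rho n j) a) phi.
Proof.
have e : feval (pull rho a) (Inf (fneg phi)) = - feval (pull rho a) (Sup phi).
  rewrite -[LHS]/(inf (range (fun x => feval (extend (pull rho a) x) (fneg phi)))).
  rewrite inf_range; congr (- sup _); apply: eq_imagel => x _.
  by rewrite feval_neg opprK.
have := inf_ltP (fneg phi) rho (- r); rewrite e.
rewrite ltrN2 => ->; split=> -[j h]; exists j; move: h.
  by rewrite feval_neg ltrN2.
by rewrite feval_neg ltrN2.
Qed.

Lemma infs_ltP V xs (phi : formula R u (exts V xs)) (rho : forall n, V n -> nat) r :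
  feval (pull rho a) (infs phi) < r <->
  exists l, feval (pull (ren_exts rho xs l) a) phi < r.
Proof.
elim: xs V phi rho => [|n xs IH] V phi rho /=.
  by split=> [h|[_ h]] //; exists [::].
rewrite -[X in X < r]/(feval (pull rho a) (Inf (@infs R u (ext V n) xs phi))) inf_ltP.
split=> [[j /IH[l h]]|[l h]]; first by exists (j :: l).
by exists (head 0%N l); apply/IH; exists (behead l).
Qed.

Lemma sups_gtP V xs (phi : formula R u (exts V xs)) (rho : forall n, V n -> nat) r :
  r < feval (pull rho a) (sups phi) <->
  exists l, r < feval (pull (ren_exts rho xs l) a) phi.
Proof.
elim: xs V phi rho => [|n xs IH] V phi rho /=.
  by split=> [h|[_ h]] //; exists [::].
rewrite -[X in r < X]/(feval (pull rho a) (Sup (@sups R u (ext V n) xs phi))) sup_gtP.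
split=> [[j /IH[l h]]|[l h]]; first by exists (j :: l).
by exists (head 0%N l); apply/IH; exists (behead l).
Qed.

Lemma assignment_dense V xs (rho : forall n, V n -> nat) (b : assignment (exts V xs) A) d :
  0 < d ->
  (forall n (v : V n), rnorm (sval (b n (exts_old xs v)) - sval (pull rho a v)) <= d) ->
  exists l, forall n (v : exts V xs n),
    rnorm (sval (b n v) - sval (pull (ren_exts rho xs l) a v)) <= d.
Proof.
move=> d0; elim: xs V rho b => [|n xs IH] V rho b h; first by exists [::].
have [j xj] := (sortwise_denseP a).1 da n (b n (exts_old xs (New V n))) d d0.
have [|l hl] := IH (ext V n) (ren_ext rho n j) b; last by exists (j :: l).
by move=> m [k w|]; [exact: h|exact: ltW].
Qed.

Lemma assignment_dense_none xs (b : assignment (exts nosyms xs) A) d : 0 < d ->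
  exists l, forall n (v : exts nosyms xs n),
    rnorm (sval (b n v) - sval (pull (ren_exts ren_none xs l) a v)) <= d.
Proof. by move=> d0; apply: assignment_dense => // n []. Qed.

End dense_assignment.

(** * Functionals of densely interpreted constants *)

Section generic.
Context {R : realType} {u : bool} (T : theory R u).
Local Notation X := (set_type (TT T) : topologicalType).
Implicit Types (s : X) (A B : cstarAlg R u).

Lemma models_elementary A B (f : B -> A) (hf : cstar_emb f) (T' : theory R u) :
  (forall V (N : naming V) (phi : formula R u V) (c : assignment V B),
    feval c phi = feval (push hf c) phi) ->
  models B T' <-> models A T'.
Proof.
move=> el; have e : push hf (noassign B) = noassign A.
  by apply: functional_extensionality_dep => n; apply/funext => -[].
by split=> h phi Tphi; have := h phi Tphi; rewrite /sentval (el _ naming_none) e.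
Qed.

Lemma open_exists (I : Type) (P : I -> set X) :
  (forall i, open (P i)) -> open [set s | exists i, P i s].
Proof.
move=> oP; rewrite (_ : [set _ | _] = \bigcup_i P i); first exact: bigcup_open.
by apply/seteqP; split=> s [j]; exists j.
Qed.

Lemma separable_model A (a : assignment consts A) (mA : models A T) (W : set X) :
  open W -> W (mkTT a mA) ->
  exists (B : cstarAlg R u) (f : B -> A) (hf : cstar_emb f) (b : assignment consts B)
    (mB : models B T),
    [/\ forall V (N : naming V) (phi : formula R u V) (c : assignment V B),
          feval c phi = feval (push hf c) phi,
        sortwise_dense b & W (mkTT b mB)].
Proof.
move=> oW Wa.
pose approx (M : nat) (x : X) := exists (B : cstarAlg R u) (f : B -> A)
    (hf : cstar_emb f) (b : assignment consts B) (mB : models B T),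
    [/\ forall V (N : naming V) (phi : formula R u V) (c : assignment V B),
          feval c phi = feval (push hf c) phi,
        sortwise_dense b,
        (forall n (j : nat), (j < M)%N -> f (sval (b n j)) = sval (a n j)) &
        x = mkTT b mB].
have exs M : exists x, approx M x.
  have [B [f [hf [b [el db bM]]]]] := downward_LS a M.
  have mB : models B T by apply: (models_elementary T el).2 mA.
  by exists (mkTT b mB), B, f, hf, b, mB.
have [x xP] := choice exs.
have cx : x @ \oo --> mkTT a mA.
  apply: ptws_cvg => phi; apply/cvgrPdist_le => e e0.
  (* Ranking by the index alone suffices here, since the constants are kept in all sorts
     simultaneously. *)
  have [M [d d0 dP]] := feval_continuous (sval phi) (fun n (j : consts n) => j : nat) e0.
  exists M => // k /= Mk; have [B [f [hf [b [mB [el db bk ->]]]]]] := xP k.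
  rewrite (evE (a := a))// (evE (a := b))// (el _ naming_consts); apply: dP => n j jM.
  by rewrite /= bk ?(leq_trans jM)// subrr rnorm0 ltW.
have [M _ WM] : \forall M \near \oo, W (x M) by apply: cx; apply: open_nbhs_nbhs.
have [B [f [hf [b [mB [el db bk xE]]]]]] := xP M.
by exists B, f, hf, b, mB; split=> //; rewrite -xE; apply: WM => /=.
Qed.

Definition generic_set : set X :=
  [set s | exists (A : cstarAlg R u) (a : assignment consts A), generated_by T (set_val s) a].

Lemma generic_dense : dense generic_set.
Proof.
move=> W [s Ws] oW; have [A [a [mA sa]]] := TT_ex s.
have sE : s = mkTT a mA by apply: val_inj.
rewrite sE in Ws; have [B [f [hf [b [mB [_ db Wb]]]]]] := separable_model oW Ws.
by exists (mkTT b mB); split=> //; exists B, b.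
Qed.

Variables (T0 : theory R u) (hT0 : forall phi, T0 phi -> AE_sentence phi)
  (T0E : forall A, models A T <-> models A T0).

Definition matrices (xs ys : seq nat) : set (formula R u (exts (exts nosyms xs) ys)) :=
  [set psi | [/\ qfree psi, nonneg psi & T0 (sups (infs psi))]].

Definition term_sep : nat -> {n & term R u consts n} :=
  projT1 (cid (terms_separable naming_consts)).

Lemma term_sepP n (t : term R u consts n) e : 0 < e ->
  exists k, forall A (a : assignment consts A),
    rnorm (teval a t - teval a (projT2 (term_sep k))) <= e.
Proof. exact: (projT2 (cid (terms_separable naming_consts))). Qed.

Lemma matrix_sep_ex xs ys : exists g : nat -> option (formula R u (exts (exts nosyms xs) ys)),
  (forall k phi, g k = Some phi -> matrices phi) /\
  forall phi e, matrices phi -> 0 < e -> exists k psi, g k = Some psi /\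
      forall A (a : assignment _ A), `|feval a phi - feval a psi| <= e.
Proof.
have [g h1 h2] := formulas_separable (naming_exts (naming_exts naming_none xs) ys) (@matrices xs ys).
by exists g.
Qed.

Definition matrix_sep xs ys := projT1 (cid (matrix_sep_ex xs ys)).

Lemma matrix_sep_in xs ys k phi : matrix_sep xs ys k = Some phi -> matrices phi.
Proof. exact: (proj1 (projT2 (cid (matrix_sep_ex xs ys)))). Qed.

Lemma matrix_sepP xs ys phi e : matrices phi -> 0 < e ->
  exists k psi, matrix_sep xs ys k = Some psi /\
      forall A (a : assignment _ A), `|feval a phi - feval a psi| <= e.
Proof. exact: (proj2 (projT2 (cid (matrix_sep_ex xs ys)))). Qed.

Definition term_dist m (t : term R u consts m) n (t' : term R u consts n) : Sigma R u :=
  exist _ (Dist (Incl (leq_maxl m n) t) (Incl (leq_maxr m n) t')) I.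

Definition term_norm m (t : term R u consts m) : Sigma R u := term_dist t (Zero R u consts).

(* Some [c_j] of sort [n] is as close to the term as the ball of radius [n] allows.
   As the truncation is on the right, the condition is open. *)
Definition term_cond (k n m : nat) : set X := [set s | exists j (r : R),
  ev (term_dist (projT2 (term_sep k)) (Sym R u (j : consts n))) s < r + m.+1%:R^-1 /\
  (r = 0 \/ r < ev (term_norm (projT2 (term_sep k))) s - n%:R)].

(** The constants [l] of the outer block are fixed and [l'] are witnesses for the inner infimum. The
    substituted sentence [chi] is described by its values, because substitution is only known to
    exist. *)
Definition matrix_cond (xs ys : seq nat) (k : nat) (l : seq nat) (m : nat) : set X :=
  if matrix_sep xs ys k is Some psi then
    [set s | exists l' (chi : Sigma R u), (forall A (a : assignment consts A),
      feval a (sval chi) =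
      feval (pull (ren_exts (ren_exts ren_none xs l) ys l') a) psi) /\
      ev chi s < m.+1%:R^-1]
  else setT.

Lemma open_term_cond k n m : open (term_cond k n m).
Proof.
apply: open_exists => j; apply: open_exists => r.
set D := term_dist _ _.
rewrite (_ : (fun=> _) = [set s | ev D s < r + m.+1%:R^-1] `&`
  [set s | r = 0 \/ r < ev (term_norm (projT2 (term_sep k))) s - n%:R]) //.
apply: openI; first exact: open_ev_lt.
have [->|r0] := eqVneq r 0.
  rewrite (_ : [set _ | _] = setT); first exact: openT.
  by apply/seteqP; split=> // s _; left.
rewrite (_ : [set _ | _] = [set s | r + n%:R < ev (term_norm (projT2 (term_sep k))) s]).
  exact: open_ev_gt.
apply/seteqP; split=> s /=; last by move=> h; right; rewrite ltrBrDr.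
by move=> [/eqP|]; [rewrite (negPf r0)|rewrite ltrBrDr].
Qed.

Lemma open_matrix_cond xs ys k l m : open (matrix_cond xs ys k l m).
Proof.
rewrite /matrix_cond; case: matrix_sep => [psi|]; last exact: openT.
apply: open_exists => l'; apply: open_exists => chi.
set P := forall A, _; have [h|h] := pselect P.
  rewrite (_ : (fun=> _) = [set s | ev chi s < m.+1%:R^-1]); first exact: open_ev_lt.
  by apply/seteqP; split=> s /= => [[]|].
rewrite (_ : (fun=> _) = set0); first exact: open0.
by apply/seteqP; split=> s //= [].
Qed.

Lemma ev_term_dist s A (a : assignment consts A) m (t : term R u consts m)
    n (t' : term R u consts n) : set_val s = functional a ->
  ev (term_dist t t') s = rnorm (teval a t - teval a t').
Proof. by move=> sa; rewrite (evE _ sa). Qed.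

Lemma ev_term_norm s A (a : assignment consts A) m (t : term R u consts m) :
  set_val s = functional a -> ev (term_norm t) s = rnorm (teval a t).
Proof. by move=> sa; rewrite (ev_term_dist _ _ sa) subr0. Qed.

Lemma generic_conds s : generic_set s ->
  (forall k n m, term_cond k n m s) /\ (forall xs ys k l m, matrix_cond xs ys k l m s).
Proof.
move=> [A [a [mA da sa]]]; split=> [k n m|xs ys k l m].
  set t := projT2 (term_sep k); have m0 : 0 < m.+1%:R^-1 :> R by rewrite invr_gt0.
  set e := m.+1%:R^-1 in m0 *.
  have [tn|tn] := leP (rnorm (teval a t)) n%:R.
    have [j hj] := (sortwise_denseP a).1 da n (mkball tn) e m0.
    by exists j, 0; split; [rewrite (ev_term_dist _ _ sa) add0r|left].
  have e20 : 0 < e / 2 by rewrite divr_gt0.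
  have t0 : 0 < rnorm (teval a t) by apply: le_lt_trans tn.
  (* The nearest point of the ball is the radial projection, at distance [rnorm (teval a t) - n%:R].
     The tolerance is split between approximating it by a constant and taking [r] strictly below
     that distance. *)
  pose c := n%:R / rnorm (teval a t).
  have c0 : 0 <= c by rewrite divr_ge0// ltW.
  have c1 : c <= 1 by rewrite ler_pdivrMr// mul1r ltW.
  have yn : rnorm (c%:C%C *: teval a t) <= n%:R.
    by rewrite rnormZ cabs_real ger0_norm// /c divfK// gt_eqF.
  have [j hj] := (sortwise_denseP a).1 da n (mkball yn) _ e20.
  exists j, (rnorm (teval a t) - n%:R - e / 2); split; last first.
    by right; rewrite (ev_term_norm _ sa); lra.
  rewrite (ev_term_dist _ _ sa).
  apply: le_lt_trans (rnorm_triangle (c%:C%C *: teval a t) _ _) _.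
  have -> : teval a t - c%:C%C *: teval a t = (1 - c)%:C%C *: teval a t.
    by rewrite -[X in X - _]scale1r -scalerBl rmorphB.
  rewrite rnormZ cabs_real ger0_norm ?subr_ge0// mulrBl mul1r.
  rewrite {1}/c divfK ?gt_eqF//; move: hj => /= hj.
  by rewrite -/e; move: e (rnorm (_ - _)) hj {m0 e20} => e r *; lra.
rewrite /matrix_cond; case E : matrix_sep => [psi|//].
have [q nn Tpsi] := matrix_sep_in E.
have /(T0E A) mA0 := mA; have := mA0 _ Tpsi; rewrite /sentval -(pull_none a) => h.
have m0 : 0 < m.+1%:R^-1 :> R by rewrite invr_gt0.
have : ~ m.+1%:R^-1 / 2 < feval (pull ren_none a) (sups (infs psi)).
  by rewrite h => /lt_geF; rewrite divr_ge0// ltW.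
rewrite (sups_gtP da) => /forallNP/(_ l)/negP; rewrite -leNgt => h1.
have : feval (pull (ren_exts ren_none xs l) a) (infs psi) < m.+1%:R^-1.
  by apply: le_lt_trans h1 _; rewrite ltr_pdivrMr// ltr_pMr// ltr1n.
move=> /(infs_ltP da)[l' hl'].
have [chi chiP] := subst_qfree (ren_exts (ren_exts ren_none xs l) ys l') q.
by exists l', chi; split=> //; rewrite (evE _ sa) chiP.
Qed.

(** In any model realizing [s], the term conditions make the closure of the constants a subalgebra
    with dense constants in each ball, and the matrix conditions make it satisfy the axioms.
    Quantifier-free values do not change on passing to it. *)
Lemma conds_generic s :
  (forall k n m, term_cond k n m s) -> (forall xs ys k l m, matrix_cond xs ys k l m s) ->
  generic_set s.
Proof.
move=> ht hm; have [A [a [mA sa]]] := TT_ex s.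
(* The factor 4 counts replacing [t] by a listed term, the tolerance of the condition, and at most
   [2 * e] by which that term can exceed radius [p]. *)
have key n (t : term R u consts n) p e : 0 < e -> rnorm (teval a t) < p%:R + e ->
    exists j : nat, rnorm (teval a t - sval (a p j)) < 4 * e.
  move=> e0 tp; have [k kP] := term_sepP t e0; have {}kP := kP A a.
  have [m me] := inv_succ_le e0.
  have [j [r []]] := ht k p m; rewrite (ev_term_dist _ _ sa) (ev_term_norm _ sa).
  set t' := projT2 _ in kP *; move=> h1 h2; exists j.
  apply: le_lt_trans (rnorm_triangle (teval a t') _ _) _.
  have := rnorm_dist (teval a t) (teval a t'); rewrite ler_norml => /andP[h3 _].
  move: h1 me; rewrite /=; set q := m.+1%:R^-1; move: q => q h1 me.
  by case: h2 => [h2|h2]; rewrite ?h2 in h1 *; lra.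
pose H : set A := [set x | exists n (j : nat), x = sval (a n j)].
have term_H n (t : term R u consts n) : norm_closure H (teval a t).
  move=> e e0; have e40 : 0 < e / 4 by rewrite divr_gt0.
  have [|j hj] := key n t n _ e40; first by rewrite (le_lt_trans (rnorm_teval _ _))// ltrDl.
  by exists (sval (a n j)); [exists n, j|rewrite mulrC divfK in hj].
have HH n (j : nat) : H (sval (a n j)) by exists n, j.
have H0 : H 0.
  (* The ball of radius 0 has a single element, so every constant of sort 0 is 0. *)
  exists 0%N, 0%N; apply/esym/rnorm0_eq0/eqP; rewrite eq_le rnorm_ge0 andbT.
  exact: (cball_rnorm (a 0%N 0%N)).
have HD x y : H x -> H y -> norm_closure H (x + y).
  move=> [n [j ->]] [m [i ->]].
  exact: (term_H _ (Add (Sym R u (j : consts n)) (Sym R u (i : consts m)))).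
have HM x y : H x -> H y -> norm_closure H (cmul x y).
  move=> [n [j ->]] [m [i ->]].
  exact: (term_H _ (Mul (Sym R u (j : consts n)) (Sym R u (i : consts m)))).
have HZ l x : H x -> norm_closure H (l *: x).
  move=> [n [j ->]]; have [m lm] := scale_sort l n.
  exact: (term_H _ (Scale lm (Sym R u (j : consts n)))).
have HS x : H x -> norm_closure H (cstar x).
  by move=> [n [j ->]]; exact: (term_H _ (Star (Sym R u (j : consts n)))).
have H1 h : norm_closure H (cone A h) by exact: (term_H _ (One R consts h)).
pose C := closure_csub H0 HD HZ HM HS H1; pose B := csub_alg C; pose hf := csub_emb C.
have inB n (j : nat) : csub_val (csub_mk C (sval (a n j))) = sval (a n j).
  by apply: csub_mkK; apply: norm_closure_sub.
have bn n (j : nat) : rnorm (csub_mk C (sval (a n j))) <= n%:R.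
  by rewrite -(emb_norm hf) inB cball_rnorm.
pose b : assignment consts B := fun n j => mkball (bn n j).
have ab : push hf b = a.
  by apply: functional_extensionality_dep => n; apply/funext => j; apply: val_inj; exact: inB.
have sb : set_val s = functional b.
  by rewrite sa -ab; apply/funext => phi; exact: feval_push_qfree (svalP phi).
have db : sortwise_dense b.
  apply/sortwise_denseP => n x e e0.
  have e80 : 0 < e / 8 by rewrite divr_gt0.
  have : norm_closure H (csub_val (sval x)) by exact: (@csub_valS _ _ _ C).
  move=> /(_ _ e80)[_ [m [i ->]] xc].
  have cn : rnorm (csub_val (sval x)) <= n%:R by rewrite (emb_norm hf) cball_rnorm.
  have [|j hj] := key m (Sym R u (i : consts m)) n _ e80.
    have := rnorm_dist (csub_val (sval x)) (sval (a m i)); rewrite ler_norml.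
    by move=> /andP[h3 _] /=; lra.
  exists j; rewrite -(emb_norm hf) (embB hf) /= inB.
  by apply: le_lt_trans (rnorm_triangle (sval (a m i)) _ _) _; rewrite /= in hj; lra.
exists B, b; split=> //; apply/T0E => phi T0phi.
have [xs [ys [psi [q nn E]]]] := hT0 T0phi; rewrite {}E in T0phi *.
have mpsi : matrices psi by split.
rewrite /sentval -(pull_none b); apply/eqP; rewrite eq_le !leNgt.
apply/andP; split; apply/negP => h.
  (* If the axiom were positive, the inner infimum would have a value [r > 0] at some constants.
     Listed matrix and tolerance cost [r / 4] each, and the matrix condition gives a value too small
     for [r]. *)
  have [l hl] := (sups_gtP db _ _ _).1 h.
  set r := feval _ (infs psi) in hl.
  have r40 : 0 < r / 4 by rewrite divr_gt0.
  have [k [psi' [kE kP]]] := matrix_sepP mpsi r40.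
  have [m mr] := inv_succ_le r40.
  have := hm xs ys k l m; rewrite /matrix_cond kE => -[l' [chi [chiP]]].
  rewrite (evE _ sb) chiP => h1.
  have := kP B (pull (ren_exts (ren_exts ren_none xs l) ys l') b).
  rewrite ler_norml => /andP[_ h2].
  have : r < r / 2 + r / 4.
    apply/(infs_ltP db); exists l'.
    by move: mr h1 h2; set q0 := m.+1%:R^-1; move: q0 => q0 *; lra.
  by lra.
(* Irreflexivity, read through [sups_gtP], bounds the inner formula at every tuple of constants by
   the supremum; a negative value would then contradict nonnegativity of the matrix. *)
have : ~ (feval (pull ren_none b) (sups (infs psi)) < feval (pull ren_none b) (sups (infs psi))).
  by rewrite ltxx.
move=> /(sups_gtP db)/forallNP/(_ [::])/negP; rewrite -leNgt => h1.
have /(infs_ltP db)[l' hl'] := le_lt_trans h1 h.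
by have := nn B (pull (ren_exts (ren_exts ren_none xs [::]) ys l') b); rewrite leNgt hl'.
Qed.

Definition generic_opens (i : nat * nat * nat + seq nat * seq nat * nat * seq nat * nat) : set X :=
  match i with
  | inl (k, n, m) => term_cond k n m
  | inr (xs, ys, k, l, m) => matrix_cond xs ys k l m
  end.

Lemma generic_setE : generic_set = \bigcap_i generic_opens i.
Proof.
apply/seteqP; split=> s.
  by move=> /generic_conds[h1 h2] [[[k n] m]|[[[[xs ys] k] l] m]] _; [exact: h1|exact: h2].
move=> h; apply: conds_generic => [k n m|xs ys k l m].
  exact: (h (inl (k, n, m))).
exact: (h (inr (xs, ys, k, l, m))).
Qed.

Lemma open_generic_opens i : open (generic_opens i).
Proof.
case: i => [[[k n] m]|[[[[xs ys] k] l] m]]; [exact: open_term_cond|exact: open_matrix_cond].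
Qed.

End generic.

(** * Uniqueness of the generated model *)

Definition term_rel (R : realType) u (A B : cstarAlg R u)
    (a : assignment consts A) (b : assignment consts B) (x : A) (y : B) :=
  forall e, 0 < e -> exists n (t : term R u consts n),
    rnorm (x - teval a t) < e /\ rnorm (y - teval b t) < e.

Definition same_norms (R : realType) u (A B : cstarAlg R u)
    (a : assignment consts A) (b : assignment consts B) :=
  forall m (t : term R u consts m) n (t' : term R u consts n),
    rnorm (teval a t - teval a t') = rnorm (teval b t - teval b t').

Lemma term_relC (R : realType) u (A B : cstarAlg R u)
    (a : assignment consts A) (b : assignment consts B) x y :
  term_rel a b x y -> term_rel b a y x.
Proof. by move=> h e /h[n [t [h1 h2]]]; exists n, t. Qed.

Section term_rel.
Context {R : realType} {u : bool} (A B : cstarAlg R u).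
Variables (a : assignment consts A) (b : assignment consts B).
Hypothesis ab : same_norms a b.
Local Notation rel := (term_rel a b).

Lemma rel_const n (j : nat) : rel (sval (@a n j)) (sval (@b n j)).
Proof.
by move=> e e0; exists n, (Sym R u (j : consts n)); rewrite /= !subrr !rnorm0.
Qed.

Lemma rel_isometry x y x' y' : rel x y -> rel x' y' -> rnorm (x - x') = rnorm (y - y').
Proof.
move=> h h'; apply/eqP; rewrite -subr_eq0 -normr_le0; apply/ler_addgt0Pr => e e0.
have e40 : 0 < e / 4 by rewrite divr_gt0.
have [n [t [h1 h2]]] := h _ e40; have [m [t' [h3 h4]]] := h' _ e40.
have := ab t t'; set c := teval a t in h1 *; set c' := teval a t' in h3 *.
set d := teval b t in h2 *; set d' := teval b t' in h4 * => cd.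
have e1 : x - x' - (c - c') = (x - c) - (x' - c') by rewrite !opprD !opprK addrACA.
have e2 : y - y' - (d - d') = (y - d) - (y' - d') by rewrite !opprD !opprK addrACA.
have := rnorm_dist (x - x') (c - c'); have := rnorm_dist (y - y') (d - d').
rewrite e1 e2 cd !ler_norml => /andP[a1 a2] /andP[a3 a4].
have := rnormD (x - c) (- (x' - c')); have := rnormD (y - d) (- (y' - d')).
by rewrite !rnormN => b1 b2; apply/andP; split; lra.
Qed.

Lemma rel_uniq x y y' : rel x y -> rel x y' -> y = y'.
Proof.
by move=> h h'; apply/subr0_eq/rnorm0_eq0; rewrite -(rel_isometry h h') subrr rnorm0.
Qed.

Lemma relD x y x' y' : rel x y -> rel x' y' -> rel (x + x') (y + y').
Proof.
move=> h h' e e0; have e20 : 0 < e / 2 by rewrite divr_gt0.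
have [n [t [h1 h2]]] := h _ e20; have [m [t' [h3 h4]]] := h' _ e20.
exists (n + m)%N, (Add t t') => /=; rewrite [e]splitr.
by split; rewrite opprD addrACA; apply: le_lt_trans (rnormD _ _) _; exact: ltrD.
Qed.

Lemma relZ l x y : rel x y -> rel (l *: x) (l *: y).
Proof.
move=> h e e0; have l0 : 0 < cabs l + 1 by rewrite ltr_wpDl// cabs_ge0.
have [n [t [h1 h2]]] := h _ (divr_gt0 e0 l0); have [m lm] := scale_sort l n.
have key z : 0 <= z -> z < e / (cabs l + 1) -> cabs l * z < e.
  move=> z0; rewrite ltr_pdivlMr// mulrC => ze; apply: le_lt_trans ze.
  by rewrite ler_wpM2r// lerDl.
exists m, (Scale lm t); rewrite /= -!scalerBr !rnormZ.
by split; apply: key => //; exact: rnorm_ge0.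
Qed.

Lemma relS x y : rel x y -> rel (cstar x) (cstar y).
Proof.
move=> h e e0; have [n [t [h1 h2]]] := h _ e0.
by exists n, (Star t); rewrite /= -!cstarB !rnorm_cstar.
Qed.

Lemma rel1 h : rel (cone A h) (cone B h).
Proof. by move=> e e0; exists 1%N, (One R consts h); rewrite /= !subrr !rnorm0. Qed.

Lemma rnorm_mul_dist (C : cstarAlg R u) (x x' c c' : C) d : d <= 1 ->
  rnorm (x - c) < d -> rnorm (x' - c') < d ->
  rnorm (cmul x x' - cmul c c') <= (rnorm x + rnorm x' + 1) * d.
Proof.
move=> d1 h h'; have cn : rnorm c' <= rnorm x' + 1.
  have := rnorm_dist x' c'; rewrite ler_norml => /andP[? _]; lra.
have -> : cmul x x' - cmul c c' = cmul x (x' - c') + cmul (x - c) c'.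
  by rewrite cmulBr cmulBl addrA subrK.
rewrite (le_trans (rnormD _ _))// -addrA mulrDl lerD//.
  by rewrite (le_trans (rnorm_cmul _ _))// ler_wpM2l ?rnorm_ge0// ltW.
by rewrite (le_trans (rnorm_cmul _ _))// mulrC ler_pM ?rnorm_ge0// ltW.
Qed.

Lemma relM x y x' y' : rel x y -> rel x' y' -> rel (cmul x x') (cmul y y').
Proof.
(* [K] dominates the Lipschitz factors in both algebras; dividing by [K + e] gives [d <= 1] as well
   as [K * d < e]. *)
move=> h h' e e0; pose K := rnorm x + rnorm x' + rnorm y + rnorm y' + 1.
have [x0 x'0 y0 y'0] : [/\ 0 <= rnorm x, 0 <= rnorm x', 0 <= rnorm y & 0 <= rnorm y'].
  by rewrite !rnorm_ge0.
have K0 : 0 < K + e by rewrite /K; lra.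
pose d := e / (K + e); have d0 : 0 < d by rewrite divr_gt0.
have d1 : d <= 1 by rewrite ler_pdivrMr// mul1r /K; lra.
have Kd : K * d < e.
  by rewrite mulrA ltr_pdivrMr// mulrDr (mulrC e K) ltrDl mulr_gt0.
have [n [t [h1 h2]]] := h _ d0; have [m [t' [h3 h4]]] := h' _ d0.
exists (n * m)%N, (Mul t t'); split=> /=; apply: le_lt_trans Kd.
  by apply: le_trans (rnorm_mul_dist d1 h1 h3) _; rewrite ler_wpM2r ?(ltW d0)// /K; lra.
by apply: le_trans (rnorm_mul_dist d1 h2 h4) _; rewrite ler_wpM2r ?(ltW d0)// /K; lra.
Qed.

(** A sequence of constants tending to [x] has the same mutual distances in [B], so completeness of
    [B] provides the partner of [x]. *)
Lemma rel_ex (da : sortwise_dense a) x : exists y, rel x y.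
Proof.
have [n xn] := rnorm_le_nat x.
have pos k : 0 < 2^-1 ^+ k / 4 :> R by rewrite divr_gt0// exprn_gt0// invr_gt0.
have /choice[j jP] k : exists j : nat, rnorm (x - sval (@a n j)) < 2^-1 ^+ k / 4.
  exact: ((sortwise_denseP a).1 da n (mkball xn) _ (pos k)).
have [k|y yP] := @geometric_cvg R B (fun k => sval (@b n (j k))).
  have := ab (Sym R u (j k.+1 : consts n)) (Sym R u (j k : consts n)) => /= <-.
  apply: le_trans (rnorm_triangle x _ _) _.
  have := jP k; have := jP k.+1; rewrite rnormB exprSr; have := pos k.
  by move: (2^-1 ^+ k) => q *; lra.
exists y => e e0.
have /cvgrPdist_lt /(_ e e0) [k _ /(_ k (leqnn _))] :
    (fun k => 2 * 2^-1 ^+ k : R) @ \oo --> 0.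
  rewrite -[0](mulr0 2); apply: cvgM; first exact: cvg_cst.
  by apply: cvg_expr; rewrite ger0_norm ?invr_ge0// invf_lt1// ltr1n.
rewrite sub0r normrN => ke; exists n, (Sym R u (j k : consts n)) => /=; split.
  apply: lt_trans (jP k) _; apply: le_lt_trans ke; apply: le_trans (ler_norm _).
  by have := pos k; move: (2^-1 ^+ k) => q *; lra.
by rewrite rnormB; apply: le_lt_trans (yP k) _; apply: le_lt_trans ke; exact: ler_norm.
Qed.

End term_rel.

(** The graph of the isomorphism is the set of pairs approximated by the values of one common term.
    Equal functionals give equal distances between terms, so this relation is single-valued in both
    directions; as terms are closed under the operations, it respects them. *)
Lemma generated_uniq (R : realType) u (T : theory R u) (s : {ptws Sigma R u -> R})
    (A B : cstarAlg R u) (a : assignment consts A) (b : assignment consts B) :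
  generated_by T s a -> generated_by T s b ->
  exists2 f : A -> B, cstar_iso f & forall n i, f (sval (a n i)) = sval (b n i).
Proof.
move=> [mA da sa] [mB db sb].
have fab : functional a = functional b by rewrite -sa.
have ab : same_norms a b.
  move=> m t n t'; exact: (congr1 (fun F : Sigma R u -> R => F (term_dist t t')) fab).
have ba : same_norms b a by move=> m t n t'; rewrite ab.
pose f x := projT1 (cid (rel_ex ab da x)); pose g y := projT1 (cid (rel_ex ba db y)).
have fP x : term_rel a b x (f x) := projT2 (cid (rel_ex ab da x)).
have gP y : term_rel a b (g y) y := term_relC (projT2 (cid (rel_ex ba db y))).
have fE x y : term_rel a b x y -> f x = y by exact/(rel_uniq ab)/fP.
exists f => [|n i]; last exact/fE/rel_const.
split=> [|k x y| |h|x].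
- exists g => [x|y]; last exact/fE/gP.
  by apply: (rel_uniq ba) (term_relC (fP x)); exact/term_relC/gP.
- by apply/fE/relD => //; exact: relZ.
- by split=> [x y|x]; apply: fE; [exact: relM|exact: relS].
- exact/fE/rel1.
- have f0 : term_rel a b 0 0.
    by rewrite -(scale0r (0 : A)) -(scale0r (0 : B)); have := relZ 0 (fP 0); rewrite !scale0r.
  by have := rel_isometry ab (fP x) f0; rewrite !subr0.
Qed.

(** * Continuity of the values of formulas off a meager set *)

Section generic_continuity.
Context {R : realType} {u : bool} (T : theory R u).
Local Notation X := (set_type (TT T) : topologicalType).
Implicit Types (s t : X) (H : set X) (g : X -> R).

(** This is continuity of the restriction of [g] to [H]: values at points of [W] outside [H] are not
    controlled. *)
Definition continuous_within H g := forall s e, H s -> 0 < e ->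
  exists2 W : set X, open W /\ W s & forall t, H t -> W t -> `|g s - g t| < e.

Definition generically_continuous g := exists2 H, comeager H & continuous_within H g.

Lemma continuous_withinS H H' g : H' `<=` H -> continuous_within H g -> continuous_within H' g.
Proof.
move=> sub cg s e /sub Hs e0; have [W Ws h] := cg s e Hs e0.
by exists W => // t /sub; exact: h.
Qed.

Lemma continuous_within_open H g (W : set R) : open W -> continuous_within H g ->
  exists2 U : set X, open U & forall s, H s -> (U s <-> W (g s)).
Proof.
move=> oW cg; exists (\bigcup_(U in [set U : set X | open U /\
    forall t, H t -> U t -> W (g t)]) U); first by apply: bigcup_open => U [].
move=> s Hs; split=> [[U [_ h] Us]|Ws]; first exact: h.
have /nbhs_ballP[e /= e0 sub] : nbhs (g s) W by apply: open_nbhs_nbhs.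
have [U [oU Us] h] := cg s e Hs e0; exists U => //; split=> // t Ht Ut.
by apply: sub; exact: h.
Qed.

Lemma generically_continuous_ext H g g' : comeager H -> (forall s, H s -> g s = g' s) ->
  generically_continuous g -> generically_continuous g'.
Proof.
move=> cH gg' [H' cH' cg]; exists (H `&` H'); first exact: comeagerI.
move=> s e [Hs H's] e0; have [W Ws h] := cg s e H's e0.
by exists W => // t [Ht H't] Wt; rewrite -!gg'//; exact: h.
Qed.

Lemma generically_continuous_ev phi : generically_continuous (@ev R u T phi).
Proof.
exists setT; first by apply: comeager_open_dense; [exact: openT|move=> W W0 _; rewrite setIT].
move=> s e _ e0; exists [set t | `|ev phi s - ev phi t| < e]; last by [].
split; last by rewrite /= subrr normr0.
rewrite (_ : [set t | _] = [set t | ev phi s - e < ev phi t] `&` [set t | ev phi t < ev phi s + e]).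
  by apply: openI; [exact: open_ev_gt|exact: open_ev_lt].
apply/seteqP; split=> t /=; rewrite ltr_norml.
  by move=> /andP[? ?]; split; lra.
by move=> [? ?]; apply/andP; split; lra.
Qed.

Lemma generically_continuous_opp g : generically_continuous g ->
  generically_continuous (fun s => - g s).
Proof.
move=> [H cH cg]; exists H => // s e Hs e0; have [W Ws h] := cg s e Hs e0.
by exists W => // t Ht Wt; rewrite -opprD normrN; exact: h.
Qed.

Lemma generically_continuous_row k (f : 'rV[R]_k -> R) (g : 'I_k -> X -> R) :
  continuous f -> (forall i, generically_continuous (g i)) ->
  generically_continuous (fun s => f (\row_i g i s)).
Proof.
move=> cf cg; have /choice[H hH] i : exists H, comeager H /\ continuous_within H (g i).
  by have [H h1 h2] := cg i; exists H.
exists (\bigcap_i H i); first by apply: comeager_bigcap => i; exact: (proj1 (hH i)).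
move=> s e Hs e0; have [d d0 dP] := continuous_row (\row_i g i s) cf e0.
have /choice[W WP] i : exists W : set X, [/\ open W, W s &
    forall t, H i t -> W t -> `|g i s - g i t| < d].
  by have [W [h1 h2] h3] := (proj2 (hH i)) s d (Hs i I) d0; exists W.
exists (interior [set t | forall i, W i t]).
  split; first exact: open_interior.
  have h : \forall t \near s, forall i, W i t.
    apply: (@filter_forall X _ W (nbhs s) (@nbhs_filter X s)) => i; have [oW Ws _] := WP i.
    exact: open_nbhs_nbhs.
  exact: h.
move=> t Ht Wt; apply: dP => i; rewrite !mxE.
by case: (WP i) => _ _; apply; [exact: Ht|exact: (interior_subset Wt)].
Qed.

(* A countable supremum of continuous functions is lower semicontinuous, hence
   continuous off the boundaries of the countably many sets [q < sup]. *)
Lemma generically_continuous_sup g (gs : nat -> X -> R) H0 : comeager H0 ->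
  (forall s r, H0 s -> r < g s <-> exists j, r < gs j s) ->
  (forall j, generically_continuous (gs j)) -> generically_continuous g.
Proof.
move=> cH0 gP cgs.
have /choice[H hH] j : exists H, comeager H /\ continuous_within H (gs j).
  by have [H h1 h2] := cgs j; exists H.
pose H1 := H0 `&` \bigcap_j H j.
have cH1 : comeager H1.
  by apply: comeagerI => //; apply: comeager_bigcap => j; exact: (proj1 (hH j)).
have /choice[U UP] (q : rat) : exists U : set X, open U /\
    forall s, H1 s -> (U s <-> ratr q < g s).
  have /choice[V VP] j : exists V : set X, open V /\
      forall s, H1 s -> (V s <-> ratr q < gs j s).
    have sub : H1 `<=` H j by move=> s [_ h]; exact: (h j I).
    have [V oV VE] := continuous_within_open (@open_gt R (ratr q))
      (continuous_withinS sub (proj2 (hH j))).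
    by exists V.
  exists (\bigcup_j V j); split; first by apply: bigcup_open => j _; exact: (proj1 (VP j)).
  move=> s H1s; rewrite gP; last by case: H1s.
  split=> [[j _ Vs]|[j hj]]; first by exists j; apply/(proj2 (VP j)).
  by exists j => //; apply/(proj2 (VP j)).
exists (H1 `&` \bigcap_q (U q `|` ~` closure (U q))).
  apply: comeagerI => //; apply: comeager_bigcap => q; apply: comeager_open_dense.
    apply: openU; first exact: (proj1 (UP q)).
    exact/closed_openC/closed_closure.
  exact/dense_bdyC/(proj1 (UP q)).
move=> s e [H1s Hs] e0.
have [q] : exists q : rat, ratr q \in `]g s - e, g s[ by apply: rat_in_itvoo; lra.
rewrite in_itv/= => /andP[q1 q2].
have [q'] : exists q : rat, ratr q \in `]g s, g s + e[ by apply: rat_in_itvoo; lra.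
rewrite in_itv/= => /andP[q3 q4].
exists (U q `&` ~` closure (U q')).
  split.
    apply: openI; first exact: (proj1 (UP q)).
    exact/closed_openC/closed_closure.
  split; first by apply/(proj2 (UP q) s H1s).
  have [/(proj2 (UP q') s H1s)|//] := Hs q' I.
  by move=> /(lt_trans q3); rewrite ltxx.
move=> t [H1t _] [Uq Uq']; have h1 := (proj2 (UP q) t H1t).1 Uq.
have h2 : g t <= ratr q'.
  rewrite leNgt; apply/negP => /(proj2 (UP q') t H1t) h.
  by apply: Uq'; exact: subset_closure.
by rewrite ltr_norml; apply/andP; split; lra.
Qed.

(** The generated model where there is one, and otherwise any model realizing [s], so that values of
    formulas are functions on the whole space. *)
Definition gen_model s : {A : cstarAlg R u & assignment consts A} :=
  match pselect (generic_set s) with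
  | left h => existT _ (projT1 (cid h)) (projT1 (cid (projT2 (cid h))))
  | right _ => existT _ (projT1 (cid (TT_ex s))) (projT1 (cid (projT2 (cid (TT_ex s)))))
  end.

Lemma gen_modelP s : generic_set s -> generated_by T (set_val s) (projT2 (gen_model s)).
Proof.
move=> h; rewrite /gen_model; case: pselect => // {}h.
exact: projT2 (cid (projT2 (cid h))).
Qed.

Definition gval V (phi : formula R u V) (rho : forall n, V n -> nat) s : R :=
  feval (pull rho (projT2 (gen_model s))) phi.

Hypothesis cG : comeager (@generic_set R u T).

(** On generic functionals an atomic formula at constants is evaluation at an element of [Sigma],
    and a quantifier is a countable supremum or infimum over constants. Each step discards a meager
    set only. *)
Lemma gval_continuous V (phi : formula R u V) rho : generically_continuous (gval phi rho).
Proof.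
elim: phi rho => {V} [V n t1 t2|V k f cf args IH|V n phi IH|V n phi IH] rho.
- have [chi chiP] := @subst_qfree R u V rho (Dist t1 t2) I.
  apply: (generically_continuous_ext cG _ (generically_continuous_ev chi)) => s Gs.
  by have [_ _ sE] := gen_modelP Gs; rewrite (evE _ sE) chiP.
- exact: (generically_continuous_row cf (fun i => IH i rho)).
- apply: (generically_continuous_sup (gs := fun j => gval phi (ren_ext rho n j)) cG) => // s r Gs.
  by have [_ ds _] := gen_modelP Gs; exact: sup_gtP.
- have h : generically_continuous (gval (Sup (fneg phi)) rho).
    apply: (generically_continuous_sup
      (gs := fun j => gval (fneg phi) (ren_ext rho n j)) cG) => [s r Gs|j].
      by have [_ ds _] := gen_modelP Gs; exact: sup_gtP.
    apply: (generically_continuous_ext cG _ (generically_continuous_opp (IH (ren_ext rho n j)))).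
    by move=> s _; rewrite /gval feval_neg.
  apply: (generically_continuous_ext cG _ (generically_continuous_opp h)) => s _.
  rewrite /gval; set b := pull rho _.
  rewrite -[LHS]/(- sup (range (fun x => feval (extend b x) (fneg phi)))).
  rewrite -[RHS]/(inf (range (fun x => feval (extend b x) phi))) inf_range.
  by congr (- sup _); apply: eq_imagel => x _; rewrite feval_neg.
Qed.

End generic_continuity.

(** * Transfer between models of a complete theory *)

Section named_quantifiers.
Context {R : realType} {u : bool}.
Implicit Types A : cstarAlg R u.

Definition update A (a : assignment consts A) n (j : nat) (x : cball A n) :
    assignment consts A := fun m (i : nat) =>
  match n =P m with
  | ReflectT e => if i == j then eq_rect n (cball A) x m e else a m i
  | ReflectF _ => a m i
  end.

#[global] Arguments update {A} a {n} j x m i : rename.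

Lemma update_eq A (a : assignment consts A) n j (x : cball A n) :
  update a j x n j = x.
Proof.
by rewrite /update; case: eqP => // e; rewrite (eq_axiomK e) eqxx.
Qed.

Lemma update_neq A (a : assignment consts A) n (j : nat) (x : cball A n) m (i : nat) :
  (m, i) != (n, j) -> update a j x m i = a m i.
Proof.
move=> /eqP mi; rewrite /update; case: eqP => // e; case: eqP => // ij.
by case: mi; rewrite e ij.
Qed.

Lemma inf_const (phi : formula R u consts) n (j : nat) :
  exists psi : formula R u consts, forall A (a : assignment consts A),
    feval a psi = inf (range (fun x : cball A n => feval (update a j x) phi)).
Proof.
pose sigma m (i : nat) : term R u (ext consts n) m :=
  match n =P m with
  | ReflectT e => if i == j then eq_rect n (term R u (ext consts n)) (Sym R u (New consts n)) m e
                  else Sym R u (Old n (i : consts m))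
  | ReflectF _ => Sym R u (Old n (i : consts m))
  end.
have [psi _ psiP] := subst_formula (sigma : forall m, consts m -> _) phi.
exists (Inf psi) => A a /=; congr inf; apply: eq_imagel => x _; apply: psiP => m i.
rewrite /update /sigma; case: eqP => // e; subst m.
by case: eqP.
Qed.

Definition agree_off (L : seq (nat * nat)) A (a b : assignment consts A) :=
  forall m (i : nat), (m, i) \notin L -> a m i = b m i.

(** The constants of [L] are quantified away one at a time. The second half forgets that [b] agrees
    with [a] off [L]: transfer needs only that some assignment exists. *)
Lemma infs_consts (phi : formula R u consts) (L : seq (nat * nat)) :
  exists psi : formula R u consts, forall A (a : assignment consts A) r,
    (forall b, agree_off L a b -> feval b phi < r -> feval a psi < r) /\
    (feval a psi < r -> exists b : assignment consts A, feval b phi < r).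
Proof.
elim: L => [|[n j] L [psi IH]].
  exists phi => A a r; split=> [b ab|]; last by exists a.
  suff -> : a = b by [].
  by apply: functional_extensionality_dep => m; apply/funext => i; exact: ab.
have [psi' psi'P] := inf_const psi n j.
have [K KP] := feval_bound psi.
exists psi' => A a r; rewrite psi'P inf_range; set F := fun x => - _.
have FK x : `|F x| <= K by rewrite normrN.
split=> [b ab br|h].
  have [h _] := IH A (update a j (b n j)) r.
  have : feval (update a j (b n j)) psi < r.
    apply: (h b) => // m i miL.
    have [[-> ->]|mi] := eqVneq (m, i) (n, j); first exact: update_eq.
    by rewrite update_neq// ab// inE negb_or mi.
  have := le_sup_range (cball0 A n) FK (b n j); rewrite [F (b n j)]/F.
  by move: (sup (range F)) => s *; lra.
have e0 : 0 < r + sup (range F) by rewrite -ltrBlDr sub0r.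
have [x xP] := sup_range_adherent (cball0 A n) FK e0.
have [_ h2] := IH A (update a j x) r; apply: h2.
by move: xP; rewrite [F x]/F => xP; move: (sup (range F)) xP {h e0} => s *; lra.
Qed.

Lemma consts_zero (phi : formula R u consts) :
  exists psi : sentence R u, forall A,
    sentval A psi = feval (fun n (_ : consts n) => cball0 A n) phi.
Proof.
have [psi _ psiP] := subst_formula
  (fun n (_ : consts n) => Incl (leq0n n) (Zero R u nosyms)) phi.
by exists psi => A; exact: psiP.
Qed.

(** Up to [e] the formula depends on finitely many constants. Setting the others to 0 and taking the
    infimum over these produces a sentence, whose value is the same in [A] and [M]. *)
Lemma complete_transfer (T : theory R u) (A M : cstarAlg R u) (a : assignment consts A)
    (phi : formula R u consts) r : complete_theory T -> models A T -> models M T ->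
  feval a phi < r -> exists b : assignment consts M, feval b phi < r.
Proof.
move=> cT mA mM h; pose e := (r - feval a phi) / 2.
have e0 : 0 < e by rewrite divr_gt0// subr_gt0.
(* Ranking by [maxn n j] leaves finitely many constants below [N] over all sorts together; they are
   listed in [L]. *)
have [N [d d0 dP]] := feval_continuous phi (fun n (j : consts n) => maxn n j) e0.
pose L := [seq (n, j) | n <- iota 0 N, j <- iota 0 N].
have [psi psiP] := infs_consts phi L; have [sig sigP] := consts_zero psi.
pose z (B : cstarAlg R u) : assignment consts B := fun n _ => cball0 B n.
pose a' : assignment consts A := fun n (j : nat) =>
  if (maxn n j < N)%N then a n j else cball0 A n.
have h1 : feval a' phi < r.
  have : `|feval a phi - feval a' phi| <= e.
    by apply: dP => n v vN; rewrite /a' vN subrr rnorm0 ltW.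
  by rewrite ler_norml /e => /andP[? ?]; lra.
have h2 : sentval A sig < r.
  rewrite sigP; apply: (proj1 (psiP A (z A) r)) h1 => m i miL.
  rewrite /a'; case: ifPn => //; rewrite gtn_max => /andP[mN iN].
  by case/negP: miL; apply: allpairs_f; rewrite mem_iota.
rewrite (cT A M mA mM) sigP in h2.
exact: (proj2 (psiP M (z M) r)) h2.
Qed.

Lemma sum_dist_continuous k (r : 'I_k -> R) :
  continuous (fun v : 'rV[R]_k => \sum_(i < k) `|v 0 i - r i|).
Proof.
move=> v; have c (i : 'I_k) : (fun w : 'rV[R]_k => `|w 0 i - r i|) @ v --> `|v 0 i - r i|.
  exact: (cvg_norm (cvgB (@coord_continuous R 1 k 0 i v) (cvg_cst _))).
exact: (@cvg_big R _ +%R 0 xpredT add_continuous _ (nbhs v) _ _ _ (@nbhs_filter _ v)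
  (fun i _ => c i)).
Qed.

(** Closeness on a countable dense list of formulas determines weak* convergence, and finitely many
    of them at a time can be matched in [M] by transfer. *)
Lemma complete_functional_dense (T : theory R u) (A M : cstarAlg R u)
    (a : assignment consts A) (mA : models A T) (mM : models M T)
    (W : set (set_type (TT T))) : complete_theory T ->
  open W -> W (mkTT a mA) -> exists b : assignment consts M, W (mkTT b mM).
Proof.
move=> cT oW Wa; have [g _ gP] := formulas_separable naming_consts (@setT (formula R u consts)).
pose D k := odflt (Dist (Zero R u consts) (Zero R u consts)) (g k).
have ex N : exists b : assignment consts M, forall k : 'I_N.+1,
    `|feval b (D k) - feval a (D k)| < N.+1%:R^-1.
  (* The values at [a] enter as real parameters of a connective: [psi] vanishes at [a], and a small
     value elsewhere makes the first [N.+1] formulas nearly agree with those values. *)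
  pose psi := Conn (@sum_dist_continuous N.+1 (fun i => feval a (D i))) (fun i => D i).
  have psiE B (b : assignment consts B) :
      feval b psi = \sum_(i < N.+1) `|feval b (D i) - feval a (D i)|.
    by rewrite /=; apply: eq_bigr => i _; rewrite mxE.
  have [|b] := @complete_transfer T A M a psi N.+1%:R^-1 cT mA mM.
    by rewrite psiE big1 ?invr_gt0// => i _; rewrite subrr normr0.
  rewrite psiE => h; exists b => k; apply: le_lt_trans h.
  by rewrite (bigD1 k)//= lerDl sumr_ge0.
have [b bP] := choice ex.
have cx : (fun N => mkTT (b N) mM) @ \oo --> mkTT a mA.
  apply: ptws_cvg => phi; apply/cvgrPdist_lt => e e0.
  have e30 : 0 < e / 3 by rewrite divr_gt0.
  have [k [psi [kE kP]]] := gP (sval phi) _ I e30.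
  have [m me] := inv_succ_le e30.
  exists (maxn k m) => // N /=; rewrite geq_max => /andP[kN mN].
  rewrite (evE (a := a))// (evE (a := b N))//.
  have := bP N (Ordinal (kN : (k < N.+1)%N)); rewrite /D /= kE /= => h.
  have := kP A a; have := kP M (b N).
  have : N.+1%:R^-1 <= e / 3.
    by apply: le_trans me; rewrite lef_pV2 ?posrE// ler_nat.
  move: h; set q := N.+1%:R^-1; move: q => q; rewrite !ler_norml !ltr_norml.
  by move=> /andP[? ?] ? /andP[? ?] /andP[? ?]; apply/andP; split; lra.
have [N _ WN] : \forall N \near \oo, W (mkTT (b N) mM).
  by apply: cx; exact: open_nbhs_nbhs.
by exists (b N); apply: WN => /=.
Qed.

End named_quantifiers.

(** * Properties defined by uniform families of existential formulas *)

Section definable_conditions.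
Context {R : realType} {u : bool} (T : theory R u).
Local Notation X := (set_type (TT T) : topologicalType).
Implicit Types (s : X) (A B : cstarAlg R u).

Variables (P : cstarAlg R u -> Prop) (T' : theory R u) (xs : nat -> seq nat)
  (F : forall n, set (formula R u (exts nosyms (xs n)))).
Arguments F : clear implicits.
Hypotheses (uniF : forall n, uniform_family T' (F n))
  (exiF : forall n phi, F n phi -> existential phi)
  (PE : forall A, P A <-> models A T' /\
          forall n (a : assignment (exts nosyms (xs n)) A),
            ereal_inf [set (feval a phi)%:E | phi in F n] = 0%E).

(** The infimum over the family and the existential quantifiers merge into one existential choice of
    a member and of constants [l']. This yields a union of open sets for each fixed tuple [l] of
    constants. *)
Definition def_cond (n : nat) (l : seq nat) (m : nat) : set X :=
  [set s | exists chi : Sigma R u,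
    (exists phi ys (psi : formula R u (exts (exts nosyms (xs n)) ys)) l',
      [/\ F n phi, phi = infs psi & forall A (a : assignment consts A),
        feval a (sval chi) =
        feval (pull (ren_exts (ren_exts ren_none (xs n) l) ys l') a) psi]) /\
    ev chi s < m.+1%:R^-1].

Lemma open_def_cond n l m : open (def_cond n l m).
Proof.
apply: open_exists => chi; set C := exists phi, _; have [h|h] := pselect C.
  rewrite (_ : (fun=> _) = [set s | ev chi s < m.+1%:R^-1]); first exact: open_ev_lt.
  by apply/seteqP; split=> s /= => [[]|].
rewrite (_ : (fun=> _) = set0); first exact: open0.
by apply/seteqP; split=> s //= [].
Qed.

Lemma def_cond_holds s A (a : assignment consts A) n l m :
  generated_by T (set_val s) a -> P A -> def_cond n l m s.
Proof.
move=> [_ da sa] /PE[_ /(_ n (pull (ren_exts ren_none (xs n) l) a)) h].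
have : (ereal_inf [set (feval (pull (ren_exts ren_none (xs n) l) a) phi)%:E | phi in F n]
   < m.+1%:R^-1%:E)%E by rewrite h lte_fin invr_gt0.
move=> /ereal_inf_lt[_ [phi Fphi <-]]; rewrite lte_fin => phi_lt.
have [ys [psi [q _ phiE]]] := exiF Fphi.
move: phi_lt; rewrite phiE => /(infs_ltP da)[l' hl'].
have [chi chiP] := subst_qfree (ren_exts (ren_exts ren_none (xs n) l) ys l') q.
exists chi; split; first by exists phi, ys, psi, l'.
by rewrite (evE _ sa) chiP.
Qed.

Lemma adist_small A n (a b : assignment (exts nosyms (xs n)) A) d : 0 <= d ->
  (forall k v, rnorm (sval (a k v) - sval (b k v)) <= d) -> 0 <= adist a b <= d.
Proof.
move=> d0 h; rewrite /adist; set S := [set r | _].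
have Sd r : S r -> 0 <= r <= d by move=> [k [v ->]]; rewrite rnorm_ge0/=; exact: h.
(* Without free variables there are no distances, and the supremum is 0 by convention. *)
have [S0|/set0P[r Sr]] := eqVneq S set0; first by rewrite S0 sup0 lexx.
have /andP[r0 _] := Sd r Sr; have bS : has_sup S.
  by split; [exists r|exists d => t /Sd/andP[]].
apply/andP; split; first by apply: le_trans r0 _; exact: sup_upper_bound.
by apply: ge_sup => [|t /Sd/andP[]]; first by exists r.
Qed.

(** The conditions concern tuples of constants, and the member of the family that is small depends
    on the tuple. A modulus common to the family is therefore what allows an arbitrary tuple to be
    replaced by nearby constants beforehand. *)
Lemma conds_definable s A (a : assignment consts A) :
  generated_by T (set_val s) a -> models A T' ->
  (forall n l m, def_cond n l m s) -> P A.
Proof.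
move=> [_ da sa] mA h; apply/PE; split=> // n b.
have [_ nnF [w [w0 w_ge0 wc] wP]] := uniF n.
apply/eqP; rewrite eq_le; apply/andP; split; last first.
  by apply: le_ereal_inf_tmp => _ [phi Fphi <-]; rewrite lee_fin; exact: nnF.
apply/lee_addgt0Pr => e e0; rewrite add0e.
have e20 : 0 < e / 2 by rewrite divr_gt0.
(* A modulus is not assumed monotone, so it is bounded on a whole interval; its one-sided limit
   excludes 0, where [w 0 = 0] is used instead. *)
have [d d0 dw] : exists2 d, 0 < d & forall t, 0 <= t <= d -> w t < e / 2.
  have := wc => /cvgrPdist_lt/(_ _ e20); rewrite near_withinE.
  rewrite -filter_from_ballE => -[d /= d0 hd]; exists (d / 2); first by rewrite divr_gt0.
  move=> t /andP[]; rewrite le_eqVlt => /orP[/eqP <-|t0 td]; first by rewrite w0.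
  have := hd t; rewrite -ball_normE/= !sub0r !normrN => hd'.
  by apply: le_lt_trans (ler_norm _) (hd' _ t0); rewrite ger0_norm ?ltW//; lra.
have [l hl] := assignment_dense_none da b d0.
have [m me] := inv_succ_le e20.
have [chi [[phi [ys [psi [l' [Fphi phiE chiP]]]]]]] := h n l m.
rewrite (evE _ sa) chiP => psi_lt.
have : feval (pull (ren_exts ren_none (xs n) l) a) phi < m.+1%:R^-1.
  by rewrite phiE; apply/(infs_ltP da); exists l'.
move: me; set q := m.+1%:R^-1; move: q => q qe phi_lt.
have h1 := wP phi Fphi A mA b (pull (ren_exts ren_none (xs n) l) a).
have h2 := dw _ (adist_small (ltW d0) hl).
apply: le_trans (ereal_inf_lbound _) _; first by exists phi.
by rewrite lee_fin; move: h1; rewrite ler_norml => /andP[? ?]; lra.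
Qed.

End definable_conditions.

(** * The dense G-delta set and the subset defined by the property *)

Lemma Gdelta_bigcap (X : topologicalType) (J : countType) (V : J -> set X) :
  (forall j, open (V j)) -> Gdelta (\bigcap_j V j).
Proof.
move=> oV; exists (fun m => if unpickle m is Some j then V j else setT).
  by move=> m; case: unpickle => [j|]; [exact: oV|exact: openT].
apply/seteqP; split=> x h => [m _|j _].
  by case: unpickle => [j|//]; exact: h.
by have := h (pickle j) I; rewrite pickleK.
Qed.

Lemma open_set_val (X : topologicalType) (G : set X) (W : set X) :
  open W -> open [set s : set_type G | W (set_val s)].
Proof. by move=> oW; exists W. Qed.

Theorem theorem6p3p1 (R : realType) (u : bool) (T : theory R u)
    (P : cstarAlg R u -> Prop) (hT : AE_axiomatizable T) (hP : definable P)
    (hTP : exists2 A : cstarAlg R u, models A T & P A) :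
  exists (G : set (TT T)) (As : G -> cstarAlg R u)
         (as_ : forall s : G, assignment consts (As s)),
    [/\ Gdelta G /\ dense G,
        forall s : G, generated_by T (set_val (set_val s)) (as_ s) /\
          forall (B : cstarAlg R u) (b : assignment consts B),
            generated_by T (set_val (set_val s)) b ->
            exists2 f : As s -> B, cstar_iso f &
              forall n i, f (sval (as_ s n i)) = sval (b n i),
        Gdelta [set s : G | P (As s)] &
        complete_theory T -> dense [set s : G | P (As s)]].
Proof.
have [T0 T0AE T0E] := hT; have [T' [xs [F [uniF exiF PE]]]] := hP.
pose X : topologicalType := set_type (TT T).
have cG : comeager (@generic_set R u T).
  rewrite (generic_setE T0AE T0E); apply: comeager_bigcap => i.
  apply: comeager_open_dense; first exact: open_generic_opens.
  move=> W W0 oW; have [s [Ws Gs]] := @generic_dense R u T W W0 oW.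
  by exists s; split=> //; move: Gs; rewrite (generic_setE T0AE T0E); apply.
have [g gT' gP] := formulas_separable naming_none T'.
(* The sentences listed by [g] are dense in [T'], so their values in the generated models decide
   which of these satisfy [T']. An index without a sentence gets the value 0, which imposes
   nothing. *)
pose val k (s : X) := if g k is Some sig then gval (T := T) sig ren_none s else 0.
have /choice[H HP] k : exists H : set X, comeager H /\ continuous_within H (val k).
  have [H cH cg] : generically_continuous (val k).
    rewrite /val; case: (g k) => [sig|]; first exact: gval_continuous.
    by exists setT; [exact: comeagerS (@subsetT _ _) cG|move=> s e _ e0; exists setT;
      [split=> //; exact: openT|move=> t _ _; rewrite subrr normr0]].
  by exists H.
have [D DP DG] : comeager (@generic_set R u T `&` \bigcap_k H k).
  by apply: comeagerI => //; apply: comeager_bigcap => k; exact: (proj1 (HP k)).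
(* The open dense sets inside the comeager set are intersected, rather than that set being taken
   itself, so that [G] is a G-delta. *)
pose G : set X := \bigcap_k D k.
have Ggen (s : set_type G) : generic_set (set_val s) by have [] := DG _ (set_mem (valP s)).
have GH (s : set_type G) k : H k (set_val s).
  by have [_] := DG _ (set_mem (valP s)); apply.
have Gm (s : set_type G) : generated_by T (set_val (set_val s)) (projT2 (gen_model (set_val s))).
  exact: gen_modelP.
have cD : comeager G by exists D.
exists G, (fun s => projT1 (gen_model (set_val s))), (fun s => projT2 (gen_model (set_val s))).
have PEs (s : set_type G) : P (projT1 (gen_model (set_val s))) <->
    models (projT1 (gen_model (set_val s))) T' /\
    forall n l m, def_cond (T := T) F n l m (set_val s).
  split=> [Ps|[mA h]]; last exact: (conds_definable uniF PE (Gm s) mA h).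
  split=> [|n l m]; first by have /PE[] := Ps.
  exact: (def_cond_holds exiF PE n l m (Gm s) Ps).
split.
- split; first by exists D => // k; exact: (proj1 (DP k)).
  exact: (comeager_dense (@TT_compact R u T) (@TT_hausdorff R u T) cD).
- by move=> s; split=> // B b; exact: generated_uniq.
(* By continuity on [H], each bound on the value of a listed sentence is the trace on [G] of an open
   set [V]; satisfying [T'] thus becomes a countable intersection of open conditions. *)
- have /choice[V VP] (p : nat * nat) : exists V : set X, open V /\
      forall s, H p.1 s -> (V s <-> `|val p.1 s| < p.2.+1%:R^-1).
    have oB : open [set r : R | `|r| < p.2.+1%:R^-1].
      apply: open_comp (@open_lt R _) => r _; exact: norm_continuous.
    have [V oV VE] := continuous_within_open oB (proj2 (HP p.1)).
    by exists V.
  rewrite (_ : [set s : set_type G | _] = \bigcap_(j : nat * nat + nat * seq nat * nat)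
    [set s : set_type G | match j with
      | inl p => V p (set_val s)
      | inr (n, l, m) => def_cond (T := T) F n l m (set_val s) end]).
    apply: Gdelta_bigcap => -[p|[[n l] m]]; apply: open_set_val.
      exact: (proj1 (VP p)).
    exact: open_def_cond.
  apply/seteqP; split=> s /=.
    move=> /PEs[mA h] [p|[[n l] m]] _ /=; last exact: h.
    apply/(proj2 (VP p) _ (GH s p.1)).
    rewrite /val; case E : (g p.1) => [sig|]; last by rewrite normr0 invr_gt0.
    have := mA _ (gT' _ _ E); rewrite /sentval /gval pull_none => ->.
    by rewrite normr0 invr_gt0.
  move=> h; apply/PEs; split=> [sig Tsig|n l m]; last exact: (h (inr (n, l, m)) I).
  apply/eqP; rewrite -normr_le0; apply/ler_addgt0Pr => e e0; rewrite add0r.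
  have e20 : 0 < e / 2 by rewrite divr_gt0.
  have [k [sig' [kE kP]]] := gP _ _ Tsig e20; have [m me] := inv_succ_le e20.
  have := (proj2 (VP (k, m)) _ (GH s k)).1 (h (inl (k, m)) I).
  rewrite /val /= kE /gval pull_none => h1.
  have := kP _ (noassign (projT1 (gen_model (set_val s)))).
  rewrite /sentval; set x := feval _ sig; set y := feval _ sig'.
  have := ler_normD (x - y) y; rewrite subrK => h2 h3.
  by rewrite (le_trans h2)// [e]splitr lerD// (le_trans (ltW h1)).
- move=> cT W [s0 Ws0] [W' oW' WE].
  have [M mM PM] := hTP; have [mM' FM] := (PE M).1 PM.
  (* Completeness makes every sentence of [T'] vanish in all models of [T], as it does in [M], so
     only the existential conditions remain to be made dense. *)
  have mT' (A : cstarAlg R u) : models A T -> models A T'.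
    by move=> mA phi Tphi; rewrite (cT A M mA mM); exact: mM'.
  have dQ (Q : nat * seq nat * nat) : dense (def_cond (T := T) F Q.1.1 Q.1.2 Q.2).
    move=> U [s Us] oU; have [A [a [mA sa]]] := TT_ex s.
    have sE : s = mkTT a mA by apply: val_inj.
    rewrite sE in Us.
    have [b Ub] := complete_functional_dense mM cT oU Us.
    have [B [f [hf [b' [mB [el db Ub']]]]]] := separable_model oU Ub.
    exists (mkTT b' mB); split=> //.
    have gB : generated_by T (set_val (mkTT b' mB)) b' by [].
    apply: (def_cond_holds exiF PE _ _ _ gB); apply/PE; split; first exact: mT'.
    (* [B] is elementary in [M], so each tuple of [B] takes the same values on the family as its
       image in [M]. *)
    move=> n c; rewrite -(FM n (push hf c)); congr ereal_inf.
    by apply: eq_imagel => phi _; rewrite (el _ (naming_exts naming_none (xs n))).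
  (* Density relative to [G] is obtained in the whole compact space, where Baire's theorem applies,
     because [W] is the trace of the open set [W']. *)
  have cQ : comeager (G `&` \bigcap_(Q : nat * seq nat * nat) def_cond (T := T) F Q.1.1 Q.1.2 Q.2).
    apply: comeagerI => //; apply: comeager_bigcap => Q.
    by apply: comeager_open_dense; [exact: open_def_cond|exact: dQ].
  have [|x [W'x [Gx Qx]]] := comeager_dense (@TT_compact R u T) (@TT_hausdorff R u T) cQ _ oW'.
    by exists (set_val s0); move: Ws0; rewrite -WE.
  exists (exist _ x (mem_set Gx)); split; first by rewrite -WE.
  apply/PEs; split=> [|n l m]; last exact: (Qx (n, l, m) I).
  by apply: mT'; case: (Gm (exist _ x (mem_set Gx))).
Qed.
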